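(* Let $h_\nu(x)=I_{\nu-1}(x)/I_\nu(x)$ (case $j=I$) or $h_\nu(x)=K_{\nu+1}(x)/K_\nu(x)$ (case $j=K$). Let $x_*>0$ and $B(\alpha,\beta,\gamma,x)=(\alpha+\sqrt{\beta^2+\gamma^2x^2})/x$, with $\alpha$, $\beta$ and $\gamma$ determined by the following three conditions: (i) interpolatory conditions at $x_*$: $h_\nu(x_* )=B(\alpha,\beta,\gamma,x_* )$ and $h_\nu'(x_* )=B'(\alpha,\beta,\gamma,x_* )$; (ii) sharpness condition: $\lim_{x\to x_s}h_\nu(x)/B(\alpha,\beta,\gamma,x)=1$, where either $x_s=0^+$ or $x_s=+\infty$. Denote $B^{(j)}_\nu(x_s,x_*,x)=B(\alpha,\beta,\gamma,x)$ for this choice of coefficients (writing $0$ for $x_s=0^+$). Then the following holds for $x>0$: 1. $B^{(I)}_\nu(+\infty,x_*,x)\le I_{\nu-1}(x)/I_\nu(x)\le B^{(I)}_\nu(0,x_*,x)$; 2. $B^{(K)}_\nu(0,x_*,x)\le K_{\nu+1}(x)/K_\nu(x)\le B^{(K)}_\nu(+\infty,x_*,x)$; where the equality only takes place at $x=x_*$. The inequalities are valid for the following values of $\nu$ in each particular case ($\nu\ge1/2$ in the worst case for $I_{\nu-1}/I_\nu$ and $\nu\ge2$ in the worst case for $K_{\nu+1}/K_\nu$): - lower bound for $I_{\nu-1}/I_\nu$: $\nu\ge\frac12-\lambda$, where $\alpha=\nu-\frac12-\lambda$, $\gamma=1$, $\lambda\in(0,1/2)$; - upper bound for $I_{\nu-1}/I_\nu$: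 $\nu\ge0$, where $\alpha=\nu-\lambda$, $\beta=\nu+\lambda$, $\lambda\in(1/2,2)$; - upper bound for $K_{\nu+1}/K_\nu$: $\nu>1/2$, where $\alpha=\nu+\frac12+\lambda$, $\gamma=1$, $0<\lambda<\min\{\frac12,\nu-\frac12\}$; - lower bound for $K_{\nu+1}/K_\nu$: $\nu\ge\lambda$, where $\alpha=\nu+\lambda$, $\beta=\nu-\lambda$, $\lambda\in(1/2,2)$. In addition, in a certain range of $\nu$ (at least $\nu\ge1/2$), $$\lim_{x_*\to0^+}B^{(I)}_\nu(0,x_*,x)=B\Big(\nu-2,\nu+2,\sqrt{\tfrac{\nu+2}{\nu+1}},x\Big),\quad \lim_{x_*\to+\infty}B^{(I)}_\nu(0,x_*,x)=B(\nu-\tfrac12,\nu+\tfrac12,1,x),$$ $$\lim_{x_*\to0^+}B^{(I)}_\nu(+\infty,x_*,x)=B(\nu-1,\nu+1,1,x),\quad \lim_{x_*\to+\infty}B^{(I)}_\nu(+\infty,x_*,x)=B\Big(\nu-\tfrac12,\sqrt{\nu^2-\tfrac14},1,x\Big),$$ and the bounds $B^{(K)}_\nu$ satisfy the analogous relations in a certain range of $\nu$ ($\nu\ge2$ in the worst case): $$\lim_{x_*\to0^+}B^{(K)}_\nu(0,x_*,x)=B\Big(\nu+2,\nu-2,\sqrt{\tfrac{\nu-2}{\nu-1}},x\Big),\quad \lim_{x_*\to+\infty}B^{(K)}_\nu(0,x_*,x)=B(\nu+\tfrac12,\nu-\tfrac12,1,x),$$ $$\lim_{x_*\to0^+}B^{(K)}_\nu(+\infty,x_*,x)=B(\nu+1,\nu-1,1,x),\quad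 \lim_{x_*\to+\infty}B^{(K)}_\nu(+\infty,x_*,x)=B\Big(\nu+\tfrac12,\sqrt{\nu^2-\tfrac14},1,x\Big).$$
   Context: $I_\nu$ and $K_\nu$ denote the modified Bessel functions of the first and second kind of order $\nu$. Primes denote derivatives with respect to $x$. $B$ depends on $\beta$ and $\gamma$ only through $\beta^2$ and $\gamma^2$, so the signs of $\beta$ and $\gamma$ are immaterial. In the list of ranges, $\lambda$ is the parameter that labels the bound through its coefficient $\alpha$ as indicated.
   Formalization: In the upper bound for I_{ν-1}/I_ν at ν=0 the sharpness condition (ii) at 0+ is replaced by the listed form α=-λ, β=λ, since there (i) and (ii) together over-determine the coefficients and have no solution, e.g. for large x_*. *)

(* Defs.v *)
From Stdlib Require Import Reals Factorial.
From Coquelicot Require Export Coquelicot.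

Local Open Scope R_scope.

(* Reciprocal Gamma function 1/Gamma(z), for every real z, by Euler's limit
     Gamma(z) = lim_n  n! n^z / (z (z+1) ... (z+n));
   it vanishes at the poles 0, -1, -2, ... of Gamma. *)
Definition rgamma (z : R) : R :=
  real (Lim_seq (fun n => prod_f_R0 (fun k => z + INR k) n
                          / (INR (fact n) * Rpower (INR n) z))).

(* Both Bessel functions are meaningful for x > 0 only; the order nu is any
   real number (order -1 occurs below, and I_{-1} = I_1). *)
Definition BesselI (nu x : R) : R :=
  Rpower (x / 2) nu *
  Series (fun k => (x / 2) ^ (2 * k) * rgamma (nu + INR k + 1) / INR (fact k)).

(* K_nu(x) = int_0^{+oo} e^{- x cosh t} cosh (nu t) dt, the standard integral
   definition, valid for all real nu (integers included) and all x > 0. *)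
Definition BesselK (nu x : R) : R :=
  RInt_gen (fun t => exp (- x * cosh t) * cosh (nu * t))
           (at_point 0) (Rbar_locally p_infty).

Definition ratioI (nu x : R) : R := BesselI (nu - 1) x / BesselI nu x.
Definition ratioK (nu x : R) : R := BesselK (nu + 1) x / BesselK nu x.

Definition B (alpha beta gamma x : R) : R :=
  (alpha + sqrt (beta ^ 2 + gamma ^ 2 * x ^ 2)) / x.

Definition interpolates (h : R -> R) (xs alpha beta gamma : R) : Prop :=
  h xs = B alpha beta gamma xs /\
  Derive h xs = Derive (B alpha beta gamma) xs.

(* The filter F stands for the point x_s: at_right 0 or Rbar_locally p_infty. *)
Definition sharp (F : (R -> Prop) -> Prop) (h : R -> R)
    (alpha beta gamma : R) : Prop :=
  filterlim (fun x => h x / B alpha beta gamma x) F (locally 1).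

Definition best_coeffs (F : (R -> Prop) -> Prop) (h : R -> R)
    (xs alpha beta gamma : R) : Prop :=
  interpolates h xs alpha beta gamma /\ sharp F h alpha beta gamma.

(* beta and gamma are determined up to sign only. *)
Definition determined (F : (R -> Prop) -> Prop) (h : R -> R) (xs : R) : Prop :=
  (exists alpha beta gamma, best_coeffs F h xs alpha beta gamma) /\
  (forall a b c a' b' c',
     best_coeffs F h xs a b c -> best_coeffs F h xs a' b' c' ->
     a = a' /\ b ^ 2 = b' ^ 2 /\ c ^ 2 = c' ^ 2).

Definition lower_bound_touching (f h : R -> R) (xs : R) : Prop :=
  forall x, 0 < x -> f x <= h x /\ (f x = h x <-> x = xs).

Definition upper_bound_touching (f h : R -> R) (xs : R) : Prop :=
  forall x, 0 < x -> h x <= f x /\ (h x = f x <-> x = xs).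

(* lim_{x_* -> G} B_nu(x_s, x_*, x) = g x for every x > 0, where the
   coefficients solving the conditions at x_* are a x_*, b x_*, c x_*; the
   arbitrary choice of the signs of b and c does not affect B. *)
Definition best_bound_tends (F : (R -> Prop) -> Prop) (h : R -> R)
    (G : (R -> Prop) -> Prop) (g : R -> R) : Prop :=
  forall a b c : R -> R,
    (forall xs, 0 < xs -> best_coeffs F h xs (a xs) (b xs) (c xs)) ->
    forall x, 0 < x ->
      filterlim (fun xs => B (a xs) (b xs) (c xs) x) G (locally (g x)).

(* Main.v *)
(* Put h = I_{nu-1}/I_nu, w = x h - nu, n = nu, or h = K_{nu+1}/K_nu, w = nu - x h,
   n = - nu.  In both cases x w' = x^2 + n^2 - w^2, and the two ratios differ only in where the
   solution is pinned down: w -> n at 0+ for I, sub-exponential growth at +infinity for K.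

   Comparison: the difference d between w and the transformed bound y - mu, with
   y^2 = beta^2 + gamma^2 x^2, solves a linear equation d' = g + q d.  Sharpness and tangency
   provide the roots of the polynomial x y g in y, up to one linear factor.  A wrong position of
   the last root would make d monotone (up to an integrating factor) between x_* and the end
   where the solution is pinned down, contradicting d = 0 at x_*; the only remaining sign
   pattern of g makes d of constant sign away from x_*.

   Coefficients: sharpness and tangency give closed forms for alpha, beta^2, gamma^2 in terms of
   x_* and of w there.  The quantities that must be signed for their existence and for the ranges of
   lambda also solve linear equations with a signed source term, integrated from 0 (for I) or
   from infinity (for K).  The limits x_* -> 0 follow from the three-term recurrence, those for
   x_* -> infinity from the same linear equations. *)

Require Import Defs.
From Stdlib Require Import Reals Lra Psatz Classical Factorial.
From Coquelicot Require Import Coquelicot.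
Local Open Scope R_scope.

(** * Limits and first-order linear differential equations *)

(** Series and integral supply only crude bounds on the ratios; every finer sign or limit has to
    come from an equation [f' = g + q f]. This is feasible because the auxiliary quantities are
    polynomials in [x] and [w], and [x w' = ric_D] makes the sources form short chains: [ric_D]
    feeds [ric_N], which feeds [ric_M]; [ric_D] and [ric_F] feed [ric_G (1/2)]. The exception is
    [ric_L c], whose equation closes only after a division by [w + c]. Its source is
    [(w - n)^2 ((1 + r)^2 - 2 c) / x] with [r = (n + c) / (w + c)] between 0 and 1, so
    [1 <= (1 + r)^2 < 4]. The interval [(1/2, 2)] for [lam] consists of these two extremes, read as
    [2 c = 1] and [2 c = 4]. Keeping [w + 2] away from 0 forces [nu >= 2] for K; for I, [nu >= 1/2]
    makes [n^2 - 1/4] nonnegative and damps the equation of [ric_G (1/2)]. The two kinds differ in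
    stability: at infinity the linear equations are damped for I, so every solution settles, and
    antidamped for K, where a polynomial growth bound singles out the one solution that does not
    explode. *)

Lemma filterlim_epsilon {T} (F : (T -> Prop) -> Prop) {FF : Filter F}
    (f : T -> R) (l : R) :
  filterlim f F (locally l) <-> forall eps, 0 < eps -> F (fun x => Rabs (f x - l) < eps).
Proof.
  split.
  - intros H eps Heps.
    exact (proj1 (filterlim_locally f l) H (mkposreal eps Heps)).
  - intros H. apply filterlim_locally. intros [eps Heps]. exact (H eps Heps).
Qed.

(** Lets a limit be assembled with an existential value and identified afterwards by [ring] or
    [field]. *)
Lemma filterlim_eq {T} (F : (T -> Prop) -> Prop) (f : T -> R) (l l' : R) :
  filterlim f F (locally l') -> l' = l -> filterlim f F (locally l).
Proof. now intros H <-. Qed.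

Section RealFilterlim.
Context {T : Type} {F : (T -> Prop) -> Prop} {FF : Filter F}.

Lemma filterlim_Rplus (f g : T -> R) (a b : R) :
  filterlim f F (locally a) -> filterlim g F (locally b) ->
  filterlim (fun x => f x + g x) F (locally (a + b)).
Proof.
  intros Hf Hg. eapply filterlim_comp_2; [exact Hf | exact Hg |].
  apply (filterlim_plus a b).
Qed.

Lemma filterlim_Ropp (f : T -> R) (a : R) :
  filterlim f F (locally a) -> filterlim (fun x => - f x) F (locally (- a)).
Proof.
  intros Hf. eapply filterlim_comp; [exact Hf |]. apply (filterlim_opp a).
Qed.

Lemma filterlim_Rminus (f g : T -> R) (a b : R) :
  filterlim f F (locally a) -> filterlim g F (locally b) ->
  filterlim (fun x => f x - g x) F (locally (a - b)).
Proof.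
  intros Hf Hg. apply filterlim_Rplus; [exact Hf |]. now apply filterlim_Ropp.
Qed.

Lemma filterlim_Rmult (f g : T -> R) (a b : R) :
  filterlim f F (locally a) -> filterlim g F (locally b) ->
  filterlim (fun x => f x * g x) F (locally (a * b)).
Proof.
  intros Hf Hg. eapply filterlim_comp_2; [exact Hf | exact Hg |].
  apply (filterlim_mult a b).
Qed.

Lemma filterlim_Rinv_fun (f : T -> R) (a : R) :
  a <> 0 -> filterlim f F (locally a) -> filterlim (fun x => / f x) F (locally (/ a)).
Proof.
  intros Ha Hf. eapply filterlim_comp; [exact Hf |].
  now apply continuous_Rinv.
Qed.

Lemma filterlim_Rdiv (f g : T -> R) (a b : R) :
  filterlim f F (locally a) -> filterlim g F (locally b) -> b <> 0 ->
  filterlim (fun x => f x / g x) F (locally (a / b)).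
Proof.
  intros Hf Hg Hb. apply filterlim_Rmult; [exact Hf |].
  now apply filterlim_Rinv_fun.
Qed.

Lemma filterlim_Rpow (f : T -> R) (a : R) (k : nat) :
  filterlim f F (locally a) -> filterlim (fun x => f x ^ k) F (locally (a ^ k)).
Proof.
  intros Hf. induction k as [|k IH]; simpl.
  - apply filterlim_const.
  - now apply filterlim_Rmult.
Qed.

Lemma filterlim_sqrt_fun (f : T -> R) (a : R) :
  filterlim f F (locally a) -> filterlim (fun x => sqrt (f x)) F (locally (sqrt a)).
Proof.
  intros Hf. eapply filterlim_comp; [exact Hf |]. apply continuous_sqrt.
Qed.

Lemma filterlim_squeeze_le (f g h : T -> R) (l : R) :
  F (fun x => f x <= g x <= h x) ->
  filterlim f F (locally l) -> filterlim h F (locally l) ->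
  filterlim g F (locally l).
Proof.
  intros H Hf Hh. apply filterlim_epsilon; [exact FF |]. intros eps He.
  generalize (filter_and _ _ H (filter_and _ _
    (proj1 (filterlim_epsilon F f l) Hf eps He)
    (proj1 (filterlim_epsilon F h l) Hh eps He))).
  apply filter_imp. intros x [H1 [H2 H3]].
  apply Rabs_def2 in H2; apply Rabs_def2 in H3. apply Rabs_def1; lra.
Qed.

End RealFilterlim.

Lemma at_right_intro (P : R -> Prop) (d : R) :
  0 < d -> (forall x, 0 < x < d -> P x) -> at_right 0 P.
Proof.
  intros Hd H. exists (mkposreal d Hd). intros y Hy Hpos. apply H.
  unfold ball in Hy; simpl in Hy; unfold AbsRing_ball, abs, minus, plus, opp in Hy; simpl in Hy.
  apply Rabs_def2 in Hy. lra.
Qed.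

Lemma at_right_elim (P : R -> Prop) :
  at_right 0 P -> exists d, 0 < d /\ forall x, 0 < x < d -> P x.
Proof.
  intros [[d Hd] H]. exists d. split; [exact Hd |]. intros x Hx. apply H; [| lra].
  unfold ball; simpl; unfold AbsRing_ball, abs, minus, plus, opp; simpl.
  apply Rabs_def1; lra.
Qed.

Lemma at_right_pos : at_right 0 (fun x => 0 < x).
Proof. apply at_right_intro with 1; [lra |]. intros x Hx; lra. Qed.

Lemma p_infty_gt (a : R) : Rbar_locally p_infty (fun x => a < x).
Proof. exists a. auto. Qed.

Lemma filterlim_id_at_right : filterlim (fun x : R => x) (at_right 0) (locally 0).
Proof.
  apply filterlim_epsilon; [typeclasses eauto |]. intros eps He.
  apply at_right_intro with eps; [exact He |]. intros x Hx. apply Rabs_def1; lra.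
Qed.

Lemma filterlim_inv_p_infty : filterlim (fun x : R => / x) (Rbar_locally p_infty) (locally 0).
Proof.
  apply filterlim_epsilon; [typeclasses eauto |]. intros eps He.
  exists (/ eps). intros x Hx. assert (0 < / eps) by now apply Rinv_0_lt_compat.
  assert (0 < / x) by (apply Rinv_0_lt_compat; lra).
  rewrite Rminus_0_r, Rabs_right by lra.
  rewrite <- (Rinv_inv eps). apply Rinv_lt_contravar; [nra | exact Hx].
Qed.

(** * Sign and decay of solutions of [f' = g + q f] *)

Definition linear_ode (f g q : R -> R) : Prop :=
  forall x, 0 < x -> is_derive f x (g x + q x * f x) /\ continuous q x.

Lemma linear_ode_opp (f g q : R -> R) :
  linear_ode f g q -> linear_ode (fun x => - f x) (fun x => - g x) q.
Proof.
  intros H x Hx. destruct (H x Hx) as [H1 H2]. split; [| exact H2].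
  apply is_derive_ext with (fun x => opp (f x)); [reflexivity |].
  replace (- g x + q x * - f x) with (opp (g x + q x * f x)) by (simpl; unfold opp; simpl; ring).
  now apply (is_derive_opp f).
Qed.

Lemma linear_ode_shift (f g q : R -> R) (c : R) :
  linear_ode f g q -> linear_ode (fun x => f x - c) (fun x => g x + q x * c) q.
Proof.
  intros H x Hx. destruct (H x Hx) as [H1 H2]. split; [| exact H2].
  replace (g x + q x * c + q x * (f x - c)) with (minus (g x + q x * f x) 0)
    by (unfold minus, plus, opp; simpl; ring).
  apply (is_derive_minus f (fun _ => c)); [exact H1 |]. apply (is_derive_const c).
Qed.

Lemma derive_pos_incr (f df : R -> R) (a b : R) :
  a < b -> (forall x, a <= x <= b -> is_derive f x (df x)) ->
  (forall x, a < x < b -> 0 < df x) -> f a < f b.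
Proof.
  intros Hab Hd Hpos.
  destruct (MVT_cor2 f df a b Hab) as [c [Hc Hc']].
  - intros c Hc. apply is_derive_Reals. now apply Hd.
  - assert (0 < df c * (b - a)) by (apply Rmult_lt_0_compat; [now apply Hpos | lra]). lra.
Qed.

Lemma derive_nonneg_incr (f df : R -> R) (a b : R) :
  a <= b -> (forall x, a <= x <= b -> is_derive f x (df x)) ->
  (forall x, a < x < b -> 0 <= df x) -> f a <= f b.
Proof.
  intros [Hab | <-] Hd Hpos; [| lra].
  destruct (MVT_cor2 f df a b Hab) as [c [Hc Hc']].
  - intros c Hc. apply is_derive_Reals. now apply Hd.
  - assert (0 <= df c * (b - a)) by (apply Rmult_le_pos; [now apply Hpos | lra]). lra.
Qed.

(** Take [p = exp (- RInt q 1 x)]; the base point 1 is arbitrary in the half-line. A sign of [g]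
    becomes monotonicity of [p f], and the derivative of [p] is exported so that [p] can later be
    compared with exponentials. *)
Lemma integrating_factor (f g q : R -> R) :
  linear_ode f g q ->
  exists p : R -> R, forall x, 0 < x ->
    0 < p x /\ is_derive p x (- q x * p x) /\
    is_derive (fun t => p t * f t) x (p x * g x).
Proof.
  intros H. exists (fun x => exp (- RInt q 1 x)). intros x Hx.
  assert (HR : is_derive (RInt q 1) x (q x)).
  { apply (is_derive_RInt q (RInt q 1) 1 x); [| now apply H].
    apply filter_imp with (fun t => 0 < t); [| apply (open_gt 0); exact Hx].
    intros t Ht. apply (RInt_correct q 1 t), (ex_RInt_continuous q 1 t).
    intros z Hz. apply H. unfold Rmin in Hz. destruct (Rle_dec 1 t); lra. }
  assert (Hp : is_derive (fun x => exp (- RInt q 1 x)) x (- q x * exp (- RInt q 1 x))).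
  { revert HR. generalize (RInt q 1). intros Q HR.
    auto_derive; [now exists (q x) |].
    rewrite (is_derive_unique (fun t : R => Q t) x _ HR). ring. }
  split; [apply exp_pos |]. split; [exact Hp |].
  replace (exp (- RInt q 1 x) * g x) with
    (plus (mult (- q x * exp (- RInt q 1 x)) (f x))
          (mult (exp (- RInt q 1 x)) (g x + q x * f x)))
    by (unfold plus, mult; simpl; ring).
  apply (is_derive_mult (fun x => exp (- RInt q 1 x)) f x).
  - exact Hp.
  - now apply H.
  - intros; apply Rmult_comm.
Qed.

Section LinearODE.
Variables f g q : R -> R.
Hypothesis Hode : linear_ode f g q.

Lemma ode_forward (a b : R) :
  0 < a < b -> (forall t, a < t < b -> 0 < g t) -> 0 <= f a -> 0 < f b.
Proof.
  intros Hab Hg Ha. destruct (integrating_factor _ _ _ Hode) as [p Hp].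
  assert (L : p a * f a < p b * f b).
  { apply (derive_pos_incr (fun t => p t * f t) (fun t => p t * g t)); [lra | |].
    - intros x Hx. apply Hp; lra.
    - intros x Hx. apply Rmult_lt_0_compat; [apply Hp; lra | now apply Hg]. }
  assert (0 < p a) by (apply Hp; lra). assert (0 < p b) by (apply Hp; lra). nra.
Qed.

Lemma ode_backward (a b : R) :
  0 < a < b -> (forall t, a < t < b -> 0 < g t) -> f b <= 0 -> f a < 0.
Proof.
  intros Hab Hg Hb. apply Rnot_le_lt. intros Ha.
  pose proof (ode_forward a b Hab Hg Ha). lra.
Qed.

Lemma ode_forward_weak (a b : R) :
  0 < a < b -> (forall t, a < t < b -> 0 <= g t) -> 0 < f a -> 0 < f b.
Proof.
  intros Hab Hg Ha. destruct (integrating_factor _ _ _ Hode) as [p Hp].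
  assert (L : p a * f a <= p b * f b).
  { apply (derive_nonneg_incr (fun t => p t * f t) (fun t => p t * g t)); [lra | |].
    - intros x Hx. apply Hp; lra.
    - intros x Hx. apply Rmult_le_pos; [apply Rlt_le, Hp; lra | now apply Hg]. }
  assert (0 < p a) by (apply Hp; lra). assert (0 < p b) by (apply Hp; lra). nra.
Qed.

(** If [f b <= 0], the increasing function [p f] stays below a negative constant near 0, although
    [p] is bounded there and [f] tends to 0. A one-sided bound on [q] leaves room for coefficients
    such as [-2 n / x], which tend to minus infinity at 0. *)
Lemma ode_from_zero (C b : R) :
  0 < b -> (forall t, 0 < t < b -> 0 < g t) ->
  at_right 0 (fun t => q t <= C) ->
  filterlim f (at_right 0) (locally 0) -> 0 < f b.
Proof.
  intros Hb Hg Hq Hf. destruct (integrating_factor _ _ _ Hode) as [p Hp].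
  destruct (at_right_elim _ Hq) as [d [Hd Hqd]].
  set (c := Rmin (d / 2) (b / 2)).
  assert (Hc : 0 < c < d /\ c < b).
  { unfold c, Rmin. destruct (Rle_dec (d / 2) (b / 2)); lra. }
  (* [p t * exp (C t)] is nondecreasing because [q <= C]; the factor with [Rabs C] undoes the
     exponential for either sign of [C]. *)
  assert (Hpb : forall t, 0 < t < c -> p t <= p c * exp (C * c) * exp (Rabs C * c)).
  { intros t Ht.
    assert (L : p t * exp (C * t) <= p c * exp (C * c)).
    { apply (derive_nonneg_incr (fun t => p t * exp (C * t))
        (fun t => - q t * p t * exp (C * t) + p t * (C * exp (C * t)))); [lra | |].
      - intros x Hx.
        assert (Hpx : is_derive p x (- q x * p x)) by (apply Hp; lra).
        auto_derive; [now exists (- q x * p x) |].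
        rewrite (is_derive_unique (fun t : R => p t) x _ Hpx). ring.
      - intros x Hx. assert (0 < p x) by (apply Hp; lra).
        assert (q x <= C) by (apply Hqd; lra). pose proof (exp_pos (C * x)).
        assert (0 <= (C - q x) * (p x * exp (C * x))) by (apply Rmult_le_pos; nra). lra. }
    assert (Hpt : p t = p t * exp (C * t) * exp (- (C * t))).
    { rewrite Rmult_assoc, <- exp_plus, Rplus_opp_r, exp_0. ring. }
    rewrite Hpt. pose proof (exp_pos (C * t)). pose proof (exp_pos (- (C * t))).
    assert (0 < p t) by (apply Hp; lra).
    apply Rmult_le_compat; [nra | lra | exact L |].
    assert (HL : - (C * t) <= Rabs C * c).
    { pose proof (Rle_abs (- C)). rewrite Rabs_Ropp in H2. pose proof (Rabs_pos C). nra. }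
    destruct HL as [HL | ->]; [apply Rlt_le, exp_increasing, HL | lra]. }
  set (K := p c * exp (C * c) * exp (Rabs C * c)) in Hpb.
  assert (HK : 0 < K).
  { unfold K. repeat apply Rmult_lt_0_compat; try apply exp_pos. apply Hp; lra. }
  apply Rnot_le_lt. intros Hfb.
  assert (Hfc : f c < 0) by (apply ode_backward with b; [lra | intros; apply Hg; lra | exact Hfb]).
  assert (Hpc : 0 < p c) by (apply Hp; lra).
  (* The tolerance for [f] that, multiplied by the bound [K] on [p], equals the gap
     [- (p c * f c)]. *)
  assert (He : 0 < - (p c * f c) / K) by (apply Rdiv_lt_0_compat; nra).
  destruct (at_right_elim _ (proj1 (filterlim_epsilon _ f 0) Hf _ He)) as [e [He0 Hfe]].
  set (t := Rmin (e / 2) (c / 2)).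
  assert (Ht : 0 < t < e /\ t < c).
  { unfold t, Rmin. destruct (Rle_dec (e / 2) (c / 2)); lra. }
  assert (L : p t * f t < p c * f c).
  { apply (derive_pos_incr (fun t => p t * f t) (fun t => p t * g t)); [lra | |].
    - intros x Hx. apply Hp; lra.
    - intros x Hx. apply Rmult_lt_0_compat; [apply Hp; lra | apply Hg; lra]. }
  assert (Hft : Rabs (f t - 0) < - (p c * f c) / K) by (apply Hfe; lra).
  rewrite Rminus_0_r in Hft. apply Rabs_def2 in Hft. destruct Hft as [_ Hft].
  assert (Hpt : p t <= K) by (apply Hpb; lra).
  assert (Hpt0 : 0 < p t) by (apply Hp; lra).
  assert (E : K * (- (p c * f c) / K) = - (p c * f c)) by (field; lra).
  set (r := - (p c * f c) / K) in *. nra.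
Qed.

(** If [f a >= 0], then [p f] stays above a positive constant from some point on, while [q >= 1/2]
    makes [p] decay at least like [exp (- t / 2)], which beats the growth [t^4] allowed to [f]. The
    exponent 4 covers all quantities to come, of degree at most 3 in [x] and [w]. *)
Lemma ode_from_infinity (C a : R) :
  0 < a -> (forall t, a < t -> 0 < g t) ->
  Rbar_locally p_infty (fun t => 1 / 2 <= q t /\ Rabs (f t) <= C * t ^ 4) -> f a < 0.
Proof.
  intros Ha Hg [X HX]. destruct (integrating_factor _ _ _ Hode) as [p Hp].
  apply Rnot_le_lt. intros Hfa.
  set (c := Rmax (a + 1) (X + 1)).
  assert (Hc : a < c /\ X < c).
  { unfold c, Rmax. destruct (Rle_dec (a + 1) (X + 1)); lra. }
  assert (Hfc : 0 < f c) by (apply ode_forward with a; [lra | intros; apply Hg; lra | exact Hfa]).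
  assert (Hpc : 0 < p c) by (apply Hp; lra).
  set (K := p c * exp (c / 2)).
  assert (HK : 0 < K) by (apply Rmult_lt_0_compat; [exact Hpc | apply exp_pos]).
  assert (HC : 0 < C).
  { pose proof (HX c (proj2 Hc)) as [_ HH]. rewrite Rabs_right in HH by lra.
    assert (0 < c ^ 4) by (apply pow_lt; lra). nra. }
  (* The decay in quantitative form: a positive constant times [t] would be bounded, which a large
     [t] refutes. *)
  assert (Main : forall t, c < t -> p c * f c * t <= K * C * 100000).
  { intros t Ht.
    assert (L1 : p t * exp (t / 2) <= K).
    { apply Ropp_le_cancel.
      apply (derive_nonneg_incr (fun t => - (p t * exp (t / 2)))
        (fun t => (q t - 1 / 2) * (p t * exp (t / 2)))); [lra | |].
      - intros x Hx.
        assert (Hpx : is_derive p x (- q x * p x)) by (apply Hp; lra).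
        auto_derive; [now exists (- q x * p x) |].
        rewrite (is_derive_unique (fun t : R => p t) x _ Hpx). unfold Rdiv. ring.
      - intros x Hx. assert (0 < p x) by (apply Hp; lra).
        assert (1 / 2 <= q x) by (apply HX; lra). pose proof (exp_pos (x / 2)).
        apply Rmult_le_pos; nra. }
    assert (L2 : p c * f c < p t * f t).
    { apply (derive_pos_incr (fun t => p t * f t) (fun t => p t * g t)); [lra | |].
      - intros x Hx. apply Hp; lra.
      - intros x Hx. apply Rmult_lt_0_compat; [apply Hp; lra | apply Hg; lra]. }
    assert (L3 : f t <= C * t ^ 4).
    { apply Rle_trans with (Rabs (f t)); [apply Rle_abs |]. apply HX; lra. }
    (* [100000 = 10^5]: the exponential is split into five factors [exp (t / 10)], each at least
       [t / 10]. *)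
    assert (L4 : t ^ 5 <= 100000 * exp (t / 2)).
    { replace (t / 2) with (t / 10 + t / 10 + t / 10 + t / 10 + t / 10) by field.
      rewrite !exp_plus. pose proof (exp_ineq1_le (t / 10)) as E.
      assert (E' : 0 <= t / 10 <= exp (t / 10)) by lra.
      replace (t ^ 5) with (100000 * (t / 10) ^ 5) by field.
      apply Rmult_le_compat_l; [lra |].
      apply Rle_trans with (exp (t / 10) ^ 5); [now apply pow_incr |].
      right; ring. }
    assert (Hpt : 0 < p t) by (apply Hp; lra).
    assert (Ht0 : 0 < t) by lra.
    apply Rle_trans with (p t * (C * t ^ 4) * t).
    { apply Rmult_le_compat_r; [lra |]. apply Rle_trans with (p t * f t); [lra |].
      apply Rmult_le_compat_l; lra. }
    replace (p t * (C * t ^ 4) * t) with (C * (p t * t ^ 5)) by ring.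
    replace (K * C * 100000) with (C * (100000 * K)) by ring.
    apply Rmult_le_compat_l; [lra |].
    apply Rle_trans with (p t * (100000 * exp (t / 2))); [apply Rmult_le_compat_l; lra |].
    replace (p t * (100000 * exp (t / 2))) with (100000 * (p t * exp (t / 2))) by ring. lra. }
  assert (Hm : 0 < p c * f c) by nra.
  set (t := Rmax (c + 1) (K * C * 100000 / (p c * f c) + 1)).
  assert (Ht : c < t) by (unfold t; pose proof (Rmax_l (c + 1) (K * C * 100000 / (p c * f c) + 1)); lra).
  assert (Ht' : K * C * 100000 / (p c * f c) < t)
    by (unfold t; pose proof (Rmax_r (c + 1) (K * C * 100000 / (p c * f c) + 1)); lra).
  pose proof (Main t Ht) as Mt.
  apply Rmult_lt_compat_l with (r := p c * f c) in Ht'; [| exact Hm].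
  replace (p c * f c * (K * C * 100000 / (p c * f c))) with (K * C * 100000) in Ht'
    by (field; split; lra). lra.
Qed.

End LinearODE.

(** With [q <= 0] the factor [p] is nondecreasing, so [p f] has slope at least [p c * e] and
    outgrows any negative initial value. *)
Lemma ode_damped_eventually_pos (f g q : R -> R) (e : R) :
  linear_ode f g q -> 0 < e ->
  Rbar_locally p_infty (fun t => e <= g t /\ q t <= 0) ->
  Rbar_locally p_infty (fun t => 0 < f t).
Proof.
  intros Hode He [X HX]. destruct (integrating_factor _ _ _ Hode) as [p Hp].
  set (c := Rmax 1 (X + 1)).
  assert (Hc : 0 < c /\ X < c) by (unfold c, Rmax; destruct (Rle_dec 1 (X + 1)); lra).
  assert (Hpc : 0 < p c) by (apply Hp; lra).
  assert (Hpi : forall t, c <= t -> p c <= p t).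
  { intros t Ht. apply (derive_nonneg_incr p (fun x => - q x * p x)); [exact Ht | |].
    - intros x Hx. apply Hp; lra.
    - intros x Hx. assert (0 < p x) by (apply Hp; lra). assert (q x <= 0) by (apply HX; lra). nra. }
  exists (Rmax c (c - f c / e)). intros t Ht.
  pose proof (Rmax_l c (c - f c / e)). pose proof (Rmax_r c (c - f c / e)).
  assert (L : p c * f c - p c * e * c <= p t * f t - p c * e * t).
  { apply (derive_nonneg_incr (fun t => p t * f t - p c * e * t)
      (fun t => p t * g t - p c * e)); [lra | |].
    - intros x Hx.
      assert (Hx1 : is_derive (fun t => p t * f t) x (p x * g x)) by (apply Hp; lra).
      apply (is_derive_minus (fun t => p t * f t) (fun t => p c * e * t)); [exact Hx1 |].
      auto_derive; [exact I | ring].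
    - intros x Hx. assert (e <= g x) by (apply HX; lra).
      assert (p c <= p x) by (apply Hpi; lra). nra. }
  assert (Hpt : 0 < p t) by (apply Hp; lra).
  assert (E : 0 < p c * (f c + e * (t - c))).
  { apply Rmult_lt_0_compat; [exact Hpc |].
    assert (HH : - (f c / e) < t - c) by lra.
    apply Rmult_lt_compat_l with (r := e) in HH; [| exact He].
    replace (e * - (f c / e)) with (- f c) in HH by (field; lra). lra. }
  assert (0 < p t * f t) by nra.
  apply Rnot_le_lt. intros Hn. nra.
Qed.

Lemma filterlim_0_of_bounds {T} (F : (T -> Prop) -> Prop) {FF : Filter F} (f : T -> R) :
  (forall e, 0 < e -> F (fun x => f x < e)) -> (forall e, 0 < e -> F (fun x => - f x < e)) ->
  filterlim f F (locally 0).
Proof.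
  intros H1 H2. apply filterlim_epsilon; [exact FF |]. intros e He.
  generalize (filter_and _ _ (H1 e He) (H2 e He)). apply filter_imp.
  intros x [Ha Hb]. rewrite Rminus_0_r. apply Rabs_def1; lra.
Qed.

Lemma filterlim_pos_eventually {T} (F : (T -> Prop) -> Prop) {FF : Filter F} (f : T -> R) (l c : R) :
  filterlim f F (locally l) -> c < l -> F (fun x => c < f x).
Proof.
  intros H Hc. assert (He : 0 < l - c) by lra.
  generalize (proj1 (filterlim_epsilon F f l) H _ He). apply filter_imp.
  intros x Hx. apply Rabs_def2 in Hx. lra.
Qed.

Lemma filterlim_neg_eventually {T} (F : (T -> Prop) -> Prop) {FF : Filter F} (f : T -> R) (l c : R) :
  filterlim f F (locally l) -> l < c -> F (fun x => f x < c).
Proof.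
  intros H Hc. assert (He : 0 < c - l) by lra.
  generalize (proj1 (filterlim_epsilon F f l) H _ He). apply filter_imp.
  intros x Hx. apply Rabs_def2 in Hx. lra.
Qed.

(** [e - f] solves the same equation with source [- (g + q e)], eventually at least [e / 2] since
    [q < -1]; hence [f < e] in the end. The opposite bound is the same argument for [- f]. *)
Lemma ode_damped_tends_0 (f g q : R -> R) :
  linear_ode f g q -> filterlim g (Rbar_locally p_infty) (locally 0) ->
  filterlim q (Rbar_locally p_infty) (locally (-2)) ->
  filterlim f (Rbar_locally p_infty) (locally 0).
Proof.
  assert (Half : forall f g, linear_ode f g q ->
    filterlim g (Rbar_locally p_infty) (locally 0) ->
    filterlim q (Rbar_locally p_infty) (locally (-2)) ->
    forall e, 0 < e -> Rbar_locally p_infty (fun x => f x < e)).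
  { clear. intros f g Hode Hg Hq e He.
    pose proof (linear_ode_opp _ _ _ (linear_ode_shift _ _ _ e Hode)) as H.
    generalize (ode_damped_eventually_pos _ _ _ (e / 2) H). intros K.
    cut (Rbar_locally p_infty (fun t => 0 < - (f t - e))).
    { apply filter_imp. intros x; lra. }
    apply K; [lra |].
    assert (Hg' := filterlim_neg_eventually _ g 0 (e / 2) Hg ltac:(lra)).
    assert (Hq' := filterlim_neg_eventually _ q (-2) (-1) Hq ltac:(lra)).
    generalize (filter_and _ _ Hg' Hq'). apply filter_imp. intros x [H1 H2]. nra. }
  intros Hode Hg Hq. apply filterlim_0_of_bounds; [typeclasses eauto | |].
  - now apply (Half f g).
  - apply (Half (fun x => - f x) (fun x => - g x)); [now apply linear_ode_opp | | exact Hq].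
    eapply filterlim_eq; [apply filterlim_Ropp; exact Hg | ring].
Qed.

(** [f - e] has source [g + q e], eventually positive, so integration from infinity makes it
    negative. The growth bound is essential: the other solutions of the equation grow
    exponentially. *)
Lemma ode_antidamped_tends_0 (f g q : R -> R) (C : R) :
  linear_ode f g q -> filterlim g (Rbar_locally p_infty) (locally 0) ->
  filterlim q (Rbar_locally p_infty) (locally 2) ->
  Rbar_locally p_infty (fun t => Rabs (f t) <= C * t ^ 4) ->
  filterlim f (Rbar_locally p_infty) (locally 0).
Proof.
  assert (Half : forall f g, linear_ode f g q ->
    filterlim g (Rbar_locally p_infty) (locally 0) ->
    filterlim q (Rbar_locally p_infty) (locally 2) ->
    Rbar_locally p_infty (fun t => Rabs (f t) <= C * t ^ 4) ->
    forall e, 0 < e -> Rbar_locally p_infty (fun x => f x < e)).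
  { clear. intros f g Hode Hg Hq Hf e He.
    pose proof (linear_ode_shift _ _ _ e Hode) as H.
    assert (Hg' := filterlim_pos_eventually _ g 0 (- e / 2) Hg ltac:(lra)).
    assert (Hq' := filterlim_pos_eventually _ q 2 1 Hq ltac:(lra)).
    destruct (filter_and _ _ Hg' Hq') as [X HX].
    exists (Rmax 1 X). intros x Hx. pose proof (Rmax_l 1 X). pose proof (Rmax_r 1 X).
    cut (f x - e < 0); [lra |].
    apply (ode_from_infinity _ _ _ H (C + e)); [lra | |].
    - intros t Ht. destruct (HX t) as [H2 H3]; [lra |]. nra.
    - generalize (filter_and _ _ Hf (filter_and _ _ Hq' (p_infty_gt 1))).
      apply filter_imp. intros t [Hb [H2 H3]]. split; [lra |].
      assert (1 <= t ^ 4) by (apply pow_R1_Rle; lra).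
      apply Rabs_le_between in Hb. apply Rabs_le. nra. }
  intros Hode Hg Hq Hf. apply filterlim_0_of_bounds; [typeclasses eauto | |].
  - now apply (Half f g).
  - apply (Half (fun x => - f x) (fun x => - g x)); [now apply linear_ode_opp | | exact Hq |].
    + eapply filterlim_eq; [apply filterlim_Ropp; exact Hg | ring].
    + revert Hf. apply filter_imp. intros x. now rewrite Rabs_Ropp.
Qed.

(** * Modified Bessel functions of the first kind *)

Definition euler_term (z : R) (n : nat) : R :=
  prod_f_R0 (fun k => z + INR k) n / (INR (fact n) * Rpower (INR n) z).

(** Concavity of the logarithm: [ln u <= u - 1] is applied at [(1 + t) / A] with weight [z] and at
    [1 / A] with weight [1 - z]; the right-hand sides then cancel. *)
Lemma Rpower_bernoulli (t z : R) : -1 < t -> 0 <= z <= 1 -> Rpower (1 + t) z <= 1 + z * t.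
Proof.
  intros Ht Hz. set (A := 1 + z * t).
  assert (HA : 0 < A) by (unfold A; destruct (Rlt_le_dec z 1); nra).
  assert (Hln : forall u, 0 < u -> ln u <= u - 1).
  { intros u Hu. pose proof (exp_ineq1_le (ln u)). rewrite exp_ln in H; lra. }
  pose proof (Hln ((1 + t) / A) ltac:(apply Rdiv_lt_0_compat; lra)) as H1.
  pose proof (Hln (/ A) ltac:(now apply Rinv_0_lt_compat)) as H2.
  unfold Rdiv in H1. rewrite ln_mult in H1; [| lra | now apply Rinv_0_lt_compat].
  rewrite ln_Rinv in H1, H2 by exact HA.
  assert (E : z * ((1 + t) * / A - 1) + (1 - z) * (/ A - 1) = 0).
  { replace (z * ((1 + t) * / A - 1) + (1 - z) * (/ A - 1)) with (A * / A - 1)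
      by (unfold A; ring). rewrite Rinv_r; lra. }
  assert (L : z * ln (1 + t) <= ln A) by nra.
  unfold Rpower. rewrite <- (exp_ln A HA).
  destruct L as [L | ->]; [apply Rlt_le, exp_increasing, L | lra].
Qed.

Lemma prod_shift (z : R) (n : nat) :
  z * prod_f_R0 (fun k => z + 1 + INR k) n
  = prod_f_R0 (fun k => z + INR k) n * (z + 1 + INR n).
Proof.
  induction n as [|n IH].
  - simpl. ring.
  - change (prod_f_R0 (fun k => z + 1 + INR k) (S n))
      with (prod_f_R0 (fun k => z + 1 + INR k) n * (z + 1 + INR (S n))).
    change (prod_f_R0 (fun k => z + INR k) (S n))
      with (prod_f_R0 (fun k => z + INR k) n * (z + INR (S n))).
    rewrite <- Rmult_assoc, IH, !S_INR. ring.
Qed.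

(** The finite form of [Gamma (z + 1) = z Gamma z]. The index is a successor so that the base of the
    power [n^z] is positive. *)
Lemma euler_term_shift (z : R) (n : nat) :
  euler_term z (S n) * (1 + (z + 1) / INR (S n)) = z * euler_term (z + 1) (S n).
Proof.
  unfold euler_term. rewrite Rpower_plus, Rpower_1 by apply lt_0_INR, Nat.lt_0_succ.
  assert (H1 := pos_INR n). assert (H2 : INR (fact (S n)) <> 0) by apply INR_fact_neq_0.
  assert (H3 : 0 < Rpower (INR (S n)) z) by apply exp_pos.
  transitivity (z * prod_f_R0 (fun k => z + 1 + INR k) (S n)
                / (INR (fact (S n)) * (Rpower (INR (S n)) z * INR (S n)))).
  - rewrite prod_shift. rewrite !S_INR in *. field. repeat split; try lra; exact H2.
  - rewrite !S_INR in *. field. repeat split; try lra; exact H2.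
Qed.

Lemma euler_prod_pos (z : R) (n : nat) : 0 < z -> 0 < prod_f_R0 (fun k => z + INR k) n.
Proof.
  intros Hz. induction n as [|n IH]; [simpl; lra |].
  apply Rmult_lt_0_compat; [exact IH |]. pose proof (pos_INR (S n)). lra.
Qed.

Lemma euler_term_pos (z : R) (n : nat) : 0 < z -> 0 < euler_term z n.
Proof.
  intros Hz. apply Rdiv_lt_0_compat; [now apply euler_prod_pos |].
  apply Rmult_lt_0_compat; [apply INR_fact_lt_0 | apply exp_pos].
Qed.

Lemma euler_term_S (z : R) (n : nat) :
  euler_term z (S (S n)) =
  euler_term z (S n) * ((1 + z / INR (S (S n))) * Rpower (1 - / INR (S (S n))) z).
Proof.
  unfold euler_term.
  change (prod_f_R0 (fun k => z + INR k) (S (S n)))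
      with (prod_f_R0 (fun k => z + INR k) (S n) * (z + INR (S (S n)))).
  rewrite fact_simpl, mult_INR. assert (H0 := pos_INR n).
  assert (E : INR (S n) = INR (S (S n)) * (1 - / INR (S (S n)))).
  { rewrite !S_INR. field. lra. }
  assert (E' : Rpower (INR (S n)) z = Rpower (INR (S (S n))) z * Rpower (1 - / INR (S (S n))) z).
  { rewrite Rpower_mult_distr; [now rewrite <- E | rewrite !S_INR; lra |].
    assert (/ INR (S (S n)) < 1); [| lra]. rewrite <- Rinv_1.
    apply Rinv_lt_contravar; rewrite !S_INR; lra. }
  rewrite E'.
  assert (H1 : 0 < Rpower (INR (S (S n))) z) by apply exp_pos.
  assert (H2 : 0 < Rpower (1 - / INR (S (S n))) z) by apply exp_pos.
  pose proof (INR_fact_neq_0 (S n)) as H3.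
  field. repeat split; try lra; try exact H3. rewrite !S_INR; lra.
Qed.

(** Monotone convergence. With [(n + 1)^z] in place of [n^z] the terms increase from the value [z],
    which supplies the lower bound; with [n^z] they decrease. Both monotonicities are instances of
    [Rpower_bernoulli], whence [z <= 1]. *)
Lemma euler_limit_base (z : R) :
  0 < z <= 1 -> exists l : R, 0 < l /\ is_lim_seq (euler_term z) l.
Proof.
  intros Hz.
  assert (Hlow : forall n, z <= prod_f_R0 (fun k => z + INR k) n
                                / (INR (fact n) * Rpower (INR (S n)) z)).
  { induction n as [|n IH].
    - simpl. unfold Rpower. rewrite ln_1, Rmult_0_r, exp_0. right; field.
    - apply Rle_trans with (1 := IH).
      change (prod_f_R0 (fun k => z + INR k) (S n))
        with (prod_f_R0 (fun k => z + INR k) n * (z + INR (S n))).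
      rewrite fact_simpl, mult_INR. assert (H0 := pos_INR n).
      assert (Hi : 0 < / INR (S n)) by (apply Rinv_0_lt_compat; rewrite S_INR; lra).
      assert (E : INR (S (S n)) = INR (S n) * (1 + / INR (S n))) by (rewrite !S_INR; field; lra).
      assert (E' : Rpower (INR (S (S n))) z = Rpower (INR (S n)) z * Rpower (1 + / INR (S n)) z).
      { rewrite Rpower_mult_distr; [now rewrite <- E | rewrite !S_INR; lra | lra]. }
      rewrite E'. pose proof (Rpower_bernoulli (/ INR (S n)) z ltac:(lra) ltac:(lra)) as Hb.
      assert (H1 : 0 < Rpower (INR (S n)) z) by apply exp_pos.
      assert (H2 : 0 < Rpower (1 + / INR (S n)) z) by apply exp_pos.
      pose proof (INR_fact_lt_0 n) as H3. pose proof (euler_prod_pos z n (proj1 Hz)) as H4.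
      set (P := prod_f_R0 (fun k => z + INR k) n) in *.
      set (w := Rpower (1 + / INR (S n)) z) in *.
      assert (HS : 0 < INR (S n)) by (rewrite S_INR; lra).
      replace (P * (z + INR (S n)) / (INR (S n) * INR (fact n) * (Rpower (INR (S n)) z * w)))
        with (P / (INR (fact n) * Rpower (INR (S n)) z) * ((1 + z * / INR (S n)) / w))
        by (field; repeat split; lra).
      rewrite <- (Rmult_1_r (P / (INR (fact n) * Rpower (INR (S n)) z))) at 1.
      apply Rmult_le_compat_l.
      + apply Rlt_le, Rdiv_lt_0_compat; [exact H4 | now apply Rmult_lt_0_compat].
      + apply Rmult_le_reg_r with w; [exact H2 |]. unfold Rdiv.
        rewrite Rmult_assoc, Rinv_l by lra. lra. }
  assert (Hdec : forall n, euler_term z (S (S n)) <= euler_term z (S n)).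
  { intros n. rewrite euler_term_S. pose proof (euler_term_pos z (S n) (proj1 Hz)).
    assert (H0 := pos_INR n).
    assert (Hi : 0 < / INR (S (S n)) < 1).
    { split; [apply Rinv_0_lt_compat; rewrite !S_INR; lra |].
      rewrite <- Rinv_1. apply Rinv_lt_contravar; rewrite !S_INR; lra. }
    pose proof (Rpower_bernoulli (- / INR (S (S n))) z ltac:(lra) ltac:(lra)) as Hb.
    unfold Rminus, Rdiv. set (i := / INR (S (S n))) in *.
    set (w := Rpower (1 + - i) z) in *.
    assert (0 < w) by apply exp_pos.
    assert ((1 + z * i) * w <= 1).
    { apply Rle_trans with ((1 + z * i) * (1 + z * - i)); [apply Rmult_le_compat_l; nra | nra]. }
    nra. }
  assert (Hlow' : forall n, z <= euler_term z (S n)).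
  { intros n. apply Rle_trans with (1 := Hlow (S n)). unfold euler_term, Rdiv.
    apply Rmult_le_compat_l; [apply Rlt_le, euler_prod_pos; lra |].
    apply Rinv_le_contravar.
    - apply Rmult_lt_0_compat; [apply INR_fact_lt_0 | apply exp_pos].
    - apply Rmult_le_compat_l; [apply pos_INR |]. apply Rle_Rpower_l; [lra |].
      pose proof (pos_INR n). rewrite !S_INR. lra. }
  destruct (ex_finite_lim_seq_decr (fun n => euler_term z (S n)) z Hdec Hlow') as [l Hl].
  exists l. split.
  - pose proof (is_lim_seq_le (fun _ => z) _ z l Hlow' (is_lim_seq_const z) Hl) as Hle.
    simpl in Hle. lra.
  - now apply is_lim_seq_incr_1.
Qed.

Lemma euler_limit_S (z l : R) :
  0 < z -> is_lim_seq (euler_term z) l -> is_lim_seq (euler_term (z + 1)) (l / z).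
Proof.
  intros Hz Hl. apply is_lim_seq_incr_1.
  apply is_lim_seq_ext with (fun n => / z * (euler_term z (S n) * (1 + (z + 1) / INR (S n)))).
  { intros n. rewrite euler_term_shift. field. lra. }
  replace (Finite (l / z)) with (Rbar_mult (/ z) (l * (1 + (z + 1) * 0)))
    by (simpl; f_equal; field; lra).
  apply is_lim_seq_scal_l. apply is_lim_seq_mult'; [now apply is_lim_seq_incr_1 in Hl |].
  apply is_lim_seq_plus'; [apply is_lim_seq_const |].
  apply is_lim_seq_mult'; [apply is_lim_seq_const |].
  apply (is_lim_seq_incr_1 (fun n => / INR n)).
  replace (Finite 0) with (Rbar_inv p_infty) by reflexivity.
  apply is_lim_seq_inv; [apply is_lim_seq_INR | discriminate].
Qed.

Lemma euler_limit (z : R) :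
  0 < z -> exists l : R, 0 < l /\ is_lim_seq (euler_term z) l.
Proof.
  intros Hz.
  assert (Main : forall n z, 0 < z <= INR n + 1 ->
            exists l : R, 0 < l /\ is_lim_seq (euler_term z) l).
  { clear z Hz. induction n as [|n IH]; intros z Hz.
    - apply euler_limit_base. simpl in Hz. lra.
    - rewrite S_INR in Hz. destruct (Rle_lt_dec z 1) as [H1 | H1].
      + apply euler_limit_base. lra.
      + destruct (IH (z - 1)) as [l [Hl Hlim]]; [lra |].
        exists (l / (z - 1)). split; [apply Rdiv_lt_0_compat; lra |].
        replace z with (z - 1 + 1) at 1 by ring. apply euler_limit_S; [lra | exact Hlim]. }
  destruct (nfloor_ex z) as [n Hn]; [lra |]. apply (Main n). lra.
Qed.

Lemma rgamma_lim (z l : R) : is_lim_seq (euler_term z) l -> rgamma z = l.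
Proof.
  intros H. change (real (Lim_seq (euler_term z)) = l). now rewrite (is_lim_seq_unique _ _ H).
Qed.

Lemma rgamma_pos (z : R) : 0 < z -> 0 < rgamma z.
Proof.
  intros Hz. destruct (euler_limit z Hz) as [l [Hl H]]. now rewrite (rgamma_lim z l H).
Qed.

(** At [z = 0] each Euler product contains the factor 0 and both sides vanish. This boundary case
    gives access to the order [nu - 1 = -1] when [nu = 0]. *)
Lemma rgamma_S (z : R) : 0 <= z -> rgamma z = z * rgamma (z + 1).
Proof.
  intros [Hz | <-].
  - destruct (euler_limit z Hz) as [l [Hl H]].
    rewrite (rgamma_lim z l H), (rgamma_lim _ _ (euler_limit_S z l Hz H)). field. lra.
  - rewrite Rmult_0_l. apply rgamma_lim.
    apply is_lim_seq_ext with (fun _ => 0); [| apply is_lim_seq_const].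
    intros n. unfold euler_term.
    assert (E : prod_f_R0 (fun k => 0 + INR k) n = 0).
    { induction n as [|n IH]; [simpl; ring |]. simpl. rewrite IH. ring. }
    rewrite E. unfold Rdiv. ring.
Qed.

(* [BesselI nu x = (x/2)^nu * PSeries (bessel_coef nu) (x^2/4)]. *)
Definition bessel_coef (nu : R) (k : nat) : R := rgamma (nu + INR k + 1) / INR (fact k).

Lemma bessel_coef_pos (nu : R) (k : nat) : 0 <= nu -> 0 < bessel_coef nu k.
Proof.
  intros Hnu. pose proof (pos_INR k).
  apply Rdiv_lt_0_compat; [apply rgamma_pos; lra | apply INR_fact_lt_0].
Qed.

Lemma bessel_coef_radius (nu : R) : 0 <= nu -> CV_radius (bessel_coef nu) = p_infty.
Proof.
  intros Hnu. apply CV_radius_infinite_DAlembert.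
  - intros n. pose proof (bessel_coef_pos nu n Hnu). lra.
  - assert (Hinv : is_lim_seq (fun n => / INR (S n)) 0).
    { apply (is_lim_seq_incr_1 (fun n => / INR n)).
      replace (Finite 0) with (Rbar_inv p_infty) by reflexivity.
      apply is_lim_seq_inv; [apply is_lim_seq_INR | discriminate]. }
    apply is_lim_seq_le_le with (u := fun _ => 0) (w := fun n => / INR (S n));
      [| apply is_lim_seq_const | exact Hinv].
    intros n. split; [apply Rabs_pos |].
    pose proof (bessel_coef_pos nu n Hnu) as H1. pose proof (bessel_coef_pos nu (S n) Hnu) as H2.
    rewrite Rabs_right by (apply Rle_ge, Rlt_le, Rdiv_lt_0_compat; assumption).
    assert (H3 := pos_INR n).
    assert (E : bessel_coef nu n = (nu + INR n + 1) * INR (S n) * bessel_coef nu (S n)).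
    { unfold bessel_coef. rewrite fact_simpl, mult_INR, (rgamma_S (nu + INR n + 1)) by lra.
      replace (nu + INR (S n) + 1) with (nu + INR n + 1 + 1) by (rewrite S_INR; ring).
      pose proof (INR_fact_neq_0 n). field. split; [exact H | rewrite S_INR; lra]. }
    rewrite E.
    replace (bessel_coef nu (S n) / ((nu + INR n + 1) * INR (S n) * bessel_coef nu (S n)))
      with (/ INR (S n) * / (nu + INR n + 1)) by (field; rewrite S_INR; lra).
    rewrite <- (Rmult_1_r (/ INR (S n))) at 2. apply Rmult_le_compat_l.
    + apply Rlt_le, Rinv_0_lt_compat. rewrite S_INR; lra.
    + rewrite <- Rinv_1. apply Rinv_le_contravar; lra.
Qed.

Lemma bessel_ex_pseries (nu t : R) : 0 <= nu -> ex_pseries (bessel_coef nu) t.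
Proof. intros Hnu. apply CV_radius_inside. rewrite bessel_coef_radius; [exact I | exact Hnu]. Qed.

Lemma bessel_series_pos (nu t : R) : 0 <= nu -> 0 <= t -> 0 < PSeries (bessel_coef nu) t.
Proof.
  intros Hnu Ht.
  assert (He : ex_series (fun k => bessel_coef nu k * t ^ k)).
  { apply ex_pseries_R. now apply bessel_ex_pseries. }
  unfold PSeries. rewrite Series_incr_1 by exact He.
  apply Rplus_lt_le_0_compat.
  - simpl. pose proof (bessel_coef_pos nu 0 Hnu). lra.
  - rewrite <- (Rmult_0_l (Series (fun k => bessel_coef nu (S k) * t ^ S k))), <- Series_scal_l.
    apply Series_le.
    + intros n. rewrite Rmult_0_l. split; [lra |]. apply Rmult_le_pos; [now apply Rlt_le, bessel_coef_pos |].
      now apply pow_le.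
    + now apply (ex_series_incr_1 (fun k => bessel_coef nu k * t ^ k)) in He.
Qed.

(** The three-term recurrence [I_{nu-1} = (2 nu / x) I_nu + I_{nu+1}] without prefactors, checked
    coefficientwise through [rgamma_S]. It expresses the possibly negative order [nu - 1] by orders
    at least 0, for which positivity and convergence are available. *)
Lemma bessel_series_rec (nu t : R) : 0 <= nu ->
  PSeries (bessel_coef (nu - 1)) t
  = nu * PSeries (bessel_coef nu) t + t * PSeries (bessel_coef (nu + 1)) t.
Proof.
  intros Hnu.
  rewrite <- (PSeries_incr_1 (bessel_coef (nu + 1))), <- PSeries_scal, <- PSeries_plus.
  - apply PSeries_ext. intros [|k].
    + change (bessel_coef (nu - 1) 0 = nu * bessel_coef nu 0 + 0). unfold bessel_coef. simpl.
      replace (nu - 1 + 0 + 1) with nu by ring. replace (nu + 0 + 1) with (nu + 1) by ring.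
      rewrite (rgamma_S nu Hnu). field.
    + change (bessel_coef (nu - 1) (S k) = nu * bessel_coef nu (S k) + bessel_coef (nu + 1) k).
      unfold bessel_coef. rewrite fact_simpl, mult_INR. assert (H := pos_INR k).
      replace (nu - 1 + INR (S k) + 1) with (nu + INR (S k)) by ring.
      rewrite (rgamma_S (nu + INR (S k))) by (rewrite S_INR; lra).
      replace (nu + 1 + INR k + 1) with (nu + INR (S k) + 1) by (rewrite S_INR; ring).
      pose proof (INR_fact_neq_0 k). rewrite S_INR in *. field. split; [exact H0 | lra].
  - apply ex_pseries_scal; [apply Rmult_comm |]. now apply bessel_ex_pseries.
  - apply ex_pseries_incr_1. apply bessel_ex_pseries. lra.
Qed.

Lemma bessel_series_derive (nu t : R) : 0 <= nu ->
  is_derive (PSeries (bessel_coef nu)) t (PSeries (bessel_coef (nu + 1)) t).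
Proof.
  intros Hnu. rewrite (PSeries_ext (bessel_coef (nu + 1)) (PS_derive (bessel_coef nu))).
  - apply is_derive_PSeries. rewrite bessel_coef_radius; [exact I | exact Hnu].
  - intros k. unfold PS_derive, bessel_coef. rewrite fact_simpl, mult_INR.
    replace (nu + 1 + INR k + 1) with (nu + INR (S k) + 1) by (rewrite S_INR; ring).
    pose proof (INR_fact_neq_0 k). pose proof (pos_INR k). rewrite S_INR in *. field.
    split; [exact H | lra].
Qed.

(* [phiI nu x = x I_{nu-1}(x) / I_nu(x)]; the prefactors (x/2)^nu cancel. *)
Definition phiI (nu x : R) : R :=
  2 * PSeries (bessel_coef (nu - 1)) (x * x / 4) / PSeries (bessel_coef nu) (x * x / 4).

Lemma BesselI_series (nu x : R) :
  BesselI nu x = Rpower (x / 2) nu * PSeries (bessel_coef nu) (x * x / 4).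
Proof.
  unfold BesselI, PSeries. f_equal. apply Series_ext. intros k. unfold bessel_coef.
  rewrite pow_mult. replace ((x / 2) ^ 2) with (x * x / 4) by field. unfold Rdiv. ring.
Qed.

Lemma sqr_quarter_nonneg (x : R) : 0 <= x * x / 4.
Proof. nra. Qed.

Lemma ratioI_phiI (nu x : R) : 0 <= nu -> 0 < x -> ratioI nu x = phiI nu x / x.
Proof.
  intros Hnu Hx. unfold ratioI, phiI. rewrite !BesselI_series.
  pose proof (bessel_series_pos nu (x * x / 4) Hnu (sqr_quarter_nonneg x)) as Hp.
  replace (nu - 1) with (nu + - (1)) at 1 by ring.
  rewrite Rpower_plus, Rpower_Ropp, Rpower_1 by lra.
  assert (H : 0 < Rpower (x / 2) nu) by apply exp_pos.
  field. repeat split; lra.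
Qed.

Lemma phiI_rec (nu x : R) : 0 <= nu ->
  phiI nu x = 2 * nu + 2 * (x * x / 4) * PSeries (bessel_coef (nu + 1)) (x * x / 4)
                       / PSeries (bessel_coef nu) (x * x / 4).
Proof.
  intros Hnu. unfold phiI. rewrite bessel_series_rec by exact Hnu.
  pose proof (bessel_series_pos nu (x * x / 4) Hnu (sqr_quarter_nonneg x)) as Hp.
  field. lra.
Qed.

Lemma phiI_pos (nu x : R) : 0 <= nu -> 0 < x -> 0 < phiI nu x.
Proof.
  intros Hnu Hx. rewrite phiI_rec by exact Hnu.
  assert (0 < x * x / 4) by nra.
  apply Rplus_le_lt_0_compat; [lra |]. apply Rdiv_lt_0_compat.
  - apply Rmult_lt_0_compat; [lra |]. apply bessel_series_pos; lra.
  - apply bessel_series_pos; lra.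
Qed.

Lemma phiI_fraction (nu x : R) : 0 <= nu -> 0 < x ->
  phiI nu x = 2 * nu + x ^ 2 / phiI (nu + 1) x.
Proof.
  intros Hnu Hx. rewrite phiI_rec by exact Hnu. unfold phiI.
  replace (nu + 1 - 1) with nu by ring.
  pose proof (bessel_series_pos nu (x * x / 4) Hnu (sqr_quarter_nonneg x)) as Hp.
  pose proof (bessel_series_pos (nu + 1) (x * x / 4) ltac:(lra) (sqr_quarter_nonneg x)) as Hp'.
  field. lra.
Qed.

(** The lower bound drops a positive term of the continued fraction; inserted for order [nu + 1]
    into the same fraction, it yields the upper bound. *)
Lemma phiI_bounds (nu x : R) : 0 <= nu -> 0 < x ->
  2 * nu < phiI nu x <= 2 * nu + x ^ 2 / (2 * (nu + 1)).
Proof.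
  intros Hnu Hx. assert (H0 : 0 < x ^ 2) by now apply pow_lt.
  assert (Hlow : forall mu, 0 <= mu -> 2 * mu < phiI mu x).
  { intros mu Hmu. rewrite phiI_fraction by assumption.
    assert (0 < x ^ 2 / phiI (mu + 1) x); [| lra].
    apply Rdiv_lt_0_compat; [exact H0 | apply phiI_pos; lra]. }
  split; [now apply Hlow |]. rewrite phiI_fraction by assumption.
  apply Rplus_le_compat_l, Rmult_le_compat_l; [lra |].
  apply Rinv_le_contravar; [lra |]. apply Rlt_le, Hlow. lra.
Qed.

Lemma phiI_at_0 (nu : R) : 0 <= nu -> filterlim (phiI nu) (at_right 0) (locally (2 * nu)).
Proof.
  intros Hnu.
  apply filterlim_squeeze_le with (f := fun _ => 2 * nu)
    (h := fun x => 2 * nu + x ^ 2 / (2 * (nu + 1))).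
  - generalize at_right_pos. apply filter_imp. intros x Hx.
    pose proof (phiI_bounds nu x Hnu Hx). lra.
  - apply filterlim_const.
  - eapply filterlim_eq.
    + apply filterlim_Rplus; [apply filterlim_const |].
      apply filterlim_Rmult; [apply filterlim_Rpow, filterlim_id_at_right |].
      apply filterlim_const.
    + simpl. ring.
Qed.

Lemma phiI_riccati (nu x : R) : 0 <= nu -> 0 < x ->
  is_derive (phiI nu) x ((x ^ 2 + 2 * nu * phiI nu x - phiI nu x ^ 2) / x).
Proof.
  intros Hnu Hx.
  set (S0 := PSeries (bessel_coef nu)). set (S1 := PSeries (bessel_coef (nu + 1))).
  set (t := x * x / 4).
  assert (Ht : 0 < t) by (unfold t; nra).
  assert (Hp : 0 < S0 t) by (apply bessel_series_pos; lra).
  set (Sm := PSeries (bessel_coef (nu - 1))).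
  assert (Hrec : Sm t = nu * S0 t + t * S1 t) by now apply bessel_series_rec.
  (* Since [nu - 1] may be negative, [Sm] is differentiated through its expression by [S0] and [S1];
     the recurrence at order [nu + 1] collapses the result to [S0]. *)
  assert (Hm : is_derive Sm t (S0 t)).
  { apply is_derive_ext with (fun s => nu * S0 s + s * S1 s).
    - intros s. unfold Sm. now rewrite bessel_series_rec.
    - assert (D0 : is_derive S0 t (S1 t)) by (apply bessel_series_derive; lra).
      assert (D1 : is_derive S1 t (PSeries (bessel_coef (nu + 1 + 1)) t))
        by (apply bessel_series_derive; lra).
      assert (R1 := bessel_series_rec (nu + 1) t ltac:(lra)).
      replace (nu + 1 - 1) with nu in R1 by ring.
      fold S0 S1 in R1. rewrite R1. auto_derive.
      + split; [now exists (S1 t) | split; [now eexists; exact D1 | exact I]].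
      + rewrite (is_derive_unique (fun y : R => S0 y) t _ D0),
          (is_derive_unique (fun y : R => S1 y) t _ D1). ring. }
  assert (D0 : is_derive S0 t (S1 t)) by (apply bessel_series_derive; lra).
  change (phiI nu) with (fun y => 2 * Sm (y * y / 4) / S0 (y * y / 4)).
  assert (E : S1 t = (Sm t - nu * S0 t) / t).
  { rewrite Hrec. clearbody t S0 S1. clear - Ht. field. lra. }
  clear Hrec. clearbody Sm S0 S1.
  auto_derive.
  - change (x * x * / 4) with t. split; [now exists (S0 t) | split; [now exists (S1 t) | split; [lra | exact I]]].
  - change (x * x * / 4) with t. change (x * x / 4) with t.
    rewrite (is_derive_unique (fun y : R => S0 y) t _ D0),
      (is_derive_unique (fun y : R => Sm y) t _ Hm), E.
    revert Hp Hx. clear. generalize (S0 t) (Sm t). intros s0 sm Hp Hx. unfold t in *.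
    field. split; lra.
Qed.

(** * Modified Bessel functions of the second kind *)

(* [improper f l]: the integral of [f] over [0, +oo) is [l]; carrying a primitive of [f]
   turns linearity, comparison and integration by parts into statements on derivatives. *)
Definition improper (f : R -> R) (l : R) : Prop :=
  exists G : R -> R, G 0 = 0 /\ (forall t, is_derive G t (f t)) /\
    filterlim G (Rbar_locally p_infty) (locally l).

Lemma improper_ext (f g : R -> R) (l : R) :
  (forall t, f t = g t) -> improper f l -> improper g l.
Proof.
  intros E [G [H0 [H1 H2]]]. exists G. split; [exact H0 | split; [| exact H2]].
  intros t. rewrite <- E. apply H1.
Qed.

Lemma improper_plus (f g : R -> R) (a b : R) :
  improper f a -> improper g b -> improper (fun t => f t + g t) (a + b).
Proof.
  intros [G [H0 [H1 H2]]] [G' [H0' [H1' H2']]]. exists (fun t => G t + G' t). split; [lra |].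
  split; [| now apply filterlim_Rplus].
  intros t. apply (is_derive_plus G G'); [apply H1 | apply H1'].
Qed.

Lemma improper_scal (f : R -> R) (a c : R) :
  improper f a -> improper (fun t => c * f t) (c * a).
Proof.
  intros [G [H0 [H1 H2]]]. exists (fun t => c * G t). split; [rewrite H0; ring |].
  split; [| apply filterlim_Rmult; [apply filterlim_const | exact H2]].
  intros t. apply (is_derive_scal G t c). apply H1.
Qed.

Lemma improper_nonneg (f : R -> R) (a : R) :
  (forall t, 0 <= t -> 0 <= f t) -> improper f a -> 0 <= a.
Proof.
  intros Hf [G [H0 [H1 H2]]]. apply Rnot_lt_le. intros Ha.
  pose proof (filterlim_neg_eventually _ G a 0 H2 Ha) as [X HX].
  set (c := Rmax 0 (X + 1)).
  assert (Hc : 0 <= c /\ X < c) by (unfold c, Rmax; destruct (Rle_dec 0 (X + 1)); lra).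
  assert (G 0 <= G c).
  { apply (derive_nonneg_incr G f); [lra | intros; apply H1 | intros; apply Hf; lra]. }
  pose proof (HX c (proj2 Hc)). lra.
Qed.

Lemma improper_le (f g : R -> R) (a b : R) :
  (forall t, 0 <= t -> f t <= g t) -> improper f a -> improper g b -> a <= b.
Proof.
  intros Hfg Hf Hg.
  assert (0 <= b + (-1) * a); [| lra].
  apply (improper_nonneg (fun t => g t + (-1) * f t)).
  - intros t Ht. specialize (Hfg t Ht). lra.
  - apply improper_plus; [exact Hg | now apply improper_scal].
Qed.

Lemma improper_unique (f : R -> R) (a b : R) : improper f a -> improper f b -> a = b.
Proof.
  intros Ha Hb. apply Rle_antisym.
  - apply (improper_le f f); [intros; lra | exact Ha | exact Hb].
  - apply (improper_le f f); [intros; lra | exact Hb | exact Ha].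
Qed.

Lemma improper_pos (f : R -> R) (a : R) :
  (forall t, 0 <= t -> 0 < f t) -> improper f a -> 0 < a.
Proof.
  intros Hf [G [H0 [H1 H2]]].
  assert (G 0 < G 1).
  { apply (derive_pos_incr G f); [lra | intros; apply H1 | intros; apply Hf; lra]. }
  apply Rnot_le_lt. intros Ha.
  pose proof (filterlim_neg_eventually _ G a (G 1) H2 ltac:(lra)) as [X HX].
  set (c := Rmax 1 (X + 1)).
  assert (Hc : 1 <= c /\ X < c) by (unfold c, Rmax; destruct (Rle_dec 1 (X + 1)); lra).
  assert (G 1 <= G c).
  { apply (derive_nonneg_incr G f); [lra | intros; apply H1 |].
    intros; apply Rlt_le, Hf; lra. }
  pose proof (HX c (proj2 Hc)). lra.
Qed.

Lemma filterlim_incr_bounded (G : R -> R) (M : R) :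
  (forall a b, 0 <= a <= b -> G a <= G b) -> (forall a, 0 <= a -> G a <= M) ->
  exists l, filterlim G (Rbar_locally p_infty) (locally l).
Proof.
  intros Hi Hb.
  destruct (completeness (fun y => exists a, 0 <= a /\ y = G a)) as [l [Hl1 Hl2]].
  - exists M. intros y [a [Ha ->]]. now apply Hb.
  - exists (G 0). exists 0. split; [lra | reflexivity].
  - exists l. apply filterlim_epsilon; [typeclasses eauto |]. intros e He.
    destruct (classic (exists a, 0 <= a /\ l - e < G a)) as [[a [Ha Hae]] | Hn].
    + exists a. intros x Hx. assert (G a <= G x) by (apply Hi; lra).
      assert (G x <= l) by (apply Hl1; exists x; split; [lra | reflexivity]).
      apply Rabs_def1; lra.
    + exfalso. assert (l <= l - e); [| lra]. apply Hl2. intros y [a [Ha ->]].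
      apply Rnot_lt_le. intros Hc. apply Hn. exists a. now split.
Qed.

(** The primitive [G] is nondecreasing on the half-line and [G + C exp (- t)] is nonincreasing
    there, so [G] is bounded by [C]. *)
Lemma improper_exists (f : R -> R) (C : R) :
  (forall t, continuous f t) -> (forall t, 0 <= t -> 0 <= f t <= C * exp (- t)) ->
  exists l, improper f l.
Proof.
  intros Hc Hf.
  assert (Hd : forall t, is_derive (RInt f 0) t (f t)).
  { intros t. apply (is_derive_RInt f (RInt f 0) 0 t); [| apply Hc].
    apply filter_forall. intros u.
    apply (RInt_correct f 0 u), (ex_RInt_continuous f 0 u). intros z _. apply Hc. }
  assert (H0 : RInt f 0 0 = 0) by apply (RInt_point 0 f).
  revert Hd H0. generalize (RInt f 0). intros G Hd H0.
  destruct (filterlim_incr_bounded G C) as [l Hl].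
  - intros a b Hab. apply (derive_nonneg_incr G f); [lra | intros; apply Hd |].
    intros; apply Hf; lra.
  - intros a Ha. pose proof (exp_pos (- a)).
    assert (HC : 0 <= C).
    { destruct (Hf 0 (Rle_refl 0)) as [HA HB]. rewrite Ropp_0, exp_0 in HB. lra. }
    assert (- G 0 - C * exp (- 0) <= - G a - C * exp (- a)).
    { apply (derive_nonneg_incr (fun t => - G t - C * exp (- t))
        (fun t => C * exp (- t) - f t)); [exact Ha | |].
      - intros x Hx. auto_derive; [now exists (f x) |].
        rewrite (is_derive_unique (fun y : R => G y) x _ (Hd x)). ring.
      - intros x Hx. specialize (Hf x ltac:(lra)). lra. }
    rewrite H0, Ropp_0, exp_0 in H1. nra.
  - exists l, G. split; [exact H0 | split; [exact Hd | exact Hl]].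
Qed.

Lemma RInt_gen_improper (f : R -> R) (l : R) :
  (forall t, continuous f t) -> improper f l ->
  RInt_gen f (at_point 0) (Rbar_locally p_infty) = l.
Proof.
  intros Hc [G [H0 [H1 H2]]]. apply is_RInt_gen_unique.
  intros P HP. specialize (H2 P HP).
  apply Filter_prod with (Q := fun a => a = 0) (R := fun b => P (G b)).
  - reflexivity.
  - exact H2.
  - intros a b -> Hb. simpl. exists (G b). split; [| exact Hb].
    replace (G b) with (minus (G b) (G 0)) by (rewrite H0; unfold minus, plus, opp; simpl; ring).
    apply (is_RInt_derive G f).
    + intros x _. apply H1.
    + intros x _. apply Hc.
Qed.

(** * The integral kernel of [BesselK]: decay, recurrence, derivative *)

Definition bessel_kernel (nu x t : R) : R := exp (- x * cosh t) * cosh (nu * t).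

Lemma bessel_kernel_continuous (nu x t : R) : continuous (bessel_kernel nu x) t.
Proof.
  apply (ex_derive_continuous (bessel_kernel nu x)). unfold bessel_kernel. now auto_derive.
Qed.

Lemma cosh_ge_1 (t : R) : 1 <= cosh t.
Proof.
  unfold cosh. rewrite exp_Ropp. pose proof (exp_pos t) as H.
  assert (H' : 0 < / exp t) by now apply Rinv_0_lt_compat.
  assert (E : exp t * / exp t = 1) by (field; lra).
  pose proof (pow2_ge_0 (exp t - / exp t)). nra.
Qed.

Lemma bessel_kernel_pos (nu x t : R) : 0 < bessel_kernel nu x t.
Proof.
  apply Rmult_lt_0_compat; [apply exp_pos |]. pose proof (cosh_ge_1 (nu * t)). lra.
Qed.

(** From [cosh t >= exp t / 2 >= (1 + t / 2)^2 / 2 >= t^2 / 8], completing the square: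
    [2 (a + 1)^2 / x] is the maximum of [(a + 1) t - x t^2 / 8], attained at [t = 4 (a + 1) / x]. *)
Lemma exp_decay_bound (a x t : R) : 0 < x -> 0 <= t ->
  exp (- x * cosh t) * exp (a * t) <= exp (2 * (a + 1) ^ 2 / x) * exp (- t).
Proof.
  intros Hx Ht. rewrite <- !exp_plus.
  assert (Hc : t ^ 2 / 8 <= cosh t).
  { unfold cosh. pose proof (exp_pos (- t)). pose proof (exp_ineq1_le (t / 2)) as H2.
    assert (E : exp t = exp (t / 2) * exp (t / 2)) by (rewrite <- exp_plus; f_equal; field).
    rewrite E in *. nra. }
  assert (L : - x * cosh t + a * t <= 2 * (a + 1) ^ 2 / x + - t).
  { apply Rle_trans with (- x * (t ^ 2 / 8) + a * t); [nra |].
    assert (E : 2 * (a + 1) ^ 2 / x + - t - (- x * (t ^ 2 / 8) + a * t)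
                = x / 8 * (t - 4 * (a + 1) / x) ^ 2) by (field; lra).
    assert (0 <= x / 8 * (t - 4 * (a + 1) / x) ^ 2); [| lra].
    apply Rmult_le_pos; [lra | apply pow2_ge_0]. }
  destruct L as [L | ->]; [apply Rlt_le, exp_increasing, L | lra].
Qed.

Lemma exp_mult_le_abs (nu t : R) : 0 <= t -> exp (nu * t) <= exp (Rabs nu * t).
Proof.
  intros Ht. pose proof (Rle_abs nu).
  assert (L : nu * t <= Rabs nu * t) by nra.
  destruct L as [L | ->]; [apply Rlt_le, exp_increasing, L | lra].
Qed.

Lemma cosh_le_exp (nu t : R) : 0 <= t -> cosh (nu * t) <= exp (Rabs nu * t).
Proof.
  intros Ht. unfold cosh. pose proof (exp_mult_le_abs nu t Ht).
  pose proof (exp_mult_le_abs (- nu) t Ht). rewrite Rabs_Ropp in H0.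
  replace (- (nu * t)) with (- nu * t) by ring. lra.
Qed.

Lemma BesselK_improper (nu x : R) : 0 < x -> improper (bessel_kernel nu x) (BesselK nu x).
Proof.
  intros Hx.
  destruct (improper_exists (bessel_kernel nu x) (exp (2 * (Rabs nu + 1) ^ 2 / x))) as [l Hl].
  - apply bessel_kernel_continuous.
  - intros t Ht. split; [apply Rlt_le, bessel_kernel_pos |].
    apply Rle_trans with (2 := exp_decay_bound (Rabs nu) x t Hx Ht).
    apply Rmult_le_compat_l; [apply Rlt_le, exp_pos | now apply cosh_le_exp].
  - replace (BesselK nu x) with l; [exact Hl |]. symmetry.
    apply (RInt_gen_improper (bessel_kernel nu x)); [apply bessel_kernel_continuous | exact Hl].
Qed.

Lemma BesselK_pos (nu x : R) : 0 < x -> 0 < BesselK nu x.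
Proof.
  intros Hx. apply (improper_pos (bessel_kernel nu x)); [| now apply BesselK_improper].
  intros t _. apply bessel_kernel_pos.
Qed.

Lemma cosh_shift (nu t : R) :
  cosh ((nu + 1) * t) + cosh ((nu - 1) * t) = 2 * (cosh t * cosh (nu * t)).
Proof.
  unfold cosh. replace ((nu + 1) * t) with (nu * t + t) by ring.
  replace ((nu - 1) * t) with (nu * t + - t) by ring.
  rewrite !Ropp_plus_distr, !exp_plus, !exp_Ropp.
  pose proof (exp_pos t). pose proof (exp_pos (nu * t)). field. lra.
Qed.

Lemma cosh_diff (nu t : R) :
  cosh ((nu + 1) * t) - cosh ((nu - 1) * t) = 2 * (sinh t * sinh (nu * t)).
Proof.
  unfold cosh, sinh. replace ((nu + 1) * t) with (nu * t + t) by ring.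
  replace ((nu - 1) * t) with (nu * t + - t) by ring.
  rewrite !Ropp_plus_distr, !exp_plus, !exp_Ropp.
  pose proof (exp_pos t). pose proof (exp_pos (nu * t)). field. lra.
Qed.

Lemma filterlim_exp_opp : filterlim (fun t => exp (- t)) (Rbar_locally p_infty) (locally 0).
Proof.
  apply filterlim_squeeze_le with (f := fun _ => 0) (h := fun t => / t).
  - generalize (p_infty_gt 0). apply filter_imp. intros t Ht.
    split; [apply Rlt_le, exp_pos |]. rewrite exp_Ropp. apply Rinv_le_contravar; [exact Ht |].
    pose proof (exp_ineq1_le t). lra.
  - apply filterlim_const.
  - apply filterlim_inv_p_infty.
Qed.

(** Integration by parts: the combination of kernels is the derivative of
    [sinh (nu t) exp (- x cosh t)], which vanishes at 0 and at infinity. *)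
Lemma BesselK_rec (nu x : R) : 0 < x ->
  x * (BesselK (nu + 1) x - BesselK (nu - 1) x) = 2 * nu * BesselK nu x.
Proof.
  intros Hx.
  assert (H1 : improper (fun t => nu * bessel_kernel nu x t
                + (- x / 2 * bessel_kernel (nu + 1) x t + x / 2 * bessel_kernel (nu - 1) x t)) 0).
  { exists (fun t => sinh (nu * t) * exp (- x * cosh t)). split; [| split].
    - rewrite Rmult_0_r, sinh_0. ring.
    - intros t. unfold bessel_kernel.
      replace (nu * (exp (- x * cosh t) * cosh (nu * t))
        + (- x / 2 * (exp (- x * cosh t) * cosh ((nu + 1) * t))
           + x / 2 * (exp (- x * cosh t) * cosh ((nu - 1) * t))))
        with (nu * (exp (- x * cosh t) * cosh (nu * t))
        - x / 2 * exp (- x * cosh t) * (cosh ((nu + 1) * t) - cosh ((nu - 1) * t))) by field.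
      rewrite cosh_diff. auto_derive; [exact I | field].
    - apply filterlim_squeeze_le
        with (f := fun t => - exp (2 * (Rabs nu + 1) ^ 2 / x) * exp (- t))
             (h := fun t => exp (2 * (Rabs nu + 1) ^ 2 / x) * exp (- t)).
      + generalize (p_infty_gt 0). apply filter_imp. intros t Ht.
        pose proof (exp_decay_bound (Rabs nu) x t Hx ltac:(lra)) as HB.
        pose proof (exp_pos (- x * cosh t)) as HP.
        pose proof (cosh_le_exp nu t ltac:(lra)) as HC.
        assert (HS : - cosh (nu * t) <= sinh (nu * t) <= cosh (nu * t)).
        { unfold cosh, sinh. pose proof (exp_pos (nu * t)). pose proof (exp_pos (- (nu * t))). lra. }
        nra.
      + eapply filterlim_eq; [apply filterlim_Rmult; [apply filterlim_const | apply filterlim_exp_opp] | ring].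
      + eapply filterlim_eq; [apply filterlim_Rmult; [apply filterlim_const | apply filterlim_exp_opp] | ring]. }
  assert (H2 : improper (fun t => nu * bessel_kernel nu x t
                + (- x / 2 * bessel_kernel (nu + 1) x t + x / 2 * bessel_kernel (nu - 1) x t))
      (nu * BesselK nu x + (- x / 2 * BesselK (nu + 1) x + x / 2 * BesselK (nu - 1) x))).
  { apply improper_plus; [| apply improper_plus]; apply improper_scal; now apply BesselK_improper. }
  pose proof (improper_unique _ _ _ H1 H2). lra.
Qed.

(* The integrand is a positive multiple of [e^{nu t} (e^t - c)^2 + e^{- nu t} (e^{-t} - c)^2];
   the optimal [c] gives the Turan inequality [K_{nu+1}^2 <= K_nu K_{nu+2}]. *)
Lemma BesselK_turan (nu x c : R) : 0 < x ->
  0 <= BesselK (nu + 2) x - 2 * c * BesselK (nu + 1) x + c ^ 2 * BesselK nu x.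
Proof.
  intros Hx.
  replace (BesselK (nu + 2) x - 2 * c * BesselK (nu + 1) x + c ^ 2 * BesselK nu x)
    with (BesselK (nu + 2) x + (- 2 * c * BesselK (nu + 1) x + c ^ 2 * BesselK nu x)) by ring.
  apply (improper_nonneg (fun t => bessel_kernel (nu + 2) x t
    + (- 2 * c * bessel_kernel (nu + 1) x t + c ^ 2 * bessel_kernel nu x t))).
  - intros t Ht. unfold bessel_kernel, cosh at 2 4 6.
    replace ((nu + 2) * t) with (nu * t + t + t) by ring.
    replace ((nu + 1) * t) with (nu * t + t) by ring.
    rewrite !Ropp_plus_distr, !exp_plus, !exp_Ropp.
    pose proof (exp_pos t) as H1. pose proof (exp_pos (nu * t)) as H2.
    pose proof (exp_pos (- x * cosh t)) as H3.
    set (E := exp (- x * cosh t)) in *.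
    replace (E * ((exp (nu * t) * exp t * exp t + / exp (nu * t) * / exp t * / exp t) / 2) +
      (-2 * c * (E * ((exp (nu * t) * exp t + / exp (nu * t) * / exp t) / 2)) +
       c ^ 2 * (E * ((exp (nu * t) + / exp (nu * t)) / 2))))
      with (E / 2 * (exp (nu * t) * (exp t - c) ^ 2 + / exp (nu * t) * (/ exp t - c) ^ 2))
      by (field; lra).
    assert (0 < / exp (nu * t)) by now apply Rinv_0_lt_compat.
    apply Rmult_le_pos; [lra |].
    pose proof (pow2_ge_0 (exp t - c)). pose proof (pow2_ge_0 (/ exp t - c)). nra.
  - apply improper_plus; [now apply BesselK_improper |].
    apply improper_plus; apply improper_scal; now apply BesselK_improper.
Qed.

(** Pointwise, [cosh ((nu + 1) t) - cosh (nu t) = 2 sinh ((nu + 1/2) t) sinh (t / 2)], which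
    explains the threshold [-1/2]. *)
Lemma BesselK_incr (nu x : R) : 0 < x -> - (1 / 2) <= nu -> BesselK nu x <= BesselK (nu + 1) x.
Proof.
  intros Hx Hnu. apply (improper_le (bessel_kernel nu x) (bessel_kernel (nu + 1) x));
    [| now apply BesselK_improper | now apply BesselK_improper].
  intros t Ht. apply Rmult_le_compat_l; [apply Rlt_le, exp_pos |].
  set (p := exp ((nu + 1 / 2) * t)). set (r := exp (t / 2)).
  assert (Hp : 1 <= p) by (pose proof (exp_ineq1_le ((nu + 1 / 2) * t)); unfold p; nra).
  assert (Hr : 1 <= r) by (pose proof (exp_ineq1_le (t / 2)); unfold r; lra).
  assert (E : cosh ((nu + 1) * t) - cosh (nu * t) = (p - / p) * (r - / r) / 2).
  { unfold cosh. replace ((nu + 1) * t) with ((nu + 1 / 2) * t + t / 2) by field.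
    replace (nu * t) with ((nu + 1 / 2) * t + - (t / 2)) by field.
    rewrite !Ropp_plus_distr, !exp_plus, !exp_Ropp. fold p r. field. lra. }
  assert (Hip : / p <= p) by (apply Rle_trans with 1; [rewrite <- Rinv_1; apply Rinv_le_contravar; lra | lra]).
  assert (Hir : / r <= r) by (apply Rle_trans with 1; [rewrite <- Rinv_1; apply Rinv_le_contravar; lra | lra]).
  nra.
Qed.

Lemma exp_taylor2 (u : R) : 0 <= exp u - 1 - u <= u ^ 2 * exp (Rabs u).
Proof.
  pose proof (exp_ineq1_le u) as H1. split; [lra |].
  pose proof (exp_ineq1_le (- u)) as H2. pose proof (exp_pos u) as H3.
  assert (E : exp u * exp (- u) = 1) by (rewrite <- exp_plus, Rplus_opp_r; apply exp_0).
  assert (H4 : exp u - 1 <= u * exp u) by nra.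
  apply Rle_trans with (u * (exp u - 1)); [lra |].
  destruct (Rle_lt_dec 0 u) as [Hu | Hu].
  - rewrite Rabs_right by lra. nra.
  - rewrite Rabs_left by exact Hu. pose proof (exp_pos (- u)).
    assert (1 <= exp (- u)) by lra. nra.
Qed.

(** Dominates the second-order remainder, for differentiation under the integral. The factor
    [exp (Rabs d * cosh t)] of the remainder is absorbed by lowering [x] to [x / 2], hence the
    restriction on [d]. *)
Lemma kernel_taylor (nu x d t : R) : 0 < x -> Rabs d <= x / 2 ->
  Rabs (bessel_kernel nu (x + d) t - bessel_kernel nu x t
        + d / 2 * (bessel_kernel (nu + 1) x t + bessel_kernel (nu - 1) x t))
  <= d ^ 2 * (cosh t * (cosh t * bessel_kernel nu (x / 2) t)).
Proof.
  intros Hx Hd. unfold bessel_kernel.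
  assert (Hc := cosh_ge_1 t). assert (Hn := cosh_ge_1 (nu * t)).
  set (c := cosh t) in *. set (k := cosh (nu * t)) in *.
  replace (exp (- (x + d) * c) * k - exp (- x * c) * k
     + d / 2 * (exp (- x * c) * cosh ((nu + 1) * t) + exp (- x * c) * cosh ((nu - 1) * t)))
    with (exp (- (x + d) * c) * k - exp (- x * c) * k
     + d / 2 * exp (- x * c) * (cosh ((nu + 1) * t) + cosh ((nu - 1) * t))) by ring.
  rewrite cosh_shift. fold c k.
  replace (- (x + d) * c) with (- x * c + - (d * c)) by ring. rewrite exp_plus.
  replace (exp (- x * c) * exp (- (d * c)) * k - exp (- x * c) * k
     + d / 2 * exp (- x * c) * (2 * (c * k)))
    with (k * (exp (- x * c) * (exp (- (d * c)) - 1 - - (d * c)))) by field.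
  destruct (exp_taylor2 (- (d * c))) as [T1 T2].
  pose proof (exp_pos (- x * c)) as P1.
  rewrite Rabs_right; [| apply Rle_ge, Rmult_le_pos; [lra | apply Rmult_le_pos; lra]].
  replace (d ^ 2 * (c * (c * (exp (- (x / 2) * c) * k))))
    with (k * ((d * c) ^ 2 * exp (- (x / 2) * c))) by ring.
  apply Rmult_le_compat_l; [lra |].
  apply Rle_trans with (exp (- x * c) * ((- (d * c)) ^ 2 * exp (Rabs (- (d * c)))));
    [apply Rmult_le_compat_l; lra |].
  replace ((- (d * c)) ^ 2) with ((d * c) ^ 2) by ring.
  rewrite Rabs_Ropp, Rabs_mult, (Rabs_right c) by lra.
  replace (exp (- x * c) * ((d * c) ^ 2 * exp (Rabs d * c)))
    with ((d * c) ^ 2 * (exp (- x * c) * exp (Rabs d * c))) by ring.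
  apply Rmult_le_compat_l; [apply pow2_ge_0 |]. rewrite <- exp_plus.
  assert (L : - x * c + Rabs d * c <= - (x / 2) * c) by nra.
  destruct L as [L | ->]; [apply Rlt_le, exp_increasing, L | lra].
Qed.

Lemma BesselK_derive (nu x : R) : 0 < x ->
  is_derive (BesselK nu) x (- (BesselK (nu + 1) x + BesselK (nu - 1) x) / 2).
Proof.
  intros Hx.
  set (l := - (BesselK (nu + 1) x + BesselK (nu - 1) x) / 2).
  assert (Hx2 : 0 < x / 2) by lra.
  (* The integral of the dominating function: two applications of [cosh_shift] turn
     [cosh^2 t cosh (nu t)] into kernels of orders [nu + 2], [nu] and [nu - 2]. *)
  set (M := / 4 * (BesselK (nu + 1 + 1) (x / 2) + BesselK (nu + 1 - 1) (x / 2)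
            + (BesselK (nu - 1 + 1) (x / 2) + BesselK (nu - 1 - 1) (x / 2)))).
  assert (HM : improper (fun t => cosh t * (cosh t * bessel_kernel nu (x / 2) t)) M).
  { apply improper_ext with (fun t => / 4 *
      (bessel_kernel (nu + 1 + 1) (x / 2) t + bessel_kernel (nu + 1 - 1) (x / 2) t
       + (bessel_kernel (nu - 1 + 1) (x / 2) t + bessel_kernel (nu - 1 - 1) (x / 2) t))).
    - intros t. unfold bessel_kernel.
      pose proof (cosh_shift (nu + 1) t) as E1. pose proof (cosh_shift (nu - 1) t) as E2.
      pose proof (cosh_shift nu t) as E3.
      replace (cosh ((nu + 1 + 1) * t)) with (2 * (cosh t * cosh ((nu + 1) * t)) - cosh ((nu + 1 - 1) * t)) by lra.
      replace (cosh ((nu - 1 + 1) * t)) with (2 * (cosh t * cosh ((nu - 1) * t)) - cosh ((nu - 1 - 1) * t)) by lra.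
      replace (cosh ((nu + 1) * t)) with (2 * (cosh t * cosh (nu * t)) - cosh ((nu - 1) * t)) by lra.
      field.
    - apply improper_scal. repeat apply improper_plus; now apply BesselK_improper. }
  assert (HM0 : 0 <= M).
  { apply (improper_nonneg _ M) with (2 := HM). intros t _.
    pose proof (cosh_ge_1 t). pose proof (bessel_kernel_pos nu (x / 2) t).
    apply Rmult_le_pos; [lra | apply Rmult_le_pos; lra]. }
  assert (Main : forall d, Rabs d <= x / 2 ->
            Rabs (BesselK nu (x + d) - BesselK nu x - d * l) <= d ^ 2 * M).
  { intros d Hd.
    assert (Hxd : 0 < x + d) by (apply Rabs_le_between in Hd; lra).
    assert (HI : improper (fun t => bessel_kernel nu (x + d) t + -1 * bessel_kernel nu x t
        + d / 2 * (bessel_kernel (nu + 1) x t + bessel_kernel (nu - 1) x t))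
        (BesselK nu (x + d) + -1 * BesselK nu x
        + d / 2 * (BesselK (nu + 1) x + BesselK (nu - 1) x))).
    { apply improper_plus; [apply improper_plus; [| apply improper_scal] |
        apply improper_scal, improper_plus]; now apply BesselK_improper. }
    replace (BesselK nu (x + d) - BesselK nu x - d * l)
      with (BesselK nu (x + d) + -1 * BesselK nu x
        + d / 2 * (BesselK (nu + 1) x + BesselK (nu - 1) x)) by (unfold l; field).
    apply Rabs_le. split.
    - replace (- (d ^ 2 * M)) with (- d ^ 2 * M) by ring.
      apply (improper_le _ _ _ _) with (2 := improper_scal _ _ (- d ^ 2) HM) (3 := HI).
      intros t _. pose proof (kernel_taylor nu x d t Hx Hd) as H.
      apply Rabs_le_between in H. lra.
    - apply (improper_le _ _ _ _) with (2 := HI) (3 := improper_scal _ _ (d ^ 2) HM).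
      intros t _. pose proof (kernel_taylor nu x d t Hx Hd) as H.
      apply Rabs_le_between in H. lra. }
  apply is_derive_Reals. intros eps Heps.
  assert (Hde : 0 < Rmin (x / 2) (eps / (M + 1))).
  { apply Rmin_pos; [lra |]. apply Rdiv_lt_0_compat; lra. }
  exists (mkposreal _ Hde). intros h Hh0 Hh. simpl in Hh.
  pose proof (Rmin_l (x / 2) (eps / (M + 1))). pose proof (Rmin_r (x / 2) (eps / (M + 1))).
  pose proof (Main h ltac:(lra)) as HB.
  replace ((BesselK nu (x + h) - BesselK nu x) / h - l)
    with ((BesselK nu (x + h) - BesselK nu x - h * l) / h) by (field; exact Hh0).
  unfold Rdiv. rewrite Rabs_mult, Rabs_inv.
  assert (Hh1 : 0 < Rabs h) by now apply Rabs_pos_lt.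
  assert (Hh2 : Rabs h * (M + 1) < eps).
  { apply Rlt_le_trans with (eps / (M + 1) * (M + 1)); [apply Rmult_lt_compat_r; lra |].
    right; field; lra. }
  apply Rle_lt_trans with (Rabs h * M); [| lra].
  apply Rmult_le_reg_r with (Rabs h); [exact Hh1 |].
  rewrite Rmult_assoc, Rinv_l, Rmult_1_r by lra.
  apply Rle_trans with (1 := HB). rewrite <- (pow2_abs h). right; ring.
Qed.

(** * The ratio [K_{nu+1} / K_nu] and its a priori bounds *)

Definition psiK (nu x : R) : R := x * BesselK (nu + 1) x / BesselK nu x.

Lemma ratioK_psiK (nu x : R) : 0 < x -> ratioK nu x = psiK nu x / x.
Proof.
  intros Hx. unfold ratioK, psiK. pose proof (BesselK_pos nu x Hx). field. lra.
Qed.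

Lemma psiK_pos (nu x : R) : 0 < x -> 0 < psiK nu x.
Proof.
  intros Hx. apply Rdiv_lt_0_compat; [apply Rmult_lt_0_compat; [exact Hx |] |]; now apply BesselK_pos.
Qed.

Lemma psiK_ge (nu x : R) : - (1 / 2) <= nu -> 0 < x -> x <= psiK nu x.
Proof.
  intros Hnu Hx. unfold psiK. pose proof (BesselK_pos nu x Hx). pose proof (BesselK_incr nu x Hx Hnu).
  apply Rmult_le_reg_r with (BesselK nu x); [assumption |].
  unfold Rdiv. rewrite Rmult_assoc, Rinv_l by lra. nra.
Qed.

Lemma psiK_fraction (nu x : R) : 0 < x -> psiK nu x = 2 * nu + x ^ 2 / psiK (nu - 1) x.
Proof.
  intros Hx. unfold psiK. replace (nu - 1 + 1) with nu by ring.
  pose proof (BesselK_pos nu x Hx). pose proof (BesselK_pos (nu - 1) x Hx).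
  pose proof (BesselK_rec nu x Hx) as E.
  replace (x * BesselK (nu + 1) x) with (2 * nu * BesselK nu x + x * BesselK (nu - 1) x) by lra.
  field. lra.
Qed.

Lemma psiK_riccati (nu x : R) : 0 < x ->
  is_derive (psiK nu) x ((psiK nu x ^ 2 - 2 * nu * psiK nu x - x ^ 2) / x).
Proof.
  intros Hx. unfold psiK.
  pose proof (BesselK_pos nu x Hx) as HP.
  pose proof (BesselK_derive nu x Hx) as D0. pose proof (BesselK_derive (nu + 1) x Hx) as D1.
  pose proof (BesselK_rec nu x Hx) as R0. pose proof (BesselK_rec (nu + 1) x Hx) as R1.
  replace (nu + 1 - 1) with nu in * by ring.
  auto_derive.
  - split; [eexists; exact D1 |]. split; [eexists; exact D0 |]. split; [lra | exact I].
  - rewrite (is_derive_unique (fun y : R => BesselK (nu + 1) y) x _ D1),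
      (is_derive_unique (fun y : R => BesselK nu y) x _ D0).
    assert (E1 : BesselK (nu - 1) x = BesselK (nu + 1) x - 2 * nu * BesselK nu x / x)
      by (rewrite <- R0; field; lra).
    assert (E2 : BesselK (nu + 1 + 1) x = BesselK nu x + 2 * (nu + 1) * BesselK (nu + 1) x / x)
      by (rewrite <- R1; field; lra).
    rewrite E1, E2. field. lra.
Qed.

(** By the continued fraction the expression is a positive multiple of
    [psiK nu x - psiK (nu - 1) x]; it is also [x] times the derivative of [psiK nu], which is
    therefore monotone. *)
Lemma psiK_turan (nu x : R) : 0 < x -> 0 <= psiK nu x ^ 2 - 2 * nu * psiK nu x - x ^ 2.
Proof.
  intros Hx.
  pose proof (psiK_pos (nu - 1) x Hx) as Hm. pose proof (psiK_pos nu x Hx) as Hp.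
  assert (L : psiK (nu - 1) x <= psiK nu x).
  (* The parameter is [K_nu / K_{nu-1}], the minimiser of the quadratic. *)
  { pose proof (BesselK_turan (nu - 1) x (psiK (nu - 1) x / x) Hx) as T.
    revert Hm T. unfold psiK. replace (nu - 1 + 1) with nu by ring.
    replace (nu - 1 + 2) with (nu + 1) by ring. intros Hm T.
    pose proof (BesselK_pos (nu - 1) x Hx) as Pm. pose proof (BesselK_pos nu x Hx) as P0.
    set (K0 := BesselK nu x) in *. set (Km := BesselK (nu - 1) x) in *.
    set (Kp := BesselK (nu + 1) x) in *.
    assert (E : Kp - 2 * (x * K0 / Km / x) * K0 + (x * K0 / Km / x) ^ 2 * Km = Kp - K0 ^ 2 / Km)
      by (field; lra).
    rewrite E in T.
    assert (E' : x * Kp / K0 - x * K0 / Km = x * (Kp - K0 ^ 2 / Km) / K0) by (field; lra).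
    assert (0 <= x * (Kp - K0 ^ 2 / Km) / K0); [| lra].
    apply Rmult_le_pos; [nra | now apply Rlt_le, Rinv_0_lt_compat]. }
  pose proof (psiK_fraction nu x Hx) as F.
  assert (E : psiK nu x ^ 2 - 2 * nu * psiK nu x - x ^ 2
              = x ^ 2 * (psiK nu x - psiK (nu - 1) x) / psiK (nu - 1) x).
  { replace (psiK nu x ^ 2 - 2 * nu * psiK nu x) with (psiK nu x * (psiK nu x - 2 * nu)) by ring.
    rewrite F at 2. field. lra. }
  rewrite E. apply Rmult_le_pos; [| now apply Rlt_le, Rinv_0_lt_compat].
  apply Rmult_le_pos; [nra | lra].
Qed.

Lemma psiK_gt (nu x : R) : 0 < x -> 2 * nu < psiK nu x.
Proof.
  intros Hx. rewrite psiK_fraction by exact Hx.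
  assert (0 < x ^ 2 / psiK (nu - 1) x); [| lra].
  apply Rdiv_lt_0_compat; [nra | now apply psiK_pos].
Qed.

Lemma psiK_le (nu x : R) : 1 / 2 <= nu -> 0 < x -> psiK nu x <= 2 * nu + x.
Proof.
  intros Hnu Hx. rewrite psiK_fraction by exact Hx.
  apply Rplus_le_compat_l. pose proof (psiK_ge (nu - 1) x ltac:(lra) Hx) as H.
  apply Rmult_le_reg_r with (psiK (nu - 1) x); [lra |].
  unfold Rdiv. rewrite Rmult_assoc, Rinv_l by lra. nra.
Qed.

(* [chi = psi - 2 nu] satisfies [x chi' >= chi^2 - x^2]; were it to stay above some
   [e > 0], it would have to diverge logarithmically at 0. *)
Lemma psiK_at_0 (nu : R) : 0 <= nu -> filterlim (psiK nu) (at_right 0) (locally (2 * nu)).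
Proof.
  intros Hnu.
  assert (Hinc : forall a b, 0 < a <= b -> psiK nu a <= psiK nu b).
  { intros a b Hab. eapply derive_nonneg_incr; [lra | intros x Hx; apply psiK_riccati; lra |].
    intros x Hx. pose proof (psiK_turan nu x ltac:(lra)).
    apply Rmult_le_pos; [lra | apply Rlt_le, Rinv_0_lt_compat; lra]. }
  apply filterlim_epsilon; [typeclasses eauto |]. intros e He.
  destruct (classic (exists d, 0 < d /\ psiK nu d < 2 * nu + e)) as [[d [Hd Hde]] | Hn].
  - apply at_right_intro with d; [exact Hd |]. intros x Hx.
    pose proof (Hinc x d ltac:(lra)). pose proof (psiK_gt nu x ltac:(lra)).
    apply Rabs_def1; lra.
  - exfalso.
    assert (Hall : forall d, 0 < d -> 2 * nu + e <= psiK nu d).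
    { intros d Hd. apply Rnot_lt_le. intros Hc. apply Hn. now exists d. }
    (* For [x < b] the assumption gives [psi (psi - 2 nu) - x^2 >= e^2 - e^2 / 4 >= c], so
       [psi - c ln x] is nondecreasing on [(0, b)]. *)
    set (c := e ^ 2 / 2). set (b := e / 2).
    assert (Hc : 0 < c) by (unfold c; nra). assert (Hb : 0 < b) by (unfold b; lra).
    assert (Hlog : forall a, 0 < a < b -> psiK nu a - c * ln a <= psiK nu b - c * ln b).
    { intros a Ha. apply (derive_nonneg_incr (fun x => psiK nu x - c * ln x)
        (fun x => (psiK nu x ^ 2 - 2 * nu * psiK nu x - x ^ 2 - c) / x)); [lra | |].
      - intros x Hx. pose proof (psiK_riccati nu x ltac:(lra)) as D.
        auto_derive; [split; [eexists; exact D | split; [lra | exact I]] |].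
        rewrite (is_derive_unique (fun y : R => psiK nu y) x _ D). field. lra.
      - intros x Hx. apply Rmult_le_pos; [| apply Rlt_le, Rinv_0_lt_compat; lra].
        pose proof (Hall x ltac:(lra)) as Hx'.
        assert (x < b) by lra. unfold c, b in *.
        assert (0 <= (psiK nu x - (2 * nu + e)) * (psiK nu x + e)) by (apply Rmult_le_pos; lra).
        nra. }
    (* At a point with [ln a <= - L - 1] the comparison forces [psi a <= c L + c ln a <= - c],
       against positivity. *)
    set (L := (psiK nu b - c * ln b) / c).
    set (a := Rmin (b / 2) (exp (- L - 1))).
    assert (Ha : 0 < a < b).
    { unfold a. split; [apply Rmin_pos; [lra | apply exp_pos] |].
      pose proof (Rmin_l (b / 2) (exp (- L - 1))). lra. }
    pose proof (Hlog a Ha) as H1. pose proof (psiK_pos nu a (proj1 Ha)) as H2.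
    assert (H3 : ln a <= - L - 1).
    { rewrite <- (ln_exp (- L - 1)). apply Rcomplements.ln_le; [lra | apply Rmin_r]. }
    assert (H4 : c * L = psiK nu b - c * ln b) by (unfold L; field; lra).
    nra.
Qed.

(** * The common Riccati equation *)

Definition riccati (n : R) (w : R -> R) : Prop :=
  forall x, 0 < x -> is_derive w x ((x ^ 2 + n ^ 2 - w x ^ 2) / x).

(* [D = x w'].  The sharpness condition at 0 makes [alpha = nu -+ lam], [beta = nu +- lam],
   and tangency at [x] then forces [lam = N/M]; the one at infinity makes [gamma = 1],
   [alpha = nu -+ (1/2 + lam)], and tangency forces [lam = - G_{1/2}/D].  The sign of [L_c]
   (resp. [G_c]) thus compares [lam] with [c] (resp. [c - 1/2]). *)
Definition ric_D (n : R) (w : R -> R) (x : R) : R := x ^ 2 + n ^ 2 - w x ^ 2.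
Definition ric_F (n : R) (w : R -> R) (x : R) : R := w x + 1 / 2 - ric_D n w x.
Definition ric_G (c n : R) (w : R -> R) (x : R) : R := (w x + c) * ric_D n w x - x ^ 2.
Definition ric_N (n : R) (w : R -> R) (x : R) : R := w x * ric_D n w x - (w x ^ 2 - n ^ 2).
Definition ric_M (n : R) (w : R -> R) (x : R) : R := 2 * (w x - n) - ric_D n w x.
Definition ric_L (c n : R) (w : R -> R) (x : R) : R := ric_N n w x - c * ric_M n w x.

Section Riccati.
Variables (n : R) (w : R -> R).
Hypothesis Hw : riccati n w.

Ltac solve_ode :=
  let x := fresh "x" in let Hx := fresh "Hx" in let Hd := fresh "Hd" in
  intros x Hx; assert (Hd := Hw x Hx);
  unfold ric_L, ric_N, ric_M, ric_F, ric_G, ric_D; split;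
  [ auto_derive; [repeat split; now eexists; exact Hd |];
    rewrite ?(is_derive_unique (fun y : R => w y) x _ Hd); field; try lra
  | apply (ex_derive_continuous (V := R_NormedModule)); auto_derive;
    repeat split; try lra; try (now eexists; exact Hd) ].

Lemma ode_D : linear_ode (ric_D n w) (fun x => 2 * x) (fun x => -2 * w x / x).
Proof. solve_ode. Qed.

(** [ric_F] compares [ric_D] with [w + 1/2]. It matters because the source of [ric_G (1/2)] is
    [- ric_D * ric_F / x]. *)
Lemma ode_F : linear_ode (ric_F n w) (fun x => (2 * n ^ 2 - 1 / 2) / x) (fun x => - (2 * w x - 1) / x).
Proof. solve_ode. Qed.

Lemma ode_G (c : R) : linear_ode (ric_G c n w)
  (fun x => (ric_D n w x ^ 2 + ric_D n w x * (w x + c) * (2 * c - 2)) / x)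
  (fun x => -2 * (w x + c - 1) / x).
Proof. solve_ode. Qed.

Lemma ode_N : linear_ode (ric_N n w) (fun x => ric_D n w x ^ 2 / x) (fun x => -2 * w x / x).
Proof. solve_ode. Qed.

Lemma ode_M : linear_ode (ric_M n w) (fun x => 2 * ric_N n w x / x) (fun x => 0).
Proof. solve_ode. Qed.

(** [ric_L c = (w + c) ric_D - ((w + c)^2 - (n + c)^2)], so [ric_D] can be eliminated after division
    by [w + c]. The source is the derivative on the zero set, where [ric_D = (w - n)(1 + r)] and
    [ric_M = (w - n)(1 - r)] with [r = (n + c) / (w + c)]. *)
Lemma ode_L (c : R) : (forall x, 0 < x -> w x + c <> 0) -> linear_ode (ric_L c n w)
  (fun x => (w x - n) ^ 2 * ((1 + (n + c) / (w x + c)) ^ 2 - 2 * c) / x)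
  (fun x => (1 + ric_D n w x / (w x + c) - (n + c) ^ 2 / (w x + c) ^ 2 + 2 * c - 2 * (w x + c)) / x).
Proof.
  intros Hc x Hx. specialize (Hc x Hx).
  assert (Hc2 : (w x + c) ^ 2 <> 0) by now apply pow_nonzero.
  assert (Hd := Hw x Hx).
  unfold ric_L, ric_N, ric_M, ric_D; split.
  - auto_derive; [repeat split; now eexists; exact Hd |].
    rewrite (is_derive_unique (fun y : R => w y) x _ Hd). field. split; assumption || lra.
  - apply (ex_derive_continuous (V := R_NormedModule)). auto_derive.
    repeat split; try assumption; try lra; try (now eexists; exact Hd).
Qed.

(** The second factor in the source of [ric_G (- n)], the first being [ric_D]. *)
Lemma ode_Q : linear_ode (fun x => ric_D n w x - 2 * (1 + n) * (w x - n))
  (fun x => 2 * (w x ^ 2 - n ^ 2) * (- 2 * n - 1) / x) (fun x => -2 * (w x + n) / x).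
Proof. solve_ode. Qed.

Lemma ode_U : linear_ode (fun x => x + w x + 1 / 2)
  (fun x => (n ^ 2 - 1 / 4) / x) (fun x => (2 * x + 1 - (x + w x + 1 / 2)) / x).
Proof. solve_ode. Qed.

(** Its source is twice the quantity of [ode_U]. Together they bound [ric_D] below by [- x] for K,
    so that [beta^2] comes out nonnegative. *)
Lemma ode_T : linear_ode (fun x => ric_D n w x + x)
  (fun x => 2 * (x + w x + 1 / 2)) (fun x => -2 * w x / x).
Proof. solve_ode. Qed.

End Riccati.

(** Hypotheses are tried before decomposition, so known limits of [w], [ric_D] and the like enter as
    blocks; nonvanishing of denominators is left as a goal. *)
Ltac lim := repeat first
  [ eassumption | apply filterlim_const | apply filterlim_id_at_right | apply filterlim_inv_p_infty
  | apply filterlim_Rminus | apply filterlim_Rplus | apply filterlim_Ropp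
  | apply filterlim_Rdiv | apply filterlim_Rmult | apply filterlim_Rpow ].

(** * Signs for the solution fixed at 0 (first kind) *)

Section RiccatiI.
Variables (n : R) (w : R -> R).
Hypothesis Hw : riccati n w.
Hypothesis Hn : 0 <= n.
Hypothesis Hb : forall x, 0 < x -> n < w x <= n + x ^ 2 / (2 * (n + 1)).

Lemma ricI_at_0 : filterlim w (at_right 0) (locally n).
Proof.
  apply filterlim_squeeze_le with (f := fun _ => n) (h := fun x => n + x ^ 2 / (2 * (n + 1))).
  - generalize at_right_pos. apply filter_imp. intros x Hx. pose proof (Hb x Hx). lra.
  - apply filterlim_const.
  - eapply filterlim_eq; [lim; lra |]. simpl. field. lra.
Qed.

Lemma ricI_D_at_0 : filterlim (ric_D n w) (at_right 0) (locally 0).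
Proof.
  pose proof ricI_at_0. unfold ric_D. eapply filterlim_eq; [lim |]. ring.
Qed.

Lemma damping_le_0 (c x : R) : 0 < x -> 0 <= w x + c -> -2 * (w x + c) / x <= 0.
Proof.
  intros Hx Hc. assert (0 <= 2 * (w x + c) * / x).
  { apply Rmult_le_pos; [lra | now apply Rlt_le, Rinv_0_lt_compat]. }
  unfold Rdiv. lra.
Qed.

Lemma ricI_damping (c : R) : 0 <= n + c -> at_right 0 (fun x => -2 * (w x + c) / x <= 0).
Proof.
  intros Hc. generalize at_right_pos. apply filter_imp. intros x Hx.
  apply damping_le_0; [exact Hx | pose proof (Hb x Hx); lra].
Qed.

Lemma ricI_damping0 : at_right 0 (fun x => -2 * w x / x <= 0).
Proof.
  generalize (ricI_damping 0 ltac:(lra)). apply filter_imp. intros x. now rewrite Rplus_0_r.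
Qed.

Lemma ricI_D_pos (x : R) : 0 < x -> 0 < ric_D n w x.
Proof.
  intros Hx. apply (ode_from_zero _ _ _ (ode_D n w Hw) 0 x Hx).
  - intros t Ht. lra.
  - apply ricI_damping0.
  - apply ricI_D_at_0.
Qed.

Lemma ricI_N_pos (x : R) : 0 < x -> 0 < ric_N n w x.
Proof.
  intros Hx. apply (ode_from_zero _ _ _ (ode_N n w Hw) 0 x Hx).
  - intros t Ht. apply Rdiv_lt_0_compat; [apply pow_lt, ricI_D_pos |]; lra.
  - apply ricI_damping0.
  - pose proof ricI_at_0. pose proof ricI_D_at_0. unfold ric_N.
    eapply filterlim_eq; [lim |]. ring.
Qed.

Lemma ricI_M_pos (x : R) : 0 < x -> 0 < ric_M n w x.
Proof.
  intros Hx. apply (ode_from_zero _ _ _ (ode_M n w Hw) 0 x Hx).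
  - intros t Ht. apply Rdiv_lt_0_compat; [| lra]. pose proof (ricI_N_pos t ltac:(lra)). lra.
  - apply filter_forall. intros; lra.
  - pose proof ricI_at_0. pose proof ricI_D_at_0. unfold ric_M.
    eapply filterlim_eq; [lim |]. ring.
Qed.

(** The apparent pole at 0 is harmless: with [y = w + c] and [m = n + c], both [1 - m^2 / y^2] and
    [ric_D / y] are at most [2 x^2] (here [y >= 1/2] enters), and [2 c - 2 y = - 2 w <= 0]. The
    numerator is thus at most [4 x^2]. *)
Lemma ricI_L_damping (c : R) : 1 / 2 <= c ->
  at_right 0 (fun x => (1 + ric_D n w x / (w x + c) - (n + c) ^ 2 / (w x + c) ^ 2
                        + 2 * c - 2 * (w x + c)) / x <= 4).
Proof.
  intros Hc. apply at_right_intro with 1; [lra |]. intros x Hx.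
  pose proof (Hb x ltac:(lra)).
  assert (Hwx : w x - n <= x ^ 2 / 2).
  { apply Rle_trans with (x ^ 2 / (2 * (n + 1))); [lra |].
    apply Rmult_le_compat_l; [nra |]. apply Rinv_le_contravar; lra. }
  assert (HD : ric_D n w x <= x ^ 2) by (unfold ric_D; nra).
  assert (HD0 : 0 < ric_D n w x) by (apply ricI_D_pos; lra).
  set (y := w x + c). set (m := n + c).
  assert (Hy : m < y /\ 1 / 2 <= m) by (unfold y, m; lra).
  assert (E1 : 1 - m ^ 2 / y ^ 2 <= 2 * x ^ 2).
  { replace (1 - m ^ 2 / y ^ 2) with ((y - m) * (y + m) / y ^ 2) by (field; lra).
    assert (Hy2 : 0 < y ^ 2) by (apply pow_lt; lra).
    apply Rmult_le_reg_r with (y ^ 2); [exact Hy2 |].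
    unfold Rdiv. rewrite Rmult_assoc, Rinv_l by lra.
    assert (y - m <= x ^ 2 / 2) by (unfold y, m; lra).
    assert ((y - m) * (y + m) <= x ^ 2 / 2 * (2 * y)) by (apply Rmult_le_compat; lra).
    assert (0 <= x ^ 2 * (y * (2 * y - 1))) by (apply Rmult_le_pos; nra). lra. }
  assert (E2 : ric_D n w x / y <= 2 * x ^ 2).
  { apply Rmult_le_reg_r with y; [lra |]. unfold Rdiv. rewrite Rmult_assoc, Rinv_l by lra.
    assert (0 <= x ^ 2 * (2 * y - 1)) by (apply Rmult_le_pos; nra). lra. }
  apply Rmult_le_reg_r with x; [lra |]. unfold Rdiv at 1.
  rewrite Rmult_assoc, Rinv_l by lra.
  assert (2 * c - 2 * y <= 0) by (unfold y; lra). nra.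
Qed.

Lemma ricI_L_at_0 (c : R) : filterlim (ric_L c n w) (at_right 0) (locally 0).
Proof.
  pose proof ricI_at_0. pose proof ricI_D_at_0. unfold ric_L, ric_N, ric_M.
  eapply filterlim_eq; [lim |]. ring.
Qed.

(** For [2 c = 1] the source has the sign of [(1 + r)^2 - 1], positive because [r > 0]. *)
Lemma ricI_L_half_pos (x : R) : 0 < x -> 0 < ric_L (1 / 2) n w x.
Proof.
  intros Hx.
  assert (Hc : forall t, 0 < t -> w t + 1 / 2 <> 0) by (intros t Ht; pose proof (Hb t Ht); lra).
  apply (ode_from_zero _ _ _ (ode_L n w Hw (1 / 2) Hc) 4 x Hx).
  - intros t Ht. pose proof (Hb t ltac:(lra)).
    apply Rdiv_lt_0_compat; [| lra]. apply Rmult_lt_0_compat; [nra |].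
    assert (0 < (n + 1 / 2) / (w t + 1 / 2)) by (apply Rdiv_lt_0_compat; lra). nra.
  - apply ricI_L_damping. lra.
  - apply ricI_L_at_0.
Qed.

(** For [2 c = 4] the source has the sign of [(1 + r)^2 - 4], negative because [r < 1], that is
    [w > n]. *)
Lemma ricI_L_2_neg (x : R) : 0 < x -> ric_L 2 n w x < 0.
Proof.
  intros Hx.
  assert (Hc : forall t, 0 < t -> w t + 2 <> 0) by (intros t Ht; pose proof (Hb t Ht); lra).
  assert (0 < - ric_L 2 n w x); [| lra].
  apply (ode_from_zero _ _ _ (linear_ode_opp _ _ _ (ode_L n w Hw 2 Hc)) 4 x Hx).
  - intros t Ht. pose proof (Hb t ltac:(lra)).
    assert (H0 : 0 < (n + 2) / (w t + 2)) by (apply Rdiv_lt_0_compat; lra).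
    assert (H1 : (n + 2) / (w t + 2) < 1).
    { apply Rmult_lt_reg_r with (w t + 2); [lra |]. unfold Rdiv.
      rewrite Rmult_assoc, Rinv_l by lra. lra. }
    set (r := (n + 2) / (w t + 2)) in *.
    replace (- ((w t - n) ^ 2 * ((1 + r) ^ 2 - 2 * 2) / t))
      with ((w t - n) ^ 2 * (4 - (1 + r) ^ 2) / t) by (field; lra).
    apply Rdiv_lt_0_compat; [| lra]. apply Rmult_lt_0_compat; nra.
  - apply ricI_L_damping. lra.
  - eapply filterlim_eq; [apply filterlim_Ropp, ricI_L_at_0 |]. ring.
Qed.

Lemma ricI_lambda0 (x : R) : 0 < x -> 1 / 2 < ric_N n w x / ric_M n w x < 2.
Proof.
  intros Hx. pose proof (ricI_M_pos x Hx) as HM.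
  pose proof (ricI_L_half_pos x Hx) as H1. pose proof (ricI_L_2_neg x Hx) as H2.
  unfold ric_L in *. split; apply Rmult_lt_reg_r with (ric_M n w x); try exact HM;
    unfold Rdiv; rewrite ?Rmult_assoc, Rinv_l by lra; lra.
Qed.

(** [ric_F] starts at [n + 1/2 > 0] instead of 0, so positivity is propagated forward from a small
    point; the weak form serves because the source vanishes when [n = 1/2]. *)
Lemma ricI_F_pos (x : R) : 1 / 2 <= n -> 0 < x -> 0 < ric_F n w x.
Proof.
  intros Hn2 Hx.
  assert (H0 : filterlim (ric_F n w) (at_right 0) (locally (n + 1 / 2))).
  { pose proof ricI_at_0. pose proof ricI_D_at_0. unfold ric_F.
    eapply filterlim_eq; [lim |]. ring. }
  destruct (at_right_elim _ (filterlim_pos_eventually _ _ _ 0 H0 ltac:(lra))) as [d [Hd H1]].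
  set (a := Rmin (d / 2) (x / 2)).
  assert (Ha : 0 < a < d /\ a < x) by (unfold a, Rmin; destruct (Rle_dec (d / 2) (x / 2)); lra).
  apply (ode_forward_weak _ _ _ (ode_F n w Hw) a); [lra | | apply H1; lra].
  intros t Ht. apply Rmult_le_pos; [nra | apply Rlt_le, Rinv_0_lt_compat; lra].
Qed.

Lemma ricI_G_half_neg (x : R) : 1 / 2 <= n -> 0 < x -> ric_G (1 / 2) n w x < 0.
Proof.
  intros Hn2 Hx. assert (0 < - ric_G (1 / 2) n w x); [| lra].
  apply (ode_from_zero _ _ _ (linear_ode_opp _ _ _ (ode_G n w Hw (1 / 2))) 0 x Hx).
  - intros t Ht. pose proof (ricI_D_pos t ltac:(lra)) as H1.
    pose proof (ricI_F_pos t Hn2 ltac:(lra)) as H2. unfold ric_F in H2.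
    set (d := ric_D n w t) in *.
    replace (- ((d ^ 2 + d * (w t + 1 / 2) * (2 * (1 / 2) - 2)) / t))
      with (d * (w t + 1 / 2 - d) / t) by (field; lra).
    apply Rdiv_lt_0_compat; [nra | lra].
  - generalize (ricI_damping (1 / 2 - 1) ltac:(lra)). apply filter_imp. intros t Ht.
    replace (w t + 1 / 2 - 1) with (w t + (1 / 2 - 1)) by ring. exact Ht.
  - pose proof ricI_at_0. pose proof ricI_D_at_0. unfold ric_G.
    eapply filterlim_eq; [lim |]. ring.
Qed.

Lemma ricI_G_1_pos (x : R) : 0 < x -> 0 < ric_G 1 n w x.
Proof.
  intros Hx. apply (ode_from_zero _ _ _ (ode_G n w Hw 1) 0 x Hx).
  - intros t Ht. pose proof (ricI_D_pos t ltac:(lra)) as H1. set (d := ric_D n w t) in *.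
    apply Rdiv_lt_0_compat; [nra | lra].
  - generalize ricI_damping0. apply filter_imp. intros t Ht.
    replace (w t + 1 - 1) with (w t) by ring. exact Ht.
  - pose proof ricI_at_0. pose proof ricI_D_at_0. unfold ric_G.
    eapply filterlim_eq; [lim |]. ring.
Qed.

(** [ric_D^2 < (w + 1/2) ric_D < x^2], by the signs of [ric_F] and [ric_G (1/2)]. *)
Lemma ricI_D_lt_id (x : R) : 1 / 2 <= n -> 0 < x -> ric_D n w x < x.
Proof.
  intros Hn2 Hx. pose proof (ricI_D_pos x Hx). pose proof (ricI_F_pos x Hn2 Hx) as HF.
  pose proof (ricI_G_half_neg x Hn2 Hx) as HG. unfold ric_F, ric_G in *. nra.
Qed.

(** [ric_D > 0] gives [w < x + n]; [ric_F > 0] gives [(w + 1/2)^2 > x^2 + n^2 - 1/4 >= x^2]. *)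
Lemma ricI_asymptotic : 1 / 2 <= n ->
  filterlim (fun x => w x / x) (Rbar_locally p_infty) (locally 1).
Proof.
  intros Hn2.
  apply filterlim_squeeze_le with (f := fun x => 1 - / x * (1 / 2)) (h := fun x => 1 + / x * n).
  - generalize (p_infty_gt 0). apply filter_imp. intros x Hx.
    pose proof (ricI_D_pos x Hx) as HD. pose proof (ricI_F_pos x Hn2 Hx) as HF.
    unfold ric_F, ric_D in *. pose proof (Hb x Hx).
    split; apply Rmult_le_reg_r with x; try exact Hx; unfold Rdiv;
      rewrite ?Rmult_minus_distr_r, ?Rmult_plus_distr_r;
      [replace (/ x * (1 * / 2) * x) with (1 / 2) by (field; lra)
      |replace (/ x * n * x) with n by (field; lra)];
      rewrite Rmult_assoc, Rinv_l by lra; nra.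
  - eapply filterlim_eq; [lim |]. ring.
  - eapply filterlim_eq; [lim |]. ring.
Qed.

End RiccatiI.

Lemma le_pow4 (x : R) : 1 <= x -> x <= x ^ 4 /\ x ^ 2 <= x ^ 4.
Proof.
  intros Hx. split; [rewrite <- (pow_1 x) at 1 |]; apply Rle_pow; lra || lia.
Qed.

(** * Signs for the solution fixed at infinity (second kind) *)

Section RiccatiK.
Variables (n : R) (w : R -> R).
Hypothesis Hw : riccati n w.
Hypothesis Hn : n < - (1 / 2).
Hypothesis Hb : forall x, 0 < x -> n - x <= w x < n.
Hypothesis Hb' : forall x, 0 < x -> w x <= - n - x.

Lemma ricK_at_0 : filterlim w (at_right 0) (locally n).
Proof.
  apply filterlim_squeeze_le with (f := fun x => n - x) (h := fun _ => n).
  - generalize at_right_pos. apply filter_imp. intros x Hx. pose proof (Hb x Hx). lra.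
  - eapply filterlim_eq; [lim |]. ring.
  - apply filterlim_const.
Qed.

Lemma ricK_abs (x : R) : 1 <= x -> Rabs (w x) <= (1 - n) * x.
Proof.
  intros Hx. pose proof (Hb x ltac:(lra)). rewrite Rabs_left by lra. nra.
Qed.

Lemma ricK_D_abs (x : R) : 1 <= x -> Rabs (ric_D n w x) <= 2 * (1 - n) ^ 2 * x ^ 2.
Proof.
  intros Hx. pose proof (ricK_abs x Hx) as H. pose proof (Hb x ltac:(lra)).
  rewrite Rabs_left in H by lra. unfold ric_D. apply Rabs_le.
  assert (w x ^ 2 <= (1 - n) ^ 2 * x ^ 2) by nra.
  assert (1 <= x ^ 2) by nra.
  assert (1 + n ^ 2 <= (1 - n) ^ 2) by nra.
  split; nra.
Qed.

Lemma ricK_damping (a x : R) : 0 <= a -> - 2 * n + 2 * a + 1 < x -> 1 / 2 <= -2 * (w x + a) / x.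
Proof.
  intros Ha Hx. pose proof (Hb' x ltac:(lra)).
  apply Rmult_le_reg_r with x; [lra |]. unfold Rdiv at 2.
  rewrite Rmult_assoc, Rinv_l by lra. nra.
Qed.

Lemma pow_le_pow4 (C x : R) (k : nat) : (k <= 4)%nat -> 0 <= C -> 1 <= x -> C * x ^ k <= C * x ^ 4.
Proof. intros Hk HC Hx. apply Rmult_le_compat_l; [exact HC | now apply Rle_pow]. Qed.

(** Packages the hypothesis of [ode_from_infinity]: each [q] below dominates [-2 (w + a) / x] for
    some offset [a], and [w <= - n - x] makes the latter at least 1/2 for large [x]. *)
Lemma ricK_end (a C : R) (f q : R -> R) :
  0 <= a -> (forall x, - 2 * n + 2 * a + 1 < x -> -2 * (w x + a) / x <= q x) ->
  (forall x, 1 <= x -> Rabs (f x) <= C * x ^ 4) ->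
  Rbar_locally p_infty (fun t => 1 / 2 <= q t /\ Rabs (f t) <= C * t ^ 4).
Proof.
  intros Ha Hq Hf. exists (- 2 * n + 2 * a + 1). intros x Hx. split; [| apply Hf; lra].
  apply Rle_trans with (1 := ricK_damping a x Ha Hx). now apply Hq.
Qed.

Lemma ricK_D_neg (x : R) : 0 < x -> ric_D n w x < 0.
Proof.
  intros Hx. apply (ode_from_infinity _ _ _ (ode_D n w Hw) (2 * (1 - n) ^ 2) x Hx).
  - intros t Ht. lra.
  - apply (ricK_end 0); [lra | intros t _; rewrite Rplus_0_r; lra |].
    intros t Ht. apply Rle_trans with (1 := ricK_D_abs t Ht). apply pow_le_pow4; [lia | nra | lra].
Qed.

Lemma ricK_prod_abs (c x : R) : 1 <= x ->
  Rabs ((w x + c) * ric_D n w x) <= (1 - n + Rabs c) * (2 * (1 - n) ^ 2) * x ^ 4.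
Proof.
  intros Hx. rewrite Rabs_mult. pose proof (Rabs_pos c) as Pc.
  apply Rle_trans with ((1 - n + Rabs c) * x * (2 * (1 - n) ^ 2 * x ^ 2)).
  - apply Rmult_le_compat; try apply Rabs_pos; [| now apply ricK_D_abs].
    apply Rle_trans with (1 := Rabs_triang _ _). pose proof (ricK_abs x Hx). nra.
  - replace ((1 - n + Rabs c) * x * (2 * (1 - n) ^ 2 * x ^ 2))
      with ((1 - n + Rabs c) * (2 * (1 - n) ^ 2) * x ^ 3) by ring.
    apply pow_le_pow4; [lia | apply Rmult_le_pos; nra | exact Hx].
Qed.

Lemma ricK_G_abs (c x : R) : 1 <= x ->
  Rabs (ric_G c n w x) <= ((1 - n + Rabs c) * (2 * (1 - n) ^ 2) + 1) * x ^ 4.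
Proof.
  intros Hx. unfold ric_G. apply Rle_trans with (1 := Rabs_triang _ _).
  pose proof (ricK_prod_abs c x Hx). rewrite Rabs_Ropp, (Rabs_right (x ^ 2)) by nra.
  destruct (le_pow4 x Hx). lra.
Qed.

Lemma ricK_N_abs (x : R) : 1 <= x ->
  Rabs (ric_N n w x) <= ((1 - n + 0) * (2 * (1 - n) ^ 2) + (1 - n) ^ 2) * x ^ 4.
Proof.
  intros Hx. unfold ric_N.
  pose proof (ricK_prod_abs 0 x Hx) as H. rewrite Rplus_0_r, Rabs_R0 in H.
  apply Rle_trans with (1 := Rabs_triang _ _). rewrite Rabs_Ropp.
  destruct (le_pow4 x Hx).
  pose proof (ricK_abs x Hx) as Ha. pose proof (Hb x ltac:(lra)).
  rewrite (Rabs_left (w x)) in Ha by lra.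
  assert (w x ^ 2 <= (1 - n) ^ 2 * x ^ 2) by nra.
  rewrite (Rabs_right (w x ^ 2 - n ^ 2)) by nra.
  assert ((1 - n) ^ 2 * x ^ 2 <= (1 - n) ^ 2 * x ^ 4) by (apply Rmult_le_compat_l; nra).
  nra.
Qed.

Lemma ricK_N_neg (x : R) : 0 < x -> ric_N n w x < 0.
Proof.
  intros Hx. eapply (ode_from_infinity _ _ _ (ode_N n w Hw) _ x Hx).
  - intros t Ht. pose proof (ricK_D_neg t ltac:(lra)). apply Rdiv_lt_0_compat; [nra | lra].
  - apply (ricK_end 0); [lra | intros t _; rewrite Rplus_0_r; lra |]. exact ricK_N_abs.
Qed.

(** The equation of [ric_M] has [q = 0], so infinity provides no antidamping; the integration starts
    at 0, where [w] tends to [n] for K as well. *)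
Lemma ricK_M_neg (x : R) : 0 < x -> ric_M n w x < 0.
Proof.
  intros Hx. assert (0 < - ric_M n w x); [| lra].
  apply (ode_from_zero _ _ _ (linear_ode_opp _ _ _ (ode_M n w Hw)) 0 x Hx).
  - intros t Ht. pose proof (ricK_N_neg t ltac:(lra)).
    replace (- (2 * ric_N n w t / t)) with (2 * - ric_N n w t / t) by (field; lra).
    apply Rdiv_lt_0_compat; lra.
  - apply filter_forall. intros; lra.
  - pose proof ricK_at_0. unfold ric_M, ric_D. eapply filterlim_eq; [lim |]. ring.
Qed.

Lemma ricK_F_abs (x : R) : 1 <= x ->
  Rabs (ric_F n w x) <= (2 * (1 - n) ^ 2 + (2 - n)) * x ^ 4.
Proof.
  intros Hx. unfold ric_F. apply Rle_trans with (1 := Rabs_triang _ _). rewrite Rabs_Ropp.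
  pose proof (ricK_D_abs x Hx) as H1. pose proof (ricK_abs x Hx) as H2.
  destruct (le_pow4 x Hx).
  apply Rle_trans with ((2 - n) * x + 2 * (1 - n) ^ 2 * x ^ 2).
  - apply Rplus_le_compat; [| exact H1]. apply Rle_trans with (1 := Rabs_triang _ _).
    rewrite (Rabs_right (1 / 2)) by lra. lra.
  - assert ((2 - n) * x <= (2 - n) * x ^ 4) by (apply Rmult_le_compat_l; lra).
    assert ((1 - n) ^ 2 * x ^ 2 <= (1 - n) ^ 2 * x ^ 4) by (apply Rmult_le_compat_l; nra). lra.
Qed.

Lemma ricK_F_neg (x : R) : 0 < x -> ric_F n w x < 0.
Proof.
  intros Hx. eapply (ode_from_infinity _ _ _ (ode_F n w Hw) _ x Hx).
  - intros t Ht. apply Rdiv_lt_0_compat; [nra | lra].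
  - apply (ricK_end 0); [lra | | exact ricK_F_abs].
    intros t Ht. apply Rmult_le_compat_r; [apply Rlt_le, Rinv_0_lt_compat |]; lra.
Qed.

Lemma ricK_G_half_pos (x : R) : 0 < x -> 0 < ric_G (1 / 2) n w x.
Proof.
  intros Hx. assert (- ric_G (1 / 2) n w x < 0); [| lra].
  eapply (ode_from_infinity _ _ _ (linear_ode_opp _ _ _ (ode_G n w Hw (1 / 2))) _ x Hx).
  - intros t Ht. pose proof (ricK_D_neg t ltac:(lra)) as H1.
    pose proof (ricK_F_neg t ltac:(lra)) as H2. unfold ric_F in H2. set (d := ric_D n w t) in *.
    replace (- ((d ^ 2 + d * (w t + 1 / 2) * (2 * (1 / 2) - 2)) / t))
      with (- d * - (w t + 1 / 2 - d) / t) by (field; lra).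
    apply Rdiv_lt_0_compat; [nra | lra].
  - apply (ricK_end 0); [lra | |].
    + intros t Ht. apply Rmult_le_compat_r; [apply Rlt_le, Rinv_0_lt_compat |]; lra.
    + intros t Ht. rewrite Rabs_Ropp. now apply ricK_G_abs.
Qed.

Lemma ricK_G_1_neg (x : R) : 0 < x -> ric_G 1 n w x < 0.
Proof.
  intros Hx. eapply (ode_from_infinity _ _ _ (ode_G n w Hw 1) _ x Hx).
  - intros t Ht. pose proof (ricK_D_neg t ltac:(lra)) as H1. set (d := ric_D n w t) in *.
    apply Rdiv_lt_0_compat; [nra | lra].
  - apply (ricK_end 0); [lra | intros t Ht; right; f_equal; ring |]. exact (ricK_G_abs 1).
Qed.

Lemma ricK_Q_neg (x : R) : 0 < x -> ric_D n w x - 2 * (1 + n) * (w x - n) < 0.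
Proof.
  intros Hx. eapply (ode_from_infinity _ _ _ (ode_Q n w Hw)
    (2 * (1 - n) ^ 2 + 2 * (Rabs (1 + n)) * (1 - n)) x Hx).
  - intros t Ht. pose proof (Hb t ltac:(lra)). apply Rdiv_lt_0_compat; [| lra].
    apply Rmult_lt_0_compat; nra.
  - apply (ricK_end 0); [lra | |].
    + intros t Ht. apply Rmult_le_compat_r; [apply Rlt_le, Rinv_0_lt_compat |]; lra.
    + intros t Ht. apply Rle_trans with (1 := Rabs_triang _ _). rewrite Rabs_Ropp.
      pose proof (ricK_D_abs t Ht) as H1. pose proof (ricK_abs t Ht) as H2.
      rewrite !Rabs_mult, (Rabs_right 2) by lra. pose proof (Rabs_pos (1 + n)) as H3.
      pose proof (Hb t ltac:(lra)). rewrite Rabs_left in H2 by lra.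
      rewrite (Rabs_left (w t - n)) by lra.
      destruct (le_pow4 t Ht).
      destruct (le_pow4 t Ht).
      assert (2 * Rabs (1 + n) * - (w t - n) <= 2 * Rabs (1 + n) * ((1 - n) * t))
        by (apply Rmult_le_compat_l; lra).
      assert (2 * Rabs (1 + n) * ((1 - n) * t) <= 2 * Rabs (1 + n) * ((1 - n) * t ^ 4)).
      { apply Rmult_le_compat_l; [lra |]. apply Rmult_le_compat_l; lra. }
      assert ((1 - n) ^ 2 * t ^ 2 <= (1 - n) ^ 2 * t ^ 4) by (apply Rmult_le_compat_l; nra). lra.
Qed.

(** This choice of [c] yields the bound [lam < nu - 1/2], the second entry of the minimum; [ric_G 1]
    yields the first. *)
Lemma ricK_G_opp_neg (x : R) : 0 < x -> ric_G (- n) n w x < 0.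
Proof.
  intros Hx. eapply (ode_from_infinity _ _ _ (ode_G n w Hw (- n)) _ x Hx).
  - intros t Ht. pose proof (ricK_D_neg t ltac:(lra)) as H1. pose proof (ricK_Q_neg t ltac:(lra)) as H2.
    pose proof (Hb t ltac:(lra)). set (d := ric_D n w t) in *.
    replace (d ^ 2 + d * (w t + - n) * (2 * - n - 2)) with (- d * - (d - 2 * (1 + n) * (w t - n))) by ring.
    apply Rdiv_lt_0_compat; [nra | lra].
  - apply (ricK_end (- n)); [lra | |].
    + intros t Ht. apply Rmult_le_compat_r; [apply Rlt_le, Rinv_0_lt_compat |]; lra.
    + exact (ricK_G_abs (- n)).
Qed.

Lemma ricK_U_neg (x : R) : 0 < x -> x + w x + 1 / 2 < 0.
Proof.
  intros Hx. eapply (ode_from_infinity _ _ _ (ode_U n w Hw) (2 - n + 1) x Hx).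
  - intros t Ht. apply Rdiv_lt_0_compat; [nra | lra].
  (* The offset [- n] is needed: [q x = x + 1/2 - w] dominates [-2 (w - n)] because [w >= n - x]. *)
  - apply (ricK_end (- n)); [lra | |].
    + intros t Ht. pose proof (Hb t ltac:(lra)).
      apply Rmult_le_compat_r; [apply Rlt_le, Rinv_0_lt_compat |]; lra.
    + intros t Ht. pose proof (ricK_abs t Ht) as H2. apply Rabs_le_between in H2.
      destruct (le_pow4 t Ht).
      assert ((2 - n + 1) * t <= (2 - n + 1) * t ^ 4) by (apply Rmult_le_compat_l; lra).
      apply Rabs_le. split; nra.
Qed.

Lemma ricK_D_gt_opp (x : R) : 0 < x -> - x < ric_D n w x.
Proof.
  intros Hx. assert (- (ric_D n w x + x) < 0); [| lra].
  eapply (ode_from_infinity _ _ _ (linear_ode_opp _ _ _ (ode_T n w Hw)) (2 * (1 - n) ^ 2 + 1) x Hx).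
  - intros t Ht. pose proof (ricK_U_neg t ltac:(lra)). lra.
  - apply (ricK_end 0); [lra | intros t _; rewrite Rplus_0_r; lra |].
    intros t Ht. rewrite Rabs_Ropp. apply Rle_trans with (1 := Rabs_triang _ _).
    pose proof (ricK_D_abs t Ht) as H1. rewrite (Rabs_right t) by lra.
    destruct (le_pow4 t Ht).
    destruct (le_pow4 t Ht).
    assert ((1 - n) ^ 2 * t ^ 2 <= (1 - n) ^ 2 * t ^ 4) by (apply Rmult_le_compat_l; nra). lra.
Qed.

Lemma ricK_lambda_infty (x : R) : 0 < x ->
  0 < - ric_G (1 / 2) n w x / ric_D n w x < Rmin (1 / 2) (- n - 1 / 2).
Proof.
  intros Hx. pose proof (ricK_D_neg x Hx) as HD. pose proof (ricK_G_half_pos x Hx) as H1.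
  pose proof (ricK_G_1_neg x Hx) as H2. pose proof (ricK_G_opp_neg x Hx) as H3.
  set (g := ric_G (1 / 2) n w x) in *. set (d := ric_D n w x) in *.
  replace (- g / d) with (g / - d) by (field; lra).
  assert (E1 : ric_G 1 n w x = g + d / 2) by (unfold g, d, ric_G; field).
  assert (E2 : ric_G (- n) n w x = g + (- n - 1 / 2) * d) by (unfold g, d, ric_G; field).
  split; [apply Rdiv_lt_0_compat; lra |].
  apply Rmin_glb_lt; apply Rmult_lt_reg_r with (- d); try lra; unfold Rdiv;
    rewrite Rmult_assoc, Rinv_l by lra; lra.
Qed.

Section LowOrder.
Hypothesis Hn2 : n <= - 2.

(** As [n + c <= 0], one has [w + c < n + c <= 0]: [ric_D / (w + c)] is a quotient of two negative
    numbers and the squared ratio is at most 1, so only [-2 (w + c)] has to be kept. *)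
Lemma ricK_L_end (c : R) : 0 < c <= 2 -> exists C,
  Rbar_locally p_infty (fun x => 1 / 2 <= (1 + ric_D n w x / (w x + c) - (n + c) ^ 2 / (w x + c) ^ 2
                        + 2 * c - 2 * (w x + c)) / x /\ Rabs (ric_L c n w x) <= C * x ^ 4).
Proof.
  intros Hc. eexists. apply (ricK_end c); [lra | |].
  - intros x Hx. pose proof (Hb x ltac:(lra)). pose proof (ricK_D_neg x ltac:(lra)) as HD.
    set (y := w x + c). set (m := n + c).
    assert (Hy : y < m /\ m <= 0) by (unfold y, m; lra).
    assert (0 < ric_D n w x / y).
    { replace (ric_D n w x / y) with (- ric_D n w x / - y) by (field; lra).
      apply Rdiv_lt_0_compat; lra. }
    assert (m ^ 2 / y ^ 2 <= 1).
    { apply Rmult_le_reg_r with (y ^ 2); [nra |]. unfold Rdiv.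
      rewrite Rmult_assoc, Rinv_l by (apply pow_nonzero; lra). nra. }
    apply Rmult_le_compat_r; [apply Rlt_le, Rinv_0_lt_compat |]; lra.
  - intros x Hx. unfold ric_L, ric_M. apply Rle_trans with (1 := Rabs_triang _ _).
    instantiate (1 := (1 - n + 0) * (2 * (1 - n) ^ 2) + (1 - n) ^ 2
      + c * (2 * (1 - n) + 2 * (1 - n) ^ 2)).
    pose proof (ricK_N_abs x Hx) as H1. rewrite Rabs_Ropp, Rabs_mult, (Rabs_right c) by lra.
    rewrite Rmult_plus_distr_r. apply Rplus_le_compat; [exact H1 |].
    rewrite Rmult_assoc. apply Rmult_le_compat_l; [lra |].
    apply Rle_trans with (1 := Rabs_triang _ _). rewrite Rabs_Ropp.
    pose proof (ricK_D_abs x Hx) as H2. pose proof (ricK_abs x Hx) as H3.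
    pose proof (Hb x ltac:(lra)). rewrite Rabs_left in H3 by lra.
    rewrite (Rabs_left (2 * (w x - n))) by lra.
    destruct (le_pow4 x Hx).
    destruct (le_pow4 x Hx).
    assert ((1 - n) ^ 2 * x ^ 2 <= (1 - n) ^ 2 * x ^ 4) by (apply Rmult_le_compat_l; nra).
    assert ((1 - n) * x <= (1 - n) * x ^ 4) by (apply Rmult_le_compat_l; lra). lra.
Qed.

Lemma ricK_L_half_neg (x : R) : 0 < x -> ric_L (1 / 2) n w x < 0.
Proof.
  intros Hx.
  assert (Hc : forall t, 0 < t -> w t + 1 / 2 <> 0) by (intros t Ht; pose proof (Hb t Ht); lra).
  destruct (ricK_L_end (1 / 2)) as [C HC]; [lra |].
  apply (ode_from_infinity _ _ _ (ode_L n w Hw (1 / 2) Hc) C x Hx); [| exact HC].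
  intros t Ht. pose proof (Hb t ltac:(lra)).
  apply Rdiv_lt_0_compat; [| lra]. apply Rmult_lt_0_compat; [nra |].
  assert (0 < (n + 1 / 2) / (w t + 1 / 2)).
  { replace ((n + 1 / 2) / (w t + 1 / 2)) with (- (n + 1 / 2) / - (w t + 1 / 2)) by (field; lra).
    apply Rdiv_lt_0_compat; lra. }
  nra.
Qed.

Lemma ricK_L_2_pos (x : R) : 0 < x -> 0 < ric_L 2 n w x.
Proof.
  intros Hx.
  assert (Hc : forall t, 0 < t -> w t + 2 <> 0) by (intros t Ht; pose proof (Hb t Ht); lra).
  destruct (ricK_L_end 2) as [C HC]; [lra |].
  assert (- ric_L 2 n w x < 0); [| lra].
  apply (ode_from_infinity _ _ _ (linear_ode_opp _ _ _ (ode_L n w Hw 2 Hc)) C x Hx).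
  - intros t Ht. pose proof (Hb t ltac:(lra)).
    assert (H0 : 0 <= (n + 2) / (w t + 2)).
    { replace ((n + 2) / (w t + 2)) with (- (n + 2) / - (w t + 2)) by (field; lra).
      apply Rmult_le_pos; [lra | apply Rlt_le, Rinv_0_lt_compat; lra]. }
    assert (H1 : (n + 2) / (w t + 2) < 1).
    { replace ((n + 2) / (w t + 2)) with (- (n + 2) / - (w t + 2)) by (field; lra).
      apply Rmult_lt_reg_r with (- (w t + 2)); [lra |]. unfold Rdiv.
      rewrite Rmult_assoc, Rinv_l by lra. lra. }
    set (r := (n + 2) / (w t + 2)) in *.
    replace (- ((w t - n) ^ 2 * ((1 + r) ^ 2 - 2 * 2) / t))
      with ((w t - n) ^ 2 * (4 - (1 + r) ^ 2) / t) by (field; lra).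
    apply Rdiv_lt_0_compat; [| lra]. apply Rmult_lt_0_compat; nra.
  - revert HC. apply filter_imp. intros t. now rewrite Rabs_Ropp.
Qed.

Lemma ricK_lambda0 (x : R) : 0 < x -> 1 / 2 < ric_N n w x / ric_M n w x < 2.
Proof.
  intros Hx. pose proof (ricK_M_neg x Hx) as HM.
  pose proof (ricK_L_half_neg x Hx) as H1. pose proof (ricK_L_2_pos x Hx) as H2.
  unfold ric_L in *.
  replace (ric_N n w x / ric_M n w x) with (- ric_N n w x / - ric_M n w x) by (field; lra).
  split; apply Rmult_lt_reg_r with (- ric_M n w x); try lra;
    unfold Rdiv; rewrite ?Rmult_assoc, Rinv_l by lra; lra.
Qed.

End LowOrder.

Lemma ricK_asymptotic : filterlim (fun x => w x / x) (Rbar_locally p_infty) (locally (-1)).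
Proof.
  apply filterlim_squeeze_le with (f := fun x => -1 + / x * n) (h := fun x => -1 - / x * n).
  - generalize (p_infty_gt 0). apply filter_imp. intros x Hx.
    pose proof (Hb x Hx). pose proof (Hb' x Hx).
    split; apply Rmult_le_reg_r with x; try exact Hx; unfold Rdiv;
      rewrite ?Rmult_minus_distr_r, ?Rmult_plus_distr_r;
      replace (/ x * n * x) with n by (field; lra);
      rewrite Rmult_assoc, Rinv_l by lra; lra.
  - eapply filterlim_eq; [lim |]. ring.
  - eapply filterlim_eq; [lim |]. ring.
Qed.

End RiccatiK.

(** * Comparison with the tangent bound *)

(** After [x^2 = y^2 - b2] the cubic terms cancel and the leading coefficient is [2 lam]. Tangency
    makes [ys] a root, and the constant term [b2] fixes the other one. *)
Lemma touch_identity_infty (x xs n lam b2 y ys : R) :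
  ys <> 0 -> x ^ 2 = y ^ 2 - b2 -> xs ^ 2 = ys ^ 2 - b2 ->
  (xs ^ 2 + n ^ 2 - (ys - (lam + 1 / 2)) ^ 2) * ys = xs ^ 2 ->
  y * (x ^ 2 + n ^ 2 - (y - (lam + 1 / 2)) ^ 2) - x ^ 2
  = (y - ys) * (2 * lam * y - b2 / ys).
Proof.
  intros H0 Hx Hxs H.
  assert (E : n ^ 2 = xs ^ 2 / ys - xs ^ 2 + (ys - (lam + 1 / 2)) ^ 2).
  { replace (xs ^ 2 / ys) with (xs ^ 2 + n ^ 2 - (ys - (lam + 1 / 2)) ^ 2);
      [ring |].
    apply Rmult_eq_reg_r with ys; [| exact H0]. rewrite H. field. exact H0. }
  rewrite E, Hx, Hxs. field. exact H0.
Qed.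

(** At [x = 0] one has [y = n + lam], hence [y - lam = n], which makes [n + lam] a root of the
    cubic; tangency adds the root [ys]. The second relation records the coefficient of the quadratic
    factor and settles the degenerate case [g2 = 1] for K. *)
Lemma touch_identity_0 (x xs n lam g2 y ys : R) :
  g2 <> 0 -> ys <> 0 -> ys <> n + lam ->
  g2 * x ^ 2 = y ^ 2 - (n + lam) ^ 2 -> g2 * xs ^ 2 = ys ^ 2 - (n + lam) ^ 2 ->
  (xs ^ 2 + n ^ 2 - (ys - lam) ^ 2) * ys = g2 * xs ^ 2 ->
  y * (x ^ 2 + n ^ 2 - (y - lam) ^ 2) - g2 * x ^ 2
  = (y - (n + lam)) * ((y - ys) * ((/ g2 - 1) * y + (n + lam) / ys)) /\
  2 * lam = 1 + (n + lam) / ys - (/ g2 - 1) * (ys + (n + lam)).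
Proof.
  intros Hg H0 Hm Hx Hxs H. set (m := n + lam) in *. set (a := / g2 - 1).
  assert (Hn : n = m - lam) by (unfold m; ring).
  assert (F : forall x y, g2 * x ^ 2 = y ^ 2 - m ^ 2 ->
     y * (x ^ 2 + n ^ 2 - (y - lam) ^ 2) - g2 * x ^ 2
     = (y - m) * (a * y ^ 2 + (a * m + 2 * lam - 1) * y - m)).
  { intros u v Huv. assert (Eu : u ^ 2 = (v ^ 2 - m ^ 2) / g2) by (rewrite <- Huv; field; exact Hg).
    rewrite Huv, Eu, Hn. unfold a. field. exact Hg. }
  assert (Q : a * ys ^ 2 + (a * m + 2 * lam - 1) * ys - m = 0).
  { apply Rmult_eq_reg_l with (ys - m); [| lra]. rewrite <- (F xs ys Hxs). lra. }
  assert (E : 2 * lam = 1 + m / ys - a * (ys + m)).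
  { replace m with (a * ys ^ 2 + (a * m + 2 * lam - 1) * ys) at 1 by lra. field. exact H0. }
  split; [| exact E]. rewrite (F x y Hx).
  replace (a * m + 2 * lam - 1) with (m / ys - a * ys) by lra. field. exact H0.
Qed.

(* The bound is [x B = alpha + s] with [s = sqrt (b2 + g2 x^2)]; with [sg = 1] for I and
   [sg = -1] for K it corresponds to [y - mu] in the variable [w], where [y = sg * s]. *)
Definition ymod (sg b2 g2 x : R) : R := sg * sqrt (b2 + g2 * x ^ 2).

Section Touch.
Variables (n : R) (w : R -> R) (sg b2 g2 mu xs : R).
Hypothesis Hw : riccati n w.
Hypothesis Hsg : sg ^ 2 = 1.
Hypothesis Hb2 : 0 <= b2.
Hypothesis Hg2 : 0 < g2.
Let y := ymod sg b2 g2.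
Let d := fun x => w x - (y x - mu).
Let g := fun x => (x ^ 2 + n ^ 2 - (y x - mu) ^ 2 - g2 * x ^ 2 / y x) / x.
Let q := fun x => - (w x + (y x - mu)) / x.

Lemma radicand_pos (x : R) : 0 < x -> 0 < b2 + g2 * x ^ 2.
Proof. intros Hx. assert (0 < g2 * x ^ 2) by (apply Rmult_lt_0_compat; [exact Hg2 | now apply pow_lt]). lra. Qed.

Lemma ymod_sqr (x : R) : 0 < x -> y x ^ 2 = b2 + g2 * x ^ 2.
Proof.
  intros Hx. unfold y, ymod. rewrite Rpow_mult_distr, Hsg, pow2_sqrt; [ring |].
  now apply Rlt_le, radicand_pos.
Qed.

Lemma ymod_neq_0 (x : R) : 0 < x -> y x <> 0.
Proof.
  intros Hx E. pose proof (ymod_sqr x Hx) as H. rewrite E in H.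
  pose proof (radicand_pos x Hx). lra.
Qed.

Lemma is_derive_ymod (x : R) : 0 < x -> is_derive y x (g2 * x / y x).
Proof.
  intros Hx. pose proof (radicand_pos x Hx) as HR. pose proof (ymod_neq_0 x Hx) as H0.
  assert (H1 : 0 < sqrt (b2 + g2 * x ^ 2)) by now apply sqrt_lt_R0.
  assert (Hs : sg <> 0) by (intros E; rewrite E in Hsg; simpl in Hsg; lra).
  assert (E : sg * sg = 1) by (rewrite <- Hsg; ring).
  unfold y, ymod in *. auto_derive; [simpl in HR; lra |].
  replace (b2 + g2 * (x * (x * 1))) with (b2 + g2 * x ^ 2) by (simpl; ring).
  transitivity (sg * sg * (g2 * x / (sg * sqrt (b2 + g2 * x ^ 2)))); [field; lra |].
  rewrite E. ring.
Qed.

(** The difference of the squares of [w] and [y - mu] contains the factor [d], whose cofactor is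
    [q]; what remains is the defect [g] of the bound in the Riccati equation. *)
Lemma ode_touch : linear_ode d g q.
Proof.
  intros x Hx. pose proof (Hw x Hx) as D1. pose proof (is_derive_ymod x Hx) as D2.
  pose proof (ymod_neq_0 x Hx) as H0. unfold d, g, q. clearbody y. split.
  - auto_derive.
    + split; [eexists; exact D1 | split; [eexists; exact D2 | exact I]].
    + rewrite (is_derive_unique (fun t : R => w t) x _ D1), (is_derive_unique (fun t : R => y t) x _ D2).
      field. split; lra.
  - apply (ex_derive_continuous (V := R_NormedModule)). auto_derive.
    split; [eexists; exact D1 | split; [eexists; exact D2 | split; [lra | exact I]]].
Qed.

Hypothesis Hval : w xs = y xs - mu.
Hypothesis Hslope : ric_D n w xs * y xs = g2 * xs ^ 2.

Lemma touch_slope : (xs ^ 2 + n ^ 2 - (y xs - mu) ^ 2) * y xs = g2 * xs ^ 2.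
Proof. rewrite <- Hslope, <- Hval. reflexivity. Qed.

Lemma touch_defect (x : R) : 0 < x ->
  x * y x * g x = y x * (x ^ 2 + n ^ 2 - (y x - mu) ^ 2) - g2 * x ^ 2.
Proof.
  intros Hx. pose proof (ymod_neq_0 x Hx). unfold g. field. split; assumption || lra.
Qed.

Lemma ymod_abs_incr (a b : R) : 0 < a < b -> sg * y a < sg * y b.
Proof.
  intros Hab. unfold y, ymod. rewrite <- !Rmult_assoc.
  replace (sg * sg) with 1 by (rewrite <- Hsg; ring). rewrite !Rmult_1_l.
  apply sqrt_lt_1; [apply Rlt_le, radicand_pos; lra | apply Rlt_le, radicand_pos; lra |].
  apply Rplus_lt_compat_l, Rmult_lt_compat_l; [exact Hg2 | nra].
Qed.

Lemma ymod_abs_pos (x : R) : 0 < x -> 0 < sg * y x.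
Proof.
  intros Hx. unfold y, ymod. rewrite <- Rmult_assoc.
  replace (sg * sg) with 1 by (rewrite <- Hsg; ring). rewrite Rmult_1_l.
  now apply sqrt_lt_R0, radicand_pos.
Qed.

Lemma ode_touch_forward (a b s : R) : s ^ 2 = 1 -> 0 < a < b ->
  (forall t, a < t < b -> 0 < s * g t) -> 0 <= s * d a -> 0 < s * d b.
Proof.
  intros Hs Hab Hg Ha.
  assert (Hcase : s = 1 \/ s = -1).
  { assert (E : (s - 1) * (s + 1) = 0) by lra.
    destruct (Rmult_integral _ _ E); [left | right]; lra. }
  destruct Hcase as [-> | ->].
  - rewrite Rmult_1_l in *. apply (ode_forward _ _ _ ode_touch a b Hab); [| exact Ha].
    intros t Ht. specialize (Hg t Ht). lra.
  - replace (-1 * d b) with (- d b) by ring. replace (-1 * d a) with (- d a) in Ha by ring.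
    apply (ode_forward _ _ _ (linear_ode_opp _ _ _ ode_touch) a b Hab); [| exact Ha].
    intros t Ht. specialize (Hg t Ht). lra.
Qed.

Lemma ode_touch_backward (a b s : R) : s ^ 2 = 1 -> 0 < a < b ->
  (forall t, a < t < b -> 0 < s * g t) -> s * d b <= 0 -> s * d a < 0.
Proof.
  intros Hs Hab Hg Hb. apply Rnot_le_lt. intros Ha.
  pose proof (ode_touch_forward a b s Hs Hab Hg Ha). lra.
Qed.

End Touch.

Lemma filterlim_ymod_at_0 (sg b2 g2 : R) :
  filterlim (ymod sg b2 g2) (at_right 0) (locally (sg * sqrt b2)).
Proof.
  unfold ymod. eapply filterlim_eq.
  - apply filterlim_Rmult; [apply filterlim_const |]. apply filterlim_sqrt_fun. lim.
  - simpl. f_equal. f_equal. ring.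
Qed.

(** * Comparison for the first kind *)

Section TouchI.
Variables (n : R) (w : R -> R) (lam xs : R).
Hypothesis Hw : riccati n w.
Hypothesis Hn : 0 <= n.
Hypothesis Hb : forall x, 0 < x -> n < w x <= n + x ^ 2 / (2 * (n + 1)).
Hypothesis Hxs : 0 < xs.

Lemma touchI_infty (b2 : R) :
  0 < lam -> 0 <= b2 ->
  let y := ymod 1 b2 1 in
  w xs = y xs - (lam + 1 / 2) -> ric_D n w xs * y xs = 1 * xs ^ 2 ->
  forall x, 0 < x -> x <> xs -> 0 < w x - (y x - (lam + 1 / 2)).
Proof.
  intros Hl Hb2 y Hval Hslope x Hx Hne.
  assert (H11 : 1 ^ 2 = 1) by ring. assert (Hm11 : (-1) ^ 2 = 1) by ring.
  assert (H01 : 0 < 1) by lra.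
  set (g := fun x => (x ^ 2 + n ^ 2 - (y x - (lam + 1 / 2)) ^ 2 - 1 * x ^ 2 / y x) / x).
  set (d := fun x => w x - (y x - (lam + 1 / 2))). change (0 < d x).
  assert (Hy : forall t, 0 < t -> 0 < y t).
  { intros t Ht. pose proof (ymod_abs_pos 1 b2 1 H11 Hb2 H01 t Ht) as H. fold y in H. lra. }
  assert (Hinc : forall a b, 0 < a < b -> y a < y b).
  { intros a b Hab. pose proof (ymod_abs_incr 1 b2 1 H11 Hb2 H01 a b Hab) as H. fold y in H. lra. }
  assert (Hsq : forall t, 0 < t -> y t ^ 2 = b2 + t ^ 2).
  { intros t Ht. pose proof (ymod_sqr 1 b2 1 H11 Hb2 H01 t Ht) as H. fold y in H. lra. }
  pose proof (touch_slope n w 1 b2 1 (lam + 1 / 2) xs Hval Hslope) as Hsl. fold y in Hsl.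
  assert (Hd0 : d xs = 0) by (unfold d; lra).
  assert (Hys := Hy xs Hxs).
  (* The defect is a quadratic in [y] with the known root [y xs]. *)
  assert (Hid : forall t, 0 < t ->
     t * y t * g t = (y t - y xs) * (2 * lam * y t - b2 / y xs)).
  { intros t Ht. pose proof (touch_defect n 1 b2 1 (lam + 1 / 2) H11 Hb2 H01 t Ht) as H.
    change (t * y t * g t = y t * (t ^ 2 + n ^ 2 - (y t - (lam + 1 / 2)) ^ 2) - 1 * t ^ 2) in H. rewrite H.
    rewrite <- (touch_identity_infty t xs n lam b2 (y t) (y xs)).
    - ring.
    - lra.
    - rewrite (Hsq t Ht); ring.
    - rewrite (Hsq xs Hxs); ring.
    - rewrite Hsl. ring. }
  assert (Hgpos : forall t, 0 < t -> 0 < (y t - y xs) * (2 * lam * y t - b2 / y xs) -> 0 < 1 * g t).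
  { intros t Ht H. rewrite <- (Hid t Ht) in H. pose proof (Hy t Ht).
    assert (0 < t * y t) by now apply Rmult_lt_0_compat. nra. }
  assert (Hgneg : forall t, 0 < t -> (y t - y xs) * (2 * lam * y t - b2 / y xs) < 0 -> 0 < -1 * g t).
  { intros t Ht H. rewrite <- (Hid t Ht) in H. pose proof (Hy t Ht).
    assert (0 < t * y t) by now apply Rmult_lt_0_compat. nra. }
  set (b := b2 / y xs) in *.
  (* If the second root is not to the left of [y c], both factors are negative on [(0, c)], so
     [g > 0] there and a positive start of [d] at 0 propagates to [c]. *)
  assert (Hstart : forall c, 0 < c <= xs -> 2 * lam * y c <= b -> 0 < d c).
  { intros c Hc Hcb.
    assert (Hlim0 : filterlim d (at_right 0) (locally (n - (sqrt b2 - (lam + 1 / 2))))).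
    { pose proof (ricI_at_0 n w Hn Hb). pose proof (filterlim_ymod_at_0 1 b2 1) as Hy0.
      unfold d, y. eapply filterlim_eq; [lim |]. ring. }
    set (s := sqrt b2) in *.
    assert (Hs0 : 0 <= s) by apply sqrt_pos.
    assert (Hss : s ^ 2 = b2) by now apply pow2_sqrt.
    assert (Hsc : s < y c).
    { pose proof (Hsq c ltac:(lra)). pose proof (Hy c ltac:(lra)). assert (0 < c ^ 2) by (apply pow_lt; lra). nra. }
    assert (Hb0 : 0 < b) by (pose proof (Hy c ltac:(lra)); nra).
    assert (Hb20 : 0 < b2).
    { replace b2 with (b * y xs) by (unfold b; field; lra). now apply Rmult_lt_0_compat. }
    assert (Hspos : 0 < s) by now apply sqrt_lt_R0.
    assert (Hcx : y c <= y xs).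
    { destruct (proj2 Hc) as [Hc' | ->]; [apply Rlt_le, Hinc; lra | lra]. }
    (* The identity at [x = 0], where [y = s]: the sign of the product gives [(s - mu)^2 < n^2] with
       [mu = lam + 1/2], hence a positive limit of [d] at 0. *)
    pose proof (touch_identity_infty 0 xs n lam b2 s (y xs) ltac:(lra)
      ltac:(rewrite Hss; ring) ltac:(rewrite (Hsq xs Hxs); ring) ltac:(rewrite Hsl; ring)) as Hid0.
    fold b in Hid0.
    assert (Hpos : 0 < (s - y xs) * (2 * lam * s - b)).
    { assert (2 * lam * s < 2 * lam * y c) by (apply Rmult_lt_compat_l; lra). nra. }
    rewrite <- Hid0 in Hpos.
    assert (0 < n ^ 2 - (s - (lam + 1 / 2)) ^ 2) by nra.
    assert (Hpos' : 0 < n - (s - (lam + 1 / 2))) by nra.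
    destruct (at_right_elim _ (filterlim_pos_eventually _ _ _ 0 Hlim0 Hpos')) as [e [He He']].
    set (a := Rmin (e / 2) (c / 2)).
    assert (Ha : 0 < a < e /\ a < c) by (unfold a, Rmin; destruct (Rle_dec (e / 2) (c / 2)); lra).
    assert (Hda : 0 <= 1 * d a) by (specialize (He' a ltac:(lra)); lra).
    assert (0 < 1 * d c); [| lra].
    apply (ode_touch_forward n w 1 b2 1 (lam + 1 / 2) Hw H11 Hb2 H01 a c 1 H11 ltac:(lra)); [| exact Hda].
    intros t Ht. apply Hgpos; [lra |].
    pose proof (Hinc t c ltac:(lra)).
    assert (2 * lam * y t < 2 * lam * y c) by (apply Rmult_lt_compat_l; lra). nra. }
  (* Otherwise the previous claim at [c = xs] contradicts the contact. The second root therefore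
     lies to the left of [y xs]. *)
  assert (Hcase : b < 2 * lam * y xs).
  { apply Rnot_le_lt. intros Hc. pose proof (Hstart xs ltac:(lra) Hc). lra. }
  destruct (Rlt_le_dec x xs) as [Hlt | Hge].
  - destruct (Rle_lt_dec (2 * lam * y x) b) as [Hc | Hc]; [apply Hstart; lra |].
    assert (-1 * d x < 0); [| lra].
    apply (ode_touch_backward n w 1 b2 1 (lam + 1 / 2) Hw H11 Hb2 H01 x xs (-1) Hm11 ltac:(lra)).
    + intros t Ht. apply Hgneg; [lra |]. pose proof (Hinc x t ltac:(lra)). pose proof (Hinc t xs ltac:(lra)).
      assert (2 * lam * y x < 2 * lam * y t) by (apply Rmult_lt_compat_l; lra). nra.
    + change (-1 * d xs <= 0). lra.
  - assert (0 < 1 * d x); [| lra].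
    apply (ode_touch_forward n w 1 b2 1 (lam + 1 / 2) Hw H11 Hb2 H01 xs x 1 H11 ltac:(lra)).
    + intros t Ht. apply Hgpos; [lra |]. pose proof (Hinc xs t ltac:(lra)).
      assert (2 * lam * y xs < 2 * lam * y t) by (apply Rmult_lt_compat_l; lra). nra.
    + change (0 <= 1 * d xs). lra.
Qed.

Lemma touchI_0 (g2 : R) :
  0 < n + lam -> 0 < g2 ->
  let y := ymod 1 ((n + lam) ^ 2) g2 in
  w xs = y xs - lam -> ric_D n w xs * y xs = g2 * xs ^ 2 ->
  forall x, 0 < x -> x <> xs -> w x - (y x - lam) < 0.
Proof.
  intros Hl Hg2 y Hval Hslope x Hx Hne.
  assert (H11 : 1 ^ 2 = 1) by ring. assert (Hm11 : (-1) ^ 2 = 1) by ring.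
  set (m := n + lam) in *. assert (Hb2 : 0 <= m ^ 2) by apply pow2_ge_0.
  set (g := fun x => (x ^ 2 + n ^ 2 - (y x - lam) ^ 2 - g2 * x ^ 2 / y x) / x).
  set (d := fun x => w x - (y x - lam)). change (d x < 0).
  assert (Hinc : forall a b, 0 < a < b -> y a < y b).
  { intros a b Hab. pose proof (ymod_abs_incr 1 (m ^ 2) g2 H11 Hb2 Hg2 a b Hab) as H. fold y in H. lra. }
  assert (Hsq : forall t, 0 < t -> y t ^ 2 = m ^ 2 + g2 * t ^ 2).
  { intros t Ht. exact (ymod_sqr 1 (m ^ 2) g2 H11 Hb2 Hg2 t Ht). }
  assert (Hy : forall t, 0 < t -> m < y t).
  { intros t Ht. pose proof (ymod_abs_pos 1 (m ^ 2) g2 H11 Hb2 Hg2 t Ht) as H. fold y in H.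
    pose proof (Hsq t Ht). assert (0 < g2 * t ^ 2) by (apply Rmult_lt_0_compat; [lra | now apply pow_lt]). nra. }
  pose proof (touch_slope n w 1 (m ^ 2) g2 lam xs Hval Hslope) as Hsl. fold y in Hsl.
  assert (Hd0 : d xs = 0) by (unfold d; lra).
  assert (Hys := Hy xs Hxs).
  set (k := fun s => (/ g2 - 1) * s + m / y xs).
  (* The defect is a cubic in [y] with the known roots [m] (from sharpness at 0) and [y xs]. *)
  assert (Hid : forall t, 0 < t ->
     t * y t * g t = (y t - m) * ((y t - y xs) * k (y t))).
  { intros t Ht. pose proof (touch_defect n 1 (m ^ 2) g2 lam H11 Hb2 Hg2 t Ht) as H.
    change (t * y t * g t = y t * (t ^ 2 + n ^ 2 - (y t - lam) ^ 2) - g2 * t ^ 2) in H. rewrite H.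
    apply (touch_identity_0 t xs n lam g2 (y t) (y xs)); fold m; try lra.
    - rewrite (Hsq t Ht); ring.
    - rewrite (Hsq xs Hxs); ring. }
  assert (Hgpos : forall t, 0 < t -> 0 < (y t - y xs) * k (y t) -> 0 < 1 * g t).
  { intros t Ht H. pose proof (Hy t Ht).
    assert (H2 : 0 < t * y t * g t) by (rewrite (Hid t Ht); apply Rmult_lt_0_compat; lra).
    assert (0 < t * y t) by (apply Rmult_lt_0_compat; lra). nra. }
  assert (Hgneg : forall t, 0 < t -> 0 < (y xs - y t) * k (y t) -> 0 < -1 * g t).
  { intros t Ht H. pose proof (Hy t Ht).
    assert (H2 : 0 < - (t * y t * g t)).
    { rewrite (Hid t Ht).
      replace (- ((y t - m) * ((y t - y xs) * k (y t)))) with ((y t - m) * ((y xs - y t) * k (y t))) by ring.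
      apply Rmult_lt_0_compat; lra. }
    assert (0 < t * y t) by (apply Rmult_lt_0_compat; lra). nra. }
  assert (Hk0 : 0 < m / y xs) by (apply Rdiv_lt_0_compat; lra).
  (* The affine [k] is positive at 0 and nonnegative at [y c], hence positive in between whatever
     its slope. Sharpness at 0 makes [d] vanish in the limit, as [ode_from_zero] requires. *)
  assert (Hstart : forall c, 0 < c <= xs -> 0 <= k (y c) -> d c < 0).
  { intros c Hc Hcb. assert (0 < - d c); [| lra].
    apply (ode_from_zero _ _ _ (linear_ode_opp _ _ _ (ode_touch n w 1 (m ^ 2) g2 lam Hw H11 Hb2 Hg2)) 0 c); [lra | | |].
    - intros t Ht. change (0 < - g t).
      assert (0 < -1 * g t); [| lra]. apply Hgneg; [lra |].
      pose proof (Hinc t c ltac:(lra)). pose proof (Hy t ltac:(lra)).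
      assert (y c <= y xs) by (destruct (proj2 Hc) as [Hc' | ->]; [apply Rlt_le, Hinc; lra | lra]).
      apply Rmult_lt_0_compat; [lra |]. unfold k in *.
      destruct (Rle_lt_dec 0 (/ g2 - 1)) as [Ha | Ha]; nra.
    - generalize at_right_pos. apply filter_imp. intros t Ht. fold y.
      pose proof (Hb t Ht). pose proof (Hy t Ht).
      assert (0 < / t) by now apply Rinv_0_lt_compat.
      unfold Rdiv. assert (0 <= w t + (y t - lam)) by (unfold m in *; lra). nra.
    - pose proof (ricI_at_0 n w Hn Hb). pose proof (filterlim_ymod_at_0 1 (m ^ 2) g2) as Hy0.
      fold y in Hy0. fold y. eapply filterlim_eq; [lim |].
      rewrite sqrt_pow2 by lra. unfold m. ring. }
  assert (Hcase : k (y xs) < 0).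
  { apply Rnot_le_lt. intros Hc. pose proof (Hstart xs ltac:(lra) Hc). lra. }
  assert (Ha : / g2 - 1 < 0) by (unfold k in Hcase; nra).
  destruct (Rlt_le_dec x xs) as [Hlt | Hge].
  - destruct (Rle_lt_dec 0 (k (y x))) as [Hc | Hc]; [apply Hstart; lra |].
    assert (1 * d x < 0); [| lra].
    apply (ode_touch_backward n w 1 (m ^ 2) g2 lam Hw H11 Hb2 Hg2 x xs 1 H11 ltac:(lra)).
    + intros t Ht. apply Hgpos; [lra |]. pose proof (Hinc x t ltac:(lra)). pose proof (Hinc t xs ltac:(lra)).
      assert (k (y t) < 0) by (unfold k in *; nra). nra.
    + change (1 * d xs <= 0). lra.
  - assert (0 < -1 * d x); [| lra].
    apply (ode_touch_forward n w 1 (m ^ 2) g2 lam Hw H11 Hb2 Hg2 xs x (-1) Hm11 ltac:(lra)).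
    + intros t Ht. apply Hgneg; [lra |]. pose proof (Hinc xs t ltac:(lra)).
      assert (k (y t) < 0) by (unfold k in *; nra). nra.
    + change (0 <= -1 * d xs). lra.
Qed.

End TouchI.

(** * Comparison for the second kind *)

Section TouchK.
Variables (n : R) (w : R -> R) (lam xs : R).
Hypothesis Hw : riccati n w.
Hypothesis Hn : n < - (1 / 2).
Hypothesis Hb : forall x, 0 < x -> n - x <= w x < n.
Hypothesis Hb' : forall x, 0 < x -> w x <= - n - x.
Hypothesis Hxs : 0 < xs.

(** The bound itself is negative up to [mu] and of linear growth, so it only reinforces the
    antidamping that [w] already provides. *)
Lemma touchK_end (b2 g2 mu : R) : 0 <= b2 -> 0 < g2 -> 0 < mu -> exists C,
  Rbar_locally p_infty (fun x => 1 / 2 <= - (w x + (ymod (-1) b2 g2 x - mu)) / x /\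
    Rabs (w x - (ymod (-1) b2 g2 x - mu)) <= C * x ^ 4).
Proof.
  intros Hb2 Hg2 Hmu. exists (1 - n + (1 + b2 + g2) + mu).
  exists (1 - 2 * n). intros x Hx. pose proof (Hb x ltac:(lra)) as H1. pose proof (Hb' x ltac:(lra)) as H2.
  unfold ymod. pose proof (sqrt_pos (b2 + g2 * x ^ 2)) as Hs.
  assert (Hs' : sqrt (b2 + g2 * x ^ 2) <= (1 + b2 + g2) * x ^ 2).
  { assert (1 <= x ^ 2) by nra.
    apply Rle_trans with (1 + b2 + g2 * x ^ 2); [| nra].
    set (z := b2 + g2 * x ^ 2). assert (0 <= z) by (unfold z; nra).
    replace (1 + b2 + g2 * x ^ 2) with (1 + z) by (unfold z; ring).
    pose proof (sqrt_sqrt z ltac:(assumption)). pose proof (sqrt_pos z). nra. }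
  split.
  - apply Rmult_le_reg_r with x; [lra |]. unfold Rdiv at 2. rewrite Rmult_assoc, Rinv_l by lra. lra.
  - destruct (le_pow4 x ltac:(lra)).
    assert (1 <= x ^ 4) by (apply pow_R1_Rle; lra).
    assert ((1 + b2 + g2) * x ^ 2 <= (1 + b2 + g2) * x ^ 4) by (apply Rmult_le_compat_l; lra).
    assert ((- n) * 1 <= (- n) * x ^ 4) by (apply Rmult_le_compat_l; lra).
    assert (mu * 1 <= mu * x ^ 4) by (apply Rmult_le_compat_l; lra).
    apply Rabs_le. split; lra.
Qed.

Lemma touchK_infty (b2 : R) :
  0 < lam -> 0 <= b2 ->
  let y := ymod (-1) b2 1 in
  w xs = y xs - (lam + 1 / 2) -> ric_D n w xs * y xs = 1 * xs ^ 2 ->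
  forall x, 0 < x -> x <> xs -> 0 < w x - (y x - (lam + 1 / 2)).
Proof.
  intros Hl Hb2 y Hval Hslope x Hx Hne.
  assert (H11 : 1 ^ 2 = 1) by ring. assert (Hm11 : (-1) ^ 2 = 1) by ring.
  assert (H01 : 0 < 1) by lra.
  set (g := fun x => (x ^ 2 + n ^ 2 - (y x - (lam + 1 / 2)) ^ 2 - 1 * x ^ 2 / y x) / x).
  set (d := fun x => w x - (y x - (lam + 1 / 2))). change (0 < d x).
  assert (Hy : forall t, 0 < t -> y t < 0).
  { intros t Ht. pose proof (ymod_abs_pos (-1) b2 1 Hm11 Hb2 H01 t Ht) as H. fold y in H. lra. }
  assert (Hinc : forall a b, 0 < a < b -> y b < y a).
  { intros a b Hab. pose proof (ymod_abs_incr (-1) b2 1 Hm11 Hb2 H01 a b Hab) as H. fold y in H. lra. }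
  assert (Hsq : forall t, 0 < t -> y t ^ 2 = b2 + t ^ 2).
  { intros t Ht. pose proof (ymod_sqr (-1) b2 1 Hm11 Hb2 H01 t Ht) as H. fold y in H. lra. }
  pose proof (touch_slope n w (-1) b2 1 (lam + 1 / 2) xs Hval Hslope) as Hsl. fold y in Hsl.
  assert (Hd0 : d xs = 0) by (unfold d; lra).
  assert (Hys := Hy xs Hxs).
  set (k := fun s => 2 * lam * s - b2 / y xs).
  assert (Hid : forall t, 0 < t -> t * - y t * g t = (y xs - y t) * k (y t)).
  { intros t Ht. pose proof (touch_defect n (-1) b2 1 (lam + 1 / 2) Hm11 Hb2 H01 t Ht) as H.
    change (t * y t * g t = y t * (t ^ 2 + n ^ 2 - (y t - (lam + 1 / 2)) ^ 2) - 1 * t ^ 2) in H.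
    replace (t * - y t * g t) with (- (t * y t * g t)) by ring. rewrite H.
    replace ((y xs - y t) * k (y t)) with (- ((y t - y xs) * k (y t))) by ring. unfold k.
    rewrite <- (touch_identity_infty t xs n lam b2 (y t) (y xs)).
    - ring.
    - lra.
    - rewrite (Hsq t Ht); ring.
    - rewrite (Hsq xs Hxs); ring.
    - rewrite Hsl. ring. }
  assert (Hgpos : forall t, 0 < t -> 0 < (y xs - y t) * k (y t) -> 0 < 1 * g t).
  { intros t Ht H. rewrite <- (Hid t Ht) in H. pose proof (Hy t Ht).
    assert (0 < t * - y t) by (apply Rmult_lt_0_compat; lra). nra. }
  assert (Hgneg : forall t, 0 < t -> (y xs - y t) * k (y t) < 0 -> 0 < -1 * g t).
  { intros t Ht H. rewrite <- (Hid t Ht) in H. pose proof (Hy t Ht).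
    assert (0 < t * - y t) by (apply Rmult_lt_0_compat; lra). nra. }
  assert (Hkinc : forall a b, 0 < a < b -> k (y b) < k (y a)).
  { intros a b Hab. unfold k. pose proof (Hinc a b Hab).
    assert (2 * lam * y b < 2 * lam * y a) by (apply Rmult_lt_compat_l; lra). lra. }
  (* The mirror image of the argument at 0: a nonpositive [k] at [c] stays negative beyond it, and
     the integration starts at infinity. *)
  assert (Hend : forall c, xs <= c -> k (y c) <= 0 -> 0 < d c).
  { intros c Hc Hcb. destruct (touchK_end b2 1 (lam + 1 / 2) Hb2 H01 ltac:(lra)) as [C HC].
    assert (- d c < 0); [| lra].
    apply (ode_from_infinity _ _ _ (linear_ode_opp _ _ _
      (ode_touch n w (-1) b2 1 (lam + 1 / 2) Hw Hm11 Hb2 H01)) C c); [lra | |].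
    - intros t Ht. change (0 < - g t).
      assert (0 < -1 * g t); [| lra]. apply Hgneg; [lra |].
      pose proof (Hkinc c t ltac:(lra)). pose proof (Hinc xs t ltac:(lra)). nra.
    - revert HC. apply filter_imp. intros t. now rewrite Rabs_Ropp. }
  assert (Hcase : 0 < k (y xs)).
  { apply Rnot_le_lt. intros Hc. pose proof (Hend xs ltac:(lra) Hc). lra. }
  destruct (Rlt_le_dec x xs) as [Hlt | Hge].
  - assert (-1 * d x < 0); [| lra].
    apply (ode_touch_backward n w (-1) b2 1 (lam + 1 / 2) Hw Hm11 Hb2 H01 x xs (-1) Hm11 ltac:(lra)).
    + intros t Ht. apply Hgneg; [lra |]. pose proof (Hkinc t xs ltac:(lra)).
      pose proof (Hinc t xs ltac:(lra)). nra.
    + change (-1 * d xs <= 0). lra.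
  - destruct (Rle_lt_dec (k (y x)) 0) as [Hc | Hc]; [apply Hend; lra |].
    assert (0 < 1 * d x); [| lra].
    apply (ode_touch_forward n w (-1) b2 1 (lam + 1 / 2) Hw Hm11 Hb2 H01 xs x 1 H11 ltac:(lra)).
    + intros t Ht. apply Hgpos; [lra |]. pose proof (Hinc xs t ltac:(lra)).
      pose proof (Hkinc t x ltac:(lra)). nra.
    + change (0 <= 1 * d xs). lra.
Qed.

Lemma touchK_0 (g2 : R) :
  1 / 2 < lam -> n + lam <= 0 -> 0 < g2 ->
  let y := ymod (-1) ((n + lam) ^ 2) g2 in
  w xs = y xs - lam -> ric_D n w xs * y xs = g2 * xs ^ 2 ->
  forall x, 0 < x -> x <> xs -> w x - (y x - lam) < 0.
Proof.
  intros Hl Hm Hg2 y Hval Hslope x Hx Hne.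
  assert (H11 : 1 ^ 2 = 1) by ring. assert (Hm11 : (-1) ^ 2 = 1) by ring.
  set (m := n + lam) in *. assert (Hb2 : 0 <= m ^ 2) by apply pow2_ge_0.
  set (g := fun x => (x ^ 2 + n ^ 2 - (y x - lam) ^ 2 - g2 * x ^ 2 / y x) / x).
  set (d := fun x => w x - (y x - lam)). change (d x < 0).
  assert (Hinc : forall a b, 0 < a < b -> y b < y a).
  { intros a b Hab. pose proof (ymod_abs_incr (-1) (m ^ 2) g2 Hm11 Hb2 Hg2 a b Hab) as H. fold y in H. lra. }
  assert (Hsq : forall t, 0 < t -> y t ^ 2 = m ^ 2 + g2 * t ^ 2).
  { intros t Ht. exact (ymod_sqr (-1) (m ^ 2) g2 Hm11 Hb2 Hg2 t Ht). }
  assert (Hy : forall t, 0 < t -> y t < m).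
  { intros t Ht. pose proof (ymod_abs_pos (-1) (m ^ 2) g2 Hm11 Hb2 Hg2 t Ht) as H. fold y in H.
    pose proof (Hsq t Ht). assert (0 < g2 * t ^ 2) by (apply Rmult_lt_0_compat; [lra | now apply pow_lt]). nra. }
  pose proof (touch_slope n w (-1) (m ^ 2) g2 lam xs Hval Hslope) as Hsl. fold y in Hsl.
  assert (Hd0 : d xs = 0) by (unfold d; lra).
  assert (Hys := Hy xs Hxs).
  set (k := fun s => (/ g2 - 1) * - s - m / y xs).
  assert (Hids : forall t, 0 < t ->
     t * y t * g t = (y t - m) * ((y t - y xs) * ((/ g2 - 1) * y t + m / y xs)) /\
     2 * lam = 1 + m / y xs - (/ g2 - 1) * (y xs + m)).
  { intros t Ht. pose proof (touch_defect n (-1) (m ^ 2) g2 lam Hm11 Hb2 Hg2 t Ht) as H.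
    change (t * y t * g t = y t * (t ^ 2 + n ^ 2 - (y t - lam) ^ 2) - g2 * t ^ 2) in H. rewrite H.
    apply (touch_identity_0 t xs n lam g2 (y t) (y xs)); fold m; try lra.
    - rewrite (Hsq t Ht); ring.
    - rewrite (Hsq xs Hxs); ring. }
  assert (Hlam := proj2 (Hids xs Hxs)).
  assert (Hid : forall t, 0 < t -> t * - y t * g t = (m - y t) * ((y xs - y t) * k (y t))).
  { intros t Ht. replace (t * - y t * g t) with (- (t * y t * g t)) by ring.
    rewrite (proj1 (Hids t Ht)). unfold k. ring. }
  assert (Hgpos : forall t, 0 < t -> 0 < (y xs - y t) * k (y t) -> 0 < 1 * g t).
  { intros t Ht H. pose proof (Hy t Ht).
    assert (H2 : 0 < t * - y t * g t) by (rewrite (Hid t Ht); apply Rmult_lt_0_compat; lra).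
    assert (0 < t * - y t) by (apply Rmult_lt_0_compat; lra). nra. }
  assert (Hgneg : forall t, 0 < t -> 0 < (y t - y xs) * k (y t) -> 0 < -1 * g t).
  { intros t Ht H. pose proof (Hy t Ht).
    assert (H2 : 0 < - (t * - y t * g t)).
    { rewrite (Hid t Ht).
      replace (- ((m - y t) * ((y xs - y t) * k (y t)))) with ((m - y t) * ((y t - y xs) * k (y t))) by ring.
      apply Rmult_lt_0_compat; lra. }
    assert (0 < t * - y t) by (apply Rmult_lt_0_compat; lra). nra. }
  assert (Hk0 : 0 <= m / y xs).
  { replace (m / y xs) with (- m / - y xs) by (field; lra).
    apply Rmult_le_pos; [lra | apply Rlt_le, Rinv_0_lt_compat; lra]. }
  destruct (touchK_end (m ^ 2) g2 lam Hb2 Hg2 ltac:(lra)) as [C HC].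
  assert (Hendpos : forall c, xs <= c -> (forall t, c < t -> 0 < k (y t)) -> d c < 0).
  { intros c Hc Hk.
    apply (ode_from_infinity _ _ _ (ode_touch n w (-1) (m ^ 2) g2 lam Hw Hm11 Hb2 Hg2) C c);
      [lra | | exact HC].
    intros t Ht. change (0 < g t). assert (0 < 1 * g t); [| lra]. apply Hgpos; [lra |].
    apply Rmult_lt_0_compat; [pose proof (Hinc xs t ltac:(lra)); lra | now apply Hk]. }
  (* A constant sign of [k] on the whole of [(xs, +oo)] would contradict the contact. Each sign of
     the slope [/ g2 - 1] is tested: only a positive slope with [k] negative at the contact
     survives. *)
  assert (Hcase : k (y xs) < 0 /\ 0 < / g2 - 1).
  { assert (Hneg : (forall t, xs < t -> k (y t) < 0) -> False).
    { intros Hk. assert (- d xs < 0); [| lra].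
      apply (ode_from_infinity _ _ _ (linear_ode_opp _ _ _
        (ode_touch n w (-1) (m ^ 2) g2 lam Hw Hm11 Hb2 Hg2)) C xs); [lra | |].
      - intros t Ht. change (0 < - g t). assert (0 < -1 * g t); [| lra]. apply Hgneg; [lra |].
        pose proof (Hinc xs t ltac:(lra)). pose proof (Hk t Ht). nra.
      - revert HC. apply filter_imp. intros t. now rewrite Rabs_Ropp. }
    assert (Hpos : (forall t, xs < t -> 0 < k (y t)) -> False).
    { intros Hk. pose proof (Hendpos xs ltac:(lra) Hk). lra. }
    assert (Hd : forall t, xs < t -> k (y t) - k (y xs) = (/ g2 - 1) * (y xs - y t) /\ 0 < y xs - y t).
    { intros t Ht. pose proof (Hinc xs t ltac:(lra)). unfold k. split; [ring | lra]. }
    destruct (Rtotal_order (/ g2 - 1) 0) as [Ha | [Ha | Ha]].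
    - exfalso. apply Hneg. intros t Ht. pose proof (Hd t Ht).
      assert (k (y xs) < 0) by (unfold k; nra). nra.
    (* With zero slope [k] is the constant [- m / y xs = 1 - 2 lam], negative because
       [lam > 1/2]. *)
    - exfalso. rewrite Ha, Rmult_0_l in Hlam.
      apply Hneg. intros t Ht. unfold k. rewrite Ha. lra.
    - split; [| exact Ha]. apply Rnot_le_lt. intros Hk. apply Hpos.
      intros t Ht. pose proof (Hd t Ht). nra. }
  destruct Hcase as [Hcase Ha].
  assert (Hkinc : forall a b, 0 < a < b -> k (y a) < k (y b)).
  { intros a b Hab. unfold k. pose proof (Hinc a b Hab). nra. }
  destruct (Rlt_le_dec x xs) as [Hlt | Hge].
  - assert (1 * d x < 0); [| lra].
    apply (ode_touch_backward n w (-1) (m ^ 2) g2 lam Hw Hm11 Hb2 Hg2 x xs 1 H11 ltac:(lra)).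
    + intros t Ht. apply Hgpos; [lra |]. pose proof (Hkinc t xs ltac:(lra)).
      pose proof (Hinc t xs ltac:(lra)). nra.
    + change (1 * d xs <= 0). lra.
  - destruct (Rle_lt_dec 0 (k (y x))) as [Hc | Hc].
    + apply Hendpos; [lra |]. intros t Ht. pose proof (Hkinc x t ltac:(lra)). lra.
    + assert (0 < -1 * d x); [| lra].
      apply (ode_touch_forward n w (-1) (m ^ 2) g2 lam Hw Hm11 Hb2 Hg2 xs x (-1) Hm11 ltac:(lra)).
      * intros t Ht. apply Hgneg; [lra |]. pose proof (Hinc xs t ltac:(lra)).
        pose proof (Hkinc t x ltac:(lra)). nra.
      * change (0 <= -1 * d xs). lra.
Qed.

End TouchK.

(** * The optimal coefficients and their limits *)

Lemma eventually_at_right (P : R -> Prop) : (forall x, 0 < x -> P x) -> at_right 0 P.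
Proof. intros H. generalize at_right_pos. now apply filter_imp. Qed.

Lemma eventually_p_infty (P : R -> Prop) : (forall x, 0 < x -> P x) -> Rbar_locally p_infty P.
Proof. intros H. generalize (p_infty_gt 0). now apply filter_imp. Qed.

Lemma filterlim_ext_p_infty (f g : R -> R) (l : R) :
  (forall x, 0 < x -> f x = g x) ->
  filterlim f (Rbar_locally p_infty) (locally l) -> filterlim g (Rbar_locally p_infty) (locally l).
Proof. intros H. apply filterlim_ext_loc. now apply eventually_p_infty. Qed.

Lemma filterlim_ext_at_right (f g : R -> R) (l : R) :
  (forall x, 0 < x -> f x = g x) ->
  filterlim f (at_right 0) (locally l) -> filterlim g (at_right 0) (locally l).
Proof. intros H. apply filterlim_ext_loc. now apply eventually_at_right. Qed.

(** * Limits as the contact point tends to infinity *)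

Section LimitsAtInfinity.
Variables (n : R) (w : R -> R) (sg : R).
Hypothesis Hasym : filterlim (fun x => w x / x) (Rbar_locally p_infty) (locally sg).

Lemma ric_F_source :
  filterlim (fun x => (2 * n ^ 2 - 1 / 2) / x) (Rbar_locally p_infty) (locally 0).
Proof. eapply filterlim_eq; [unfold Rdiv; apply filterlim_Rmult; lim |]. ring. Qed.

Lemma ric_damping_lim (c : R) :
  filterlim (fun x => -2 * (w x + c) / x) (Rbar_locally p_infty) (locally (-2 * sg)).
Proof.
  apply filterlim_ext_p_infty with (fun x => -2 * (w x / x) - / x * (2 * c)).
  - intros x Hx. field. lra.
  - eapply filterlim_eq; [apply filterlim_Rminus; apply filterlim_Rmult; lim |]. ring.
Qed.

Hypothesis HF : filterlim (ric_F n w) (Rbar_locally p_infty) (locally 0).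

Lemma ric_D_asymptotic :
  filterlim (fun x => ric_D n w x / x) (Rbar_locally p_infty) (locally sg).
Proof.
  apply filterlim_ext_p_infty with (fun x => w x / x + (1 / 2 - ric_F n w x) * / x).
  - intros x Hx. unfold ric_F. field. lra.
  - eapply filterlim_eq.
    + apply filterlim_Rplus; [exact Hasym |]. apply filterlim_Rmult; lim.
    + ring.
Qed.

Lemma ric_G_source : filterlim
  (fun x => (ric_D n w x ^ 2 + ric_D n w x * (w x + 1 / 2) * (2 * (1 / 2) - 2)) / x)
  (Rbar_locally p_infty) (locally 0).
Proof.
  pose proof ric_D_asymptotic as HD.
  apply filterlim_ext_p_infty with (fun x => - (ric_D n w x / x) * ric_F n w x).
  - intros x Hx. unfold ric_F. field. lra.
  - eapply filterlim_eq; [apply filterlim_Rmult; [apply filterlim_Ropp; exact HD | exact HF] |]. ring.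
Qed.

Hypothesis Hsg : sg ^ 2 = 1.
Hypothesis HG : filterlim (ric_G (1 / 2) n w) (Rbar_locally p_infty) (locally 0).
Hypothesis HD0 : forall x, 0 < x -> ric_D n w x <> 0.
Hypothesis HM0 : forall x, 0 < x -> ric_M n w x <> 0.

Lemma sg_neq_0 : sg <> 0.
Proof. intros E. rewrite E in Hsg. simpl in Hsg. lra. Qed.

Lemma ric_mu_at_infinity :
  filterlim (fun x => x ^ 2 / ric_D n w x - w x) (Rbar_locally p_infty) (locally (1 / 2)).
Proof.
  pose proof ric_D_asymptotic as HD. pose proof sg_neq_0 as Hs.
  apply filterlim_ext_p_infty with
    (fun x => 1 / 2 - (ric_G (1 / 2) n w x * / x) / (ric_D n w x / x)).
  - intros x Hx. specialize (HD0 x Hx). unfold ric_G. field. split; assumption || lra.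
  - eapply filterlim_eq.
    + apply filterlim_Rminus; [apply filterlim_const |].
      apply filterlim_Rdiv; [apply filterlim_Rmult; lim | exact HD | exact Hs].
    + field. exact Hs.
Qed.

(** With [mu = x^2 / ric_D - w] one has [mu - 1/2 = - ric_G (1/2) / ric_D]; now expand
    [(w + 1/2 + (mu - 1/2))^2 - x^2]. The cross term is [ric_G (1/2)] times a bounded quantity, so
    convergence of [mu] is not enough and [ric_G (1/2)] itself must tend to 0. *)
Lemma ric_b2_at_infinity :
  filterlim (fun x => (x ^ 2 / ric_D n w x) ^ 2 - x ^ 2) (Rbar_locally p_infty)
    (locally (n ^ 2 - 1 / 4)).
Proof.
  pose proof ric_D_asymptotic as HD. pose proof sg_neq_0 as Hs. pose proof ric_mu_at_infinity as Hmu.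
  apply filterlim_ext_p_infty with
    (fun x => ric_F n w x + (n ^ 2 - 1 / 4)
      - 2 * ((ric_G (1 / 2) n w x * (w x / x + / x * (1 / 2))) / (ric_D n w x / x))
      + (x ^ 2 / ric_D n w x - w x - 1 / 2) ^ 2).
  - intros x Hx. specialize (HD0 x Hx). unfold ric_F, ric_G.
    assert (E : n ^ 2 = ric_D n w x - x ^ 2 + w x ^ 2) by (unfold ric_D; ring).
    rewrite E. field. split; assumption || lra.
  - eapply filterlim_eq.
    + apply filterlim_Rplus.
      * apply filterlim_Rminus; [lim |]. apply filterlim_Rmult; [apply filterlim_const |].
        apply filterlim_Rdiv; [| exact HD | exact Hs].
        apply filterlim_Rmult; [exact HG |]. apply filterlim_Rplus; [exact Hasym |].
        apply filterlim_Rmult; lim.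
      * apply filterlim_Rpow. apply filterlim_Rminus; [exact Hmu | apply filterlim_const].
    + field. exact Hs.
Qed.

Lemma ric_lambda_at_infinity :
  filterlim (fun x => ric_N n w x / ric_M n w x) (Rbar_locally p_infty) (locally (1 / 2)).
Proof.
  pose proof sg_neq_0 as Hs.
  apply filterlim_ext_p_infty with
    (fun x => (w x / x * (1 / 2 - ric_F n w x) + / x * n ^ 2)
              / (w x / x - / x * (2 * n + 1 / 2) + / x * ric_F n w x)).
  - intros x Hx. specialize (HM0 x Hx).
    replace (w x / x * (1 / 2 - ric_F n w x) + / x * n ^ 2) with (ric_N n w x / x)
      by (unfold ric_N, ric_F; field; lra).
    replace (w x / x - / x * (2 * n + 1 / 2) + / x * ric_F n w x) with (ric_M n w x / x)
      by (unfold ric_M, ric_F; field; lra).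
    field. split; assumption || lra.
  - eapply filterlim_eq.
    + apply filterlim_Rdiv.
      * apply filterlim_Rplus; [apply filterlim_Rmult; [exact Hasym | lim] | apply filterlim_Rmult; lim].
      * apply filterlim_Rplus; [apply filterlim_Rminus; [exact Hasym |] |]; apply filterlim_Rmult; lim.
      * lra.
    + field. lra.
Qed.

Lemma ric_g2_at_infinity :
  filterlim (fun x => ric_D n w x * (w x + ric_N n w x / ric_M n w x) / x ^ 2)
    (Rbar_locally p_infty) (locally 1).
Proof.
  pose proof ric_D_asymptotic as HD. pose proof ric_lambda_at_infinity as HL.
  apply filterlim_ext_p_infty with
    (fun x => ric_D n w x / x * (w x / x + / x * (ric_N n w x / ric_M n w x))).
  - intros x Hx. specialize (HM0 x Hx). field. split; assumption || lra.
  - eapply filterlim_eq.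
    + apply filterlim_Rmult; [exact HD |]. apply filterlim_Rplus; [exact Hasym |].
      apply filterlim_Rmult; [apply filterlim_inv_p_infty | exact HL].
    + transitivity (sg ^ 2); [ring | exact Hsg].
Qed.

End LimitsAtInfinity.

(** * Limits as the contact point tends to 0, by two steps [z1], [z2] of the continued fraction *)

Section LimitsAtZero.
Variables (n : R) (w z1 z2 : R -> R).
Hypothesis Hn : n + 1 <> 0.
Hypothesis Hz1 : forall x, 0 < x -> z1 x <> 0.
Hypothesis Hz2 : forall x, 0 < x -> z2 x <> 0.
Hypothesis Hwz : forall x, 0 < x -> w x = n + x ^ 2 / z1 x.
Hypothesis Hz12 : forall x, 0 < x -> z1 x = 2 * (n + 1) + x ^ 2 / z2 x.
Hypothesis Hz1_0 : filterlim z1 (at_right 0) (locally (2 * (n + 1))).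
Hypothesis Hz2_0 : filterlim z2 (at_right 0) (locally (2 * (n + 2))).
Hypothesis HD0 : forall x, 0 < x -> ric_D n w x <> 0.
Hypothesis HM0 : forall x, 0 < x -> ric_M n w x <> 0.

Lemma two_n1_neq_0 : 2 * (n + 1) <> 0.
Proof. apply Rmult_integral_contrapositive_currified; [lra | exact Hn]. Qed.

Lemma ric_w_at_zero : filterlim w (at_right 0) (locally n).
Proof.
  apply filterlim_ext_at_right with (fun x => n + x ^ 2 / z1 x).
  - intros x Hx. now rewrite Hwz.
  - eapply filterlim_eq; [lim; exact two_n1_neq_0 |]. simpl. field. exact Hn.
Qed.

Lemma ric_D_at_zero :
  filterlim (fun x => ric_D n w x / x ^ 2) (at_right 0) (locally (/ (n + 1))).
Proof.
  apply filterlim_ext_at_right with (fun x => 1 - 2 * n / z1 x - (x / z1 x) ^ 2).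
  - intros x Hx. unfold ric_D. rewrite (Hwz x Hx). specialize (Hz1 x Hx). field. split; lra.
  - eapply filterlim_eq; [lim; exact two_n1_neq_0 |]. simpl. field. exact Hn.
Qed.

(* With [eta = w - n = x^2/z1] and [zeta = x^2/z2]: [M = eta (eta - zeta)] and
   [N = eta ((n + eta) (zeta - eta) + eta)]. *)
Lemma ric_lambda_at_zero :
  filterlim (fun x => ric_N n w x / ric_M n w x) (at_right 0) (locally 2).
Proof.
  apply filterlim_ext_at_right with (fun x => z2 x / (z2 x - z1 x) - (n + x ^ 2 / z1 x)).
  - intros x Hx. specialize (HM0 x Hx). specialize (Hz1 x Hx). specialize (Hz2 x Hx).
    specialize (Hwz x Hx). specialize (Hz12 x Hx).
    assert (HxX : x ^ 2 = (z1 x - 2 * (n + 1)) * z2 x) by (rewrite Hz12; field; exact Hz2).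
    assert (HM : ric_M n w x = x ^ 4 * (z2 x - z1 x) / (z1 x ^ 2 * z2 x)).
    { replace (x ^ 4) with (x ^ 2 * x ^ 2) by ring. unfold ric_M, ric_D.
      rewrite Hwz. rewrite HxX. field. split; assumption. }
    assert (HN : ric_N n w x = x ^ 4 * (z2 x - (n + x ^ 2 / z1 x) * (z2 x - z1 x)) / (z1 x ^ 2 * z2 x)).
    { replace (x ^ 4) with (x ^ 2 * x ^ 2) by ring. unfold ric_N, ric_D.
      rewrite Hwz. rewrite HxX. field. split; assumption. }
    assert (Hne : z2 x - z1 x <> 0).
    { intros E. apply HM0. rewrite HM, E. unfold Rdiv. ring. }
    rewrite HM, HN. field. repeat split; try assumption; lra.
  - eapply filterlim_eq; [lim; lra || exact two_n1_neq_0 |]. simpl. field. split; [exact Hn | lra].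
Qed.

Lemma ric_g2_at_zero :
  filterlim (fun x => ric_D n w x * (w x + ric_N n w x / ric_M n w x) / x ^ 2)
    (at_right 0) (locally ((n + 2) / (n + 1))).
Proof.
  pose proof ric_D_at_zero as HD. pose proof ric_lambda_at_zero as HL. pose proof ric_w_at_zero as Hw0.
  apply filterlim_ext_at_right with
    (fun x => ric_D n w x / x ^ 2 * (w x + ric_N n w x / ric_M n w x)).
  - intros x Hx. specialize (HM0 x Hx). field. split; assumption || lra.
  - eapply filterlim_eq.
    + apply filterlim_Rmult; [exact HD |]. apply filterlim_Rplus; [exact Hw0 | exact HL].
    + field. exact Hn.
Qed.

Lemma ric_s_at_zero :
  filterlim (fun x => x ^ 2 / ric_D n w x) (at_right 0) (locally (n + 1)).
Proof.
  pose proof ric_D_at_zero as HD.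
  apply filterlim_ext_at_right with (fun x => / (ric_D n w x / x ^ 2)).
  - intros x Hx. specialize (HD0 x Hx). field. split; assumption || lra.
  - eapply filterlim_eq; [apply filterlim_Rinv_fun; [| exact HD] |].
    + now apply Rinv_neq_0_compat.
    + apply Rinv_inv.
Qed.

Lemma ric_mu_at_zero :
  filterlim (fun x => x ^ 2 / ric_D n w x - w x) (at_right 0) (locally 1).
Proof.
  pose proof ric_s_at_zero. pose proof ric_w_at_zero.
  eapply filterlim_eq; [apply filterlim_Rminus; eassumption |]. ring.
Qed.

Lemma ric_b2_at_zero :
  filterlim (fun x => (x ^ 2 / ric_D n w x) ^ 2 - x ^ 2) (at_right 0) (locally ((n + 1) ^ 2)).
Proof.
  pose proof ric_s_at_zero.
  eapply filterlim_eq; [apply filterlim_Rminus; [apply filterlim_Rpow; eassumption | lim] |]. simpl. ring.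
Qed.

End LimitsAtZero.

(** * Closed forms of the coefficients, for both kinds at once *)

Section Coefficients.
Variables (nu sg : R) (w h : R -> R).
Let n := sg * nu.
Hypothesis Hsg : sg ^ 2 = 1.
Hypothesis Hw : riccati n w.
Hypothesis Hh : forall x, 0 < x -> h x = (nu + sg * w x) / x.
Hypothesis HD0 : forall x, 0 < x -> ric_D n w x <> 0.

Definition rad (beta gamma x : R) : R := sqrt (beta ^ 2 + gamma ^ 2 * x ^ 2).

Lemma is_derive_B (alpha beta gamma x : R) :
  0 < x -> 0 < rad beta gamma x ->
  is_derive (B alpha beta gamma) x
    ((gamma ^ 2 * x ^ 2 / rad beta gamma x - (alpha + rad beta gamma x)) / x ^ 2).
Proof.
  intros Hx Hr. unfold B, rad in *.
  assert (HR : 0 < beta ^ 2 + gamma ^ 2 * x ^ 2).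
  { apply Rnot_le_lt. intros Hc. rewrite sqrt_neg_0 in Hr; lra. }
  auto_derive; [repeat split; simpl in *; lra |].
  replace (beta * (beta * 1) + gamma * (gamma * 1) * (x * (x * 1)))
    with (beta ^ 2 + gamma ^ 2 * x ^ 2) by (simpl; ring).
  field. split; lra.
Qed.

Lemma is_derive_ratio (x : R) : 0 < x ->
  is_derive h x ((sg * ric_D n w x - (nu + sg * w x)) / x ^ 2).
Proof.
  intros Hx. apply is_derive_ext_loc with (fun t => (nu + sg * w t) / t).
  - apply filter_imp with (fun t => 0 < t); [| now apply (open_gt 0)].
    intros t Ht. symmetry. now apply Hh.
  - pose proof (Hw x Hx) as D1. auto_derive.
    + split; [eexists; exact D1 | split; [lra | exact I]].
    + rewrite (is_derive_unique (fun t : R => w t) x _ D1). unfold ric_D. field. lra.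
Qed.

(** Multiplying by [x] turns tangency into algebra, since [x^2 h' + x h = sg * ric_D]. A zero
    radicand would force [ric_D = 0], so [sqrt] is always differentiated at a positive point. *)
Lemma interpolates_iff (xs alpha beta gamma : R) : 0 < xs ->
  interpolates h xs alpha beta gamma <->
  0 < rad beta gamma xs /\ nu + sg * w xs = alpha + rad beta gamma xs /\
  sg * ric_D n w xs * rad beta gamma xs = gamma ^ 2 * xs ^ 2.
Proof.
  intros Hx. unfold interpolates.
  rewrite (is_derive_unique _ _ _ (is_derive_ratio xs Hx)), (Hh xs Hx).
  assert (Hval : (nu + sg * w xs) / xs = B alpha beta gamma xs <->
                 nu + sg * w xs = alpha + rad beta gamma xs).
  { unfold B. fold (rad beta gamma xs). split; intros E.
    - apply Rmult_eq_reg_r with (/ xs); [exact E | apply Rinv_neq_0_compat; lra].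
    - now rewrite E. }
  rewrite Hval. clear Hval.
  destruct (sqrt_pos (beta ^ 2 + gamma ^ 2 * xs ^ 2)) as [Hr | Hr].
  - fold (rad beta gamma xs) in Hr.
    rewrite (is_derive_unique _ _ _ (is_derive_B alpha beta gamma xs Hx Hr)).
    split.
    + intros [E1 E2]. split; [exact Hr | split; [exact E1 |]].
      assert (E3 : sg * ric_D n w xs = gamma ^ 2 * xs ^ 2 / rad beta gamma xs).
      { rewrite E1 in E2.
        apply Rmult_eq_compat_r with (r := xs ^ 2) in E2. unfold Rdiv in E2 at 1.
        rewrite Rmult_assoc, Rinv_l, Rmult_1_r in E2 by (apply pow_nonzero; lra).
        unfold Rdiv in E2 at 1. rewrite Rmult_assoc, Rinv_l, Rmult_1_r in E2 by (apply pow_nonzero; lra).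
        lra. }
      rewrite E3. field. lra.
    + intros [_ [E1 E2]]. split; [exact E1 |]. rewrite E1, <- E2. field. lra.
  - split.
    + intros [E1 E2]. exfalso.
      (* A vanishing radicand forces [beta = gamma = 0], so that [x h] would be stationary. *)
      assert (Hz : beta = 0 /\ gamma = 0).
      { symmetry in Hr. apply sqrt_eq_0 in Hr; [| nra].
        assert (0 < xs ^ 2) by now apply pow_lt.
        assert (0 <= gamma ^ 2 * xs ^ 2) by (apply Rmult_le_pos; [apply pow2_ge_0 | lra]).
        pose proof (pow2_ge_0 beta).
        assert (Hg : gamma ^ 2 * xs ^ 2 = 0) by lra.
        destruct (Rmult_integral _ _ Hg) as [Hg' | Hg']; [| lra].
        split; apply Rsqr_0_uniq; unfold Rsqr; lra. }
      destruct Hz as [-> ->].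
      assert (HB : is_derive (B alpha 0 0) xs (- alpha / xs ^ 2)).
      { apply is_derive_ext with (fun t => alpha / t).
        - intros t. unfold B. replace (0 ^ 2 + 0 ^ 2 * t ^ 2) with 0 by ring. rewrite sqrt_0.
          now rewrite Rplus_0_r.
        - auto_derive; [lra | field; lra]. }
      rewrite (is_derive_unique _ _ _ HB) in E2.
      assert (Er : rad 0 0 xs = 0) by (symmetry; exact Hr). rewrite Er, Rplus_0_r in E1.
      rewrite E1 in E2.
      assert (E3 : sg * ric_D n w xs = 0).
      { apply Rmult_eq_compat_r with (r := xs ^ 2) in E2. unfold Rdiv in E2 at 1.
        rewrite Rmult_assoc, Rinv_l, Rmult_1_r in E2 by (apply pow_nonzero; lra).
        unfold Rdiv in E2 at 1. rewrite Rmult_assoc, Rinv_l, Rmult_1_r in E2 by (apply pow_nonzero; lra).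
        lra. }
      destruct (Rmult_integral _ _ E3) as [E | E]; [| now apply (HD0 xs)].
      rewrite E in Hsg. simpl in Hsg. lra.
    + intros [Hp _]. unfold rad in Hp. lra.
Qed.

Lemma sharp_limit {F : (R -> Prop) -> Prop} {FF : ProperFilter F}
    (u : R -> R -> R -> R -> R) (phi : R -> R) (l l' alpha beta gamma : R) :
  F (fun x => h x / B alpha beta gamma x = phi x / u alpha beta gamma x) ->
  filterlim phi F (locally l) -> filterlim (u alpha beta gamma) F (locally l') -> l <> 0 ->
  (sharp F h alpha beta gamma <-> l' = l).
Proof.
  intros He Hphi Hu Hl. unfold sharp. split.
  - intros H.
    assert (H1 : filterlim (fun x => phi x / u alpha beta gamma x) F (locally 1))
      by now apply (filterlim_ext_loc (fun x => h x / B alpha beta gamma x)).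
    assert (H2 : filterlim phi F (locally (1 * l'))).
    { apply filterlim_ext_loc with (fun x => phi x / u alpha beta gamma x * u alpha beta gamma x);
        [| now apply filterlim_Rmult].
      (* A positive quotient has a nonzero denominator because [/ 0 = 0]. *)
      generalize (filterlim_pos_eventually _ _ 1 0 H1 ltac:(lra)). apply filter_imp.
      intros x Hx. assert (u alpha beta gamma x <> 0); [| field; assumption].
      intros E. rewrite E in Hx. unfold Rdiv in Hx. rewrite Rinv_0 in Hx. lra. }
    rewrite Rmult_1_l in H2.
    exact (filterlim_locally_unique _ _ _ H2 Hphi).
  - intros ->.
    apply (filterlim_ext_loc (fun x => phi x / u alpha beta gamma x)).
    + revert He. apply filter_imp. intros x Hx. now symmetry.
    + eapply filterlim_eq; [apply filterlim_Rdiv; [exact Hphi | exact Hu | exact Hl] |]. now field.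
Qed.

Lemma sharp_0_iff (alpha beta gamma : R) :
  filterlim w (at_right 0) (locally n) -> 0 < nu ->
  sharp (at_right 0) h alpha beta gamma <-> alpha + Rabs beta = 2 * nu.
Proof.
  intros Hw0 Hnu.
  apply (sharp_limit (fun a b c x => a + rad b c x) (fun x => nu + sg * w x)).
  - apply eventually_at_right. intros x Hx. rewrite (Hh x Hx). unfold B.
    (* Where the bound vanishes, both quotients are 0 by the convention [/ 0 = 0]. *)
    fold (rad beta gamma x). destruct (Req_dec (alpha + rad beta gamma x) 0) as [E | E].
    + rewrite E. unfold Rdiv at 2 3. rewrite Rmult_0_l. unfold Rdiv. rewrite Rinv_0. ring.
    + field. split; assumption || lra.
  - eapply filterlim_eq; [lim |]. unfold n. transitivity (nu + sg ^ 2 * nu); [ring |]. rewrite Hsg; ring.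
  - unfold rad. eapply filterlim_eq.
    + apply filterlim_Rplus; [apply filterlim_const |]. apply filterlim_sqrt_fun. lim.
    + f_equal. rewrite <- (sqrt_Rsqr_abs beta). f_equal. unfold Rsqr. simpl. ring.
  - lra.
Qed.

Lemma filterlim_rad_p_infty (beta gamma : R) :
  filterlim (fun x => rad beta gamma x / x) (Rbar_locally p_infty) (locally (Rabs gamma)).
Proof.
  apply filterlim_ext_p_infty with (fun x => sqrt (beta ^ 2 * (/ x) ^ 2 + gamma ^ 2)).
  - intros x Hx. unfold rad.
    replace (beta ^ 2 * (/ x) ^ 2 + gamma ^ 2) with ((beta ^ 2 + gamma ^ 2 * x ^ 2) * (/ x) ^ 2)
      by (field; lra).
    assert (0 < / x) by now apply Rinv_0_lt_compat.
    rewrite sqrt_mult_alt; [rewrite sqrt_pow2 by lra; reflexivity |].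
    pose proof (pow2_ge_0 beta). pose proof (pow2_ge_0 gamma). pose proof (pow2_ge_0 x). nra.
  - eapply filterlim_eq.
    + apply filterlim_sqrt_fun. apply filterlim_Rplus; [apply filterlim_Rmult |]; lim.
    + rewrite <- (sqrt_Rsqr_abs gamma). f_equal. unfold Rsqr. simpl. ring.
Qed.

Lemma sharp_infty_iff (alpha beta gamma : R) :
  filterlim (fun x => w x / x) (Rbar_locally p_infty) (locally sg) ->
  sharp (Rbar_locally p_infty) h alpha beta gamma <-> gamma ^ 2 = 1.
Proof.
  intros Has.
  transitivity (Rabs gamma = 1).
  - apply (sharp_limit B h).
    + apply filter_forall. reflexivity.
    + apply filterlim_ext_p_infty with (fun x => / x * nu + sg * (w x / x)).
      * intros x Hx. rewrite (Hh x Hx). field. lra.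
      * eapply filterlim_eq.
        -- apply filterlim_Rplus; apply filterlim_Rmult; lim.
        -- transitivity (sg ^ 2); [ring | exact Hsg].
    + apply filterlim_ext_p_infty with (fun x => / x * alpha + rad beta gamma x / x).
      * intros x Hx. unfold B. fold (rad beta gamma x). field. lra.
      * eapply filterlim_eq.
        -- apply filterlim_Rplus; [apply filterlim_Rmult; lim | apply filterlim_rad_p_infty].
        -- ring.
    + lra.
  - rewrite <- (pow2_abs gamma). pose proof (Rabs_pos gamma). split; intros E; [rewrite E; ring | nra].
Qed.

Definition lambda0 (x : R) : R := ric_N n w x / ric_M n w x.

Lemma rad_sqr (beta gamma x : R) : rad beta gamma x ^ 2 = beta ^ 2 + gamma ^ 2 * x ^ 2.
Proof. unfold rad. apply pow2_sqrt. pose proof (pow2_ge_0 beta). pose proof (pow2_ge_0 (gamma * x)). nra. Qed.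

(** Put [lam = sg (nu - alpha)]. Sharpness gives [Rabs beta = sg (n + lam)], the value gives
    [rad = sg (w + lam)] and the slope gives [gamma^2]; squaring [rad] then leaves
    [lam * ric_M = ric_N], in which [lam^2] has cancelled. *)
Lemma best_coeffs_0_only (xs alpha beta gamma : R) :
  filterlim w (at_right 0) (locally n) -> 0 < nu -> 0 < xs -> ric_M n w xs <> 0 ->
  best_coeffs (at_right 0) h xs alpha beta gamma ->
  alpha = nu - sg * lambda0 xs /\ beta ^ 2 = (n + lambda0 xs) ^ 2 /\
  gamma ^ 2 = ric_D n w xs * (w xs + lambda0 xs) / xs ^ 2.
Proof.
  intros Hw0 Hnu Hxs HM [Hi Hs].
  apply (sharp_0_iff _ _ _ Hw0 Hnu) in Hs. apply (interpolates_iff _ _ _ _ Hxs) in Hi.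
  destruct Hi as [Hr [E1 E2]]. pose proof (rad_sqr beta gamma xs) as E3.
  rewrite <- (pow2_abs beta) in *.
  set (r := rad beta gamma xs) in *. set (lam := sg * (nu - alpha)).
  assert (Ss : sg * sg = 1) by (rewrite <- Hsg; ring).
  assert (Ea : alpha = nu - sg * lam).
  { unfold lam. rewrite <- Rmult_assoc, Ss. ring. }
  assert (Er : r = sg * (w xs + lam)) by (rewrite Ea in E1; lra).
  assert (Eb : Rabs beta = sg * (n + lam)).
  { rewrite Ea in Hs. unfold n. transitivity (sg * sg * nu + sg * lam); [rewrite Ss; lra | ring]. }
  assert (Eg : gamma ^ 2 = ric_D n w xs * (w xs + lam) / xs ^ 2).
  { apply Rmult_eq_reg_r with (xs ^ 2); [| apply pow_nonzero; lra].
    rewrite <- E2, Er.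
    transitivity (sg * sg * ric_D n w xs * (w xs + lam)); [ring |]. rewrite Ss. field. lra. }
  assert (El : lam * ric_M n w xs = ric_N n w xs).
  { rewrite Eb, Eg, Er in E3. rewrite !Rpow_mult_distr, Hsg in E3.
    replace (ric_D n w xs * (w xs + lam) / xs ^ 2 * xs ^ 2) with (ric_D n w xs * (w xs + lam)) in E3
      by (field; lra).
    unfold ric_M, ric_N. lra. }
  assert (Elam : lam = lambda0 xs) by (unfold lambda0; rewrite <- El; field; exact HM).
  rewrite <- Elam. split; [exact Ea | split; [| exact Eg]].
  rewrite Eb, Rpow_mult_distr, Hsg. ring.
Qed.

Lemma interpolates_0 (xs gamma : R) :
  0 < xs -> ric_M n w xs <> 0 -> 0 < sg * (w xs + lambda0 xs) ->
  gamma ^ 2 = ric_D n w xs * (w xs + lambda0 xs) / xs ^ 2 ->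
  interpolates h xs (nu - sg * lambda0 xs) (nu + sg * lambda0 xs) gamma.
Proof.
  intros Hxs HM Hp Hg. apply interpolates_iff; [exact Hxs |].
  set (lam := lambda0 xs) in *.
  assert (Ss : sg * sg = 1) by (rewrite <- Hsg; ring).
  assert (El : lam * ric_M n w xs = ric_N n w xs).
  { unfold lam, lambda0. field. exact HM. }
  assert (Er : rad (nu + sg * lam) gamma xs = sg * (w xs + lam)).
  { unfold rad. rewrite Hg.
    replace ((nu + sg * lam) ^ 2 + ric_D n w xs * (w xs + lam) / xs ^ 2 * xs ^ 2)
      with ((sg * (w xs + lam)) ^ 2); [apply sqrt_pow2; lra |].
    rewrite Rpow_mult_distr, Hsg.
    replace ((nu + sg * lam) ^ 2) with ((n + lam) ^ 2).
    - replace (ric_D n w xs * (w xs + lam) / xs ^ 2 * xs ^ 2) with (ric_D n w xs * (w xs + lam))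
        by (field; lra).
      unfold ric_M, ric_N in El. lra.
    - unfold n. replace ((sg * nu + lam) ^ 2) with (sg * sg * nu ^ 2 + 2 * sg * nu * lam + lam ^ 2) by ring.
      replace ((nu + sg * lam) ^ 2) with (nu ^ 2 + 2 * sg * nu * lam + sg * sg * lam ^ 2) by ring.
      rewrite Ss. ring. }
  rewrite Er, Hg. split; [exact Hp | split; [ring |]].
  transitivity (sg * sg * ric_D n w xs * (w xs + lam)); [ring |]. rewrite Ss. field. lra.
Qed.

(** Once [gamma^2 = 1], the slope alone fixes [rad = sg x^2 / ric_D]; the value then yields [alpha]
    and the square yields [beta^2]. *)
Lemma best_coeffs_infty_only (xs alpha beta gamma : R) :
  filterlim (fun x => w x / x) (Rbar_locally p_infty) (locally sg) -> 0 < xs ->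
  best_coeffs (Rbar_locally p_infty) h xs alpha beta gamma ->
  alpha = nu - sg * (xs ^ 2 / ric_D n w xs - w xs) /\
  beta ^ 2 = (xs ^ 2 / ric_D n w xs) ^ 2 - xs ^ 2 /\ gamma ^ 2 = 1.
Proof.
  intros Has Hxs [Hi Hs].
  apply (sharp_infty_iff _ _ _ Has) in Hs. apply (interpolates_iff _ _ _ _ Hxs) in Hi.
  destruct Hi as [Hr [E1 E2]]. pose proof (rad_sqr beta gamma xs) as E3.
  rewrite Hs, Rmult_1_l in *. specialize (HD0 xs Hxs).
  assert (Ss : sg * sg = 1) by (rewrite <- Hsg; ring).
  assert (Er : rad beta gamma xs = sg * (xs ^ 2 / ric_D n w xs)).
  { rewrite <- E2. transitivity (sg * sg * rad beta gamma xs); [rewrite Ss; ring | field; exact HD0]. }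
  rewrite Er in *. rewrite Rpow_mult_distr, Hsg in E3. split; [lra | split; [lra | reflexivity]].
Qed.

Lemma interpolates_infty (xs beta : R) :
  0 < xs -> 0 < sg * ric_D n w xs ->
  beta ^ 2 = (xs ^ 2 / ric_D n w xs) ^ 2 - xs ^ 2 ->
  interpolates h xs (nu - sg * (xs ^ 2 / ric_D n w xs - w xs)) beta 1.
Proof.
  intros Hxs Hp Hb. apply interpolates_iff; [exact Hxs |]. specialize (HD0 xs Hxs).
  assert (Ss : sg * sg = 1) by (rewrite <- Hsg; ring).
  assert (Hq : 0 < sg * (xs ^ 2 / ric_D n w xs)).
  { assert (Hs0 : sg <> 0) by (intros E; rewrite E in Ss; lra).
    replace (sg * (xs ^ 2 / ric_D n w xs)) with (sg * sg * (xs ^ 2 / (sg * ric_D n w xs)))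
      by (field; split; assumption).
    rewrite Ss, Rmult_1_l. apply Rdiv_lt_0_compat; [now apply pow_lt | exact Hp]. }
  assert (Er : rad beta 1 xs = sg * (xs ^ 2 / ric_D n w xs)).
  { unfold rad. rewrite Hb.
    replace ((xs ^ 2 / ric_D n w xs) ^ 2 - xs ^ 2 + 1 ^ 2 * xs ^ 2)
      with ((sg * (xs ^ 2 / ric_D n w xs)) ^ 2); [apply sqrt_pow2; lra |].
    rewrite Rpow_mult_distr, Hsg. ring. }
  rewrite Er. split; [exact Hq | split; [ring |]].
  transitivity (sg * sg * (ric_D n w xs * (xs ^ 2 / ric_D n w xs))); [ring |]. rewrite Ss. field. exact HD0.
Qed.

Lemma interpolates_signed (xs mu beta gamma : R) : 0 < xs ->
  interpolates h xs (nu - sg * mu) beta gamma ->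
  w xs = ymod sg (beta ^ 2) (gamma ^ 2) xs - mu /\
  ric_D n w xs * ymod sg (beta ^ 2) (gamma ^ 2) xs = gamma ^ 2 * xs ^ 2 /\ 0 < gamma ^ 2.
Proof.
  intros Hxs Hi. apply (interpolates_iff _ _ _ _ Hxs) in Hi. destruct Hi as [Hr [E1 E2]].
  change (ymod sg (beta ^ 2) (gamma ^ 2) xs) with (sg * rad beta gamma xs).
  set (r := rad beta gamma xs) in *.
  assert (Ss : sg * sg = 1) by (rewrite <- Hsg; ring).
  assert (Hx2 : 0 < xs ^ 2) by now apply pow_lt.
  split; [| split].
  - assert (E : sg * (w xs + mu) = r) by lra. rewrite <- E, <- Rmult_assoc, Ss. ring.
  - rewrite <- E2. ring.
  - pose proof (pow2_ge_0 gamma) as Hg. destruct Hg as [Hg | Hg]; [exact Hg | exfalso].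
    rewrite <- Hg, Rmult_0_l in E2.
    destruct (Rmult_integral _ _ E2) as [E | E]; [| lra].
    destruct (Rmult_integral _ _ E) as [E' | E']; [| now apply (HD0 xs)].
    rewrite E' in Ss. lra.
Qed.

Lemma ratio_minus_B (mu beta gamma x : R) : 0 < x ->
  h x - B (nu - sg * mu) beta gamma x = sg * (w x - (ymod sg (beta ^ 2) (gamma ^ 2) x - mu)) / x.
Proof.
  intros Hx. rewrite (Hh x Hx). unfold B, ymod. fold (rad beta gamma x).
  change (sqrt (beta ^ 2 + gamma ^ 2 * x ^ 2)) with (rad beta gamma x).
  assert (Ss : sg * sg = 1) by (rewrite <- Hsg; ring).
  replace (sg * (w x - (sg * rad beta gamma x - mu))) with (sg * w x - sg * sg * rad beta gamma x + sg * mu) by ring.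
  rewrite Ss. field. lra.
Qed.

End Coefficients.

Lemma lower_touching_intro (f h : R -> R) (xs : R) : f xs = h xs ->
  (forall x, 0 < x -> x <> xs -> 0 < h x - f x) -> lower_bound_touching f h xs.
Proof.
  intros Hxs H x Hx. destruct (Req_dec x xs) as [-> | Hne].
  - split; [lra | split; intros _; [reflexivity | lra]].
  - specialize (H x Hx Hne). split; [lra | split; intros E; [lra | contradiction]].
Qed.

Lemma upper_touching_intro (f h : R -> R) (xs : R) : f xs = h xs ->
  (forall x, 0 < x -> x <> xs -> h x - f x < 0) -> upper_bound_touching f h xs.
Proof.
  intros Hxs H x Hx. destruct (Req_dec x xs) as [-> | Hne].
  - split; [lra | split; intros _; [reflexivity | lra]].
  - specialize (H x Hx Hne). split; [lra | split; intros E; [lra | contradiction]].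
Qed.

(** Tracking the squares keeps the radicand continuous and needs [sqrt] only to be continuous, also
    at 0: for K with [nu = 2] the limiting radicand vanishes as both contact point and sharpness go
    to 0. *)
Lemma best_bound_tends_intro (F G : (R -> Prop) -> Prop) {FG : Filter G} (h : R -> R)
    (fa fb fc : R -> R) (alpha beta gamma : R) :
  (forall xs a b c, 0 < xs -> best_coeffs F h xs a b c ->
     a = fa xs /\ b ^ 2 = fb xs /\ c ^ 2 = fc xs) ->
  G (fun xs => 0 < xs) ->
  filterlim fa G (locally alpha) -> filterlim fb G (locally (beta ^ 2)) ->
  filterlim fc G (locally (gamma ^ 2)) ->
  best_bound_tends F h G (B alpha beta gamma).
Proof.
  intros Hc HG Ha Hb Hg a b c Habc x Hx.
  apply filterlim_ext_loc with (fun xs => (fa xs + sqrt (fb xs + fc xs * x ^ 2)) / x).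
  - revert HG. apply filter_imp. intros xs Hxs.
    destruct (Hc xs _ _ _ Hxs (Habc xs Hxs)) as [Ea [Eb Ec]]. unfold B. now rewrite Ea, Eb, Ec.
  - unfold B. apply filterlim_Rdiv; [| apply filterlim_const | lra].
    apply filterlim_Rplus; [exact Ha |]. apply filterlim_sqrt_fun.
    apply filterlim_Rplus; [exact Hb |]. apply filterlim_Rmult; [exact Hg | apply filterlim_const].
Qed.

Lemma determined_intro (F : (R -> Prop) -> Prop) (h : R -> R) (xs alpha b2 g2 : R) :
  (exists a b c, best_coeffs F h xs a b c) ->
  (forall a b c, best_coeffs F h xs a b c -> a = alpha /\ b ^ 2 = b2 /\ c ^ 2 = g2) ->
  determined F h xs.
Proof.
  intros He Hu. split; [exact He |]. intros a b c a' b' c' H H'.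
  destruct (Hu _ _ _ H) as [-> [-> ->]]. destruct (Hu _ _ _ H') as [-> [-> ->]]. auto.
Qed.

(** * The two families of ratios *)

Lemma one_sqr : 1 ^ 2 = 1.
Proof. ring. Qed.

Lemma opp_one_sqr : (-1) ^ 2 = 1.
Proof. ring. Qed.

Lemma ric_mu_lambda (n : R) (w : R -> R) (x : R) : ric_D n w x <> 0 ->
  x ^ 2 / ric_D n w x - w x = - ric_G (1 / 2) n w x / ric_D n w x + 1 / 2.
Proof. intros H. unfold ric_G. field. exact H. Qed.

(** * Assembly for the first kind *)

Section OrderI.
Variable nu : R.
Hypothesis Hnu : 0 <= nu.
(** Kept unsimplified so as to match [sg * nu] of the shared section at [sg = 1]. *)
Let n := 1 * nu.
Let w (x : R) := phiI nu x - nu.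
Let h := ratioI nu.

Lemma I_n_nonneg : 0 <= n.
Proof. unfold n. lra. Qed.

Lemma I_riccati : riccati n w.
Proof.
  intros x Hx. pose proof (phiI_riccati nu x Hnu Hx) as D1. unfold n, w.
  auto_derive; [eexists; exact D1 |].
  rewrite (is_derive_unique (fun t : R => phiI nu t) x _ D1). field. lra.
Qed.

Lemma I_bounds (x : R) : 0 < x -> n < w x <= n + x ^ 2 / (2 * (n + 1)).
Proof.
  intros Hx. pose proof (phiI_bounds nu x Hnu Hx). unfold n, w. rewrite Rmult_1_l. lra.
Qed.

Lemma I_ratio (x : R) : 0 < x -> h x = (nu + 1 * w x) / x.
Proof. intros Hx. unfold h, w. rewrite (ratioI_phiI nu x Hnu Hx). f_equal. ring. Qed.

Lemma I_at_0 : filterlim w (at_right 0) (locally n).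
Proof. exact (ricI_at_0 n w I_n_nonneg I_bounds). Qed.

Lemma I_D_pos (x : R) : 0 < x -> 0 < ric_D n w x.
Proof. exact (ricI_D_pos n w I_riccati I_n_nonneg I_bounds x). Qed.

Lemma I_D_neq_0 (x : R) : 0 < x -> ric_D n w x <> 0.
Proof. intros Hx. pose proof (I_D_pos x Hx). lra. Qed.

Lemma I_M_neq_0 (x : R) : 0 < x -> ric_M n w x <> 0.
Proof. intros Hx. pose proof (ricI_M_pos n w I_riccati I_n_nonneg I_bounds x Hx). lra. Qed.

Lemma I_lambda0 (x : R) : 0 < x -> 1 / 2 < lambda0 nu 1 w x < 2.
Proof. exact (ricI_lambda0 n w I_riccati I_n_nonneg I_bounds x). Qed.

Lemma I_touch_infty (xs lam beta gamma : R) : 0 < lam -> 0 < xs -> gamma ^ 2 = 1 ->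
  interpolates h xs (nu - 1 * (lam + 1 / 2)) beta gamma ->
  lower_bound_touching (B (nu - 1 * (lam + 1 / 2)) beta gamma) h xs.
Proof.
  intros Hl Hxs Hg Hi. apply lower_touching_intro; [symmetry; apply Hi |].
  intros x Hx Hne.
  rewrite (ratio_minus_B nu 1 w h one_sqr I_ratio _ _ _ x Hx).
  destruct (interpolates_signed nu 1 w h one_sqr I_riccati I_ratio I_D_neq_0 xs _ _ _ Hxs Hi)
    as [H1 [H2 _]].
  rewrite Hg in *. apply Rdiv_lt_0_compat; [| exact Hx]. rewrite Rmult_1_l.
  exact (touchI_infty n w lam xs I_riccati I_n_nonneg I_bounds Hxs (beta ^ 2) Hl
    (pow2_ge_0 beta) H1 H2 x Hx Hne).
Qed.

Lemma I_touch_0 (xs lam beta gamma : R) : 0 < nu + lam -> 0 < xs -> beta ^ 2 = (n + lam) ^ 2 ->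
  interpolates h xs (nu - 1 * lam) beta gamma ->
  upper_bound_touching (B (nu - 1 * lam) beta gamma) h xs.
Proof.
  intros Hl Hxs Hb Hi. apply upper_touching_intro; [symmetry; apply Hi |].
  intros x Hx Hne.
  rewrite (ratio_minus_B nu 1 w h one_sqr I_ratio _ _ _ x Hx).
  destruct (interpolates_signed nu 1 w h one_sqr I_riccati I_ratio I_D_neq_0 xs _ _ _ Hxs Hi)
    as [H1 [H2 H3]].
  rewrite Hb in *.
  assert (Hl' : 0 < n + lam) by (unfold n; lra).
  pose proof (touchI_0 n w lam xs I_riccati I_n_nonneg I_bounds Hxs (gamma ^ 2) Hl' H3 H1 H2 x Hx Hne) as H.
  cbv zeta in H. rewrite Rmult_1_l.
  set (e := w x - (ymod 1 ((n + lam) ^ 2) (gamma ^ 2) x - lam)) in *.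
  assert (0 < - e / x) by (apply Rdiv_lt_0_compat; lra). unfold Rdiv in *. lra.
Qed.

Lemma I_exists_0 (xs : R) : 0 < xs -> exists lam gamma, 1 / 2 < lam < 2 /\
  interpolates h xs (nu - lam) (nu + lam) gamma /\
  (0 < nu -> sharp (at_right 0) h (nu - lam) (nu + lam) gamma).
Proof.
  intros Hxs. pose proof (I_lambda0 xs Hxs) as Hl. pose proof (I_bounds xs Hxs) as Hb.
  pose proof (I_D_pos xs Hxs) as HD. pose proof I_n_nonneg as Hn.
  set (lam := lambda0 nu 1 w xs) in *.
  set (gamma := sqrt (ric_D n w xs * (w xs + lam) / xs ^ 2)).
  assert (Hg : gamma ^ 2 = ric_D n w xs * (w xs + lam) / xs ^ 2).
  { apply pow2_sqrt. apply Rlt_le, Rdiv_lt_0_compat; [| now apply pow_lt].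
    apply Rmult_lt_0_compat; lra. }
  assert (Hp : 0 < 1 * (w xs + lam)) by lra.
  pose proof (interpolates_0 nu 1 w h one_sqr I_riccati I_ratio I_D_neq_0 xs gamma Hxs
    (I_M_neq_0 xs Hxs) Hp Hg) as Hi.
  fold lam in Hi. rewrite !Rmult_1_l in Hi.
  exists lam, gamma. split; [exact Hl | split; [exact Hi |]].
  intros Hnu'. apply (sharp_0_iff nu 1 w h one_sqr I_ratio); [exact I_at_0 | exact Hnu' |].
  rewrite Rabs_right; lra.
Qed.

Lemma I_best_0_only (xs alpha beta gamma : R) : 0 < nu -> 0 < xs ->
  best_coeffs (at_right 0) h xs alpha beta gamma ->
  alpha = nu - 1 * lambda0 nu 1 w xs /\ beta ^ 2 = (n + lambda0 nu 1 w xs) ^ 2 /\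
  gamma ^ 2 = ric_D n w xs * (w xs + lambda0 nu 1 w xs) / xs ^ 2.
Proof.
  intros Hnu' Hxs. apply (best_coeffs_0_only nu 1 w h one_sqr I_riccati I_ratio I_D_neq_0); auto.
  - exact I_at_0.
  - now apply I_M_neq_0.
Qed.

Hypothesis Hnu2 : 1 / 2 <= nu.

Lemma I_n_half : 1 / 2 <= n.
Proof. unfold n. lra. Qed.

Lemma I_asymptotic : filterlim (fun x => w x / x) (Rbar_locally p_infty) (locally 1).
Proof. exact (ricI_asymptotic n w I_riccati I_n_nonneg I_bounds I_n_half). Qed.

Lemma I_F_lim : filterlim (ric_F n w) (Rbar_locally p_infty) (locally 0).
Proof.
  apply (ode_damped_tends_0 _ _ _ (ode_F n w I_riccati)); [apply ric_F_source |].
  apply filterlim_ext_p_infty with (fun x => -2 * (w x + - (1 / 2)) / x).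
  - intros x Hx. field. lra.
  - eapply filterlim_eq; [apply ric_damping_lim, I_asymptotic | ring].
Qed.

Lemma I_G_lim : filterlim (ric_G (1 / 2) n w) (Rbar_locally p_infty) (locally 0).
Proof.
  apply (ode_damped_tends_0 _ _ _ (ode_G n w I_riccati (1 / 2))).
  - apply (ric_G_source n w 1 I_asymptotic I_F_lim).
  - apply filterlim_ext_p_infty with (fun x => -2 * (w x + - (1 / 2)) / x).
    + intros x Hx. field. lra.
    + eapply filterlim_eq; [apply ric_damping_lim, I_asymptotic | ring].
Qed.

Lemma I_lambda_infty (x : R) : 0 < x -> 0 < - ric_G (1 / 2) n w x / ric_D n w x < 1 / 2.
Proof.
  intros Hx. pose proof (I_D_pos x Hx) as HD.
  pose proof (ricI_G_half_neg n w I_riccati I_n_nonneg I_bounds x I_n_half Hx) as H1.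
  pose proof (ricI_G_1_pos n w I_riccati I_n_nonneg I_bounds x Hx) as H2.
  assert (E1 : ric_G 1 n w x = ric_G (1 / 2) n w x + ric_D n w x / 2) by (unfold ric_G; field).
  split; [apply Rdiv_lt_0_compat; lra |].
  apply Rmult_lt_reg_r with (ric_D n w x); [exact HD |]. unfold Rdiv.
  rewrite Rmult_assoc, Rinv_l by lra. lra.
Qed.

Lemma I_exists_infty (xs : R) : 0 < xs -> exists lam beta, 0 < lam < 1 / 2 /\
  best_coeffs (Rbar_locally p_infty) h xs (nu - 1 / 2 - lam) beta 1.
Proof.
  intros Hxs. pose proof (I_D_pos xs Hxs) as HD.
  pose proof (ricI_D_lt_id n w I_riccati I_n_nonneg I_bounds xs I_n_half Hxs) as HD'.
  exists (- ric_G (1 / 2) n w xs / ric_D n w xs).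
  set (b2 := (xs ^ 2 / ric_D n w xs) ^ 2 - xs ^ 2).
  (* From [ric_D < x] follows [x^2 / ric_D >= x], so a real [beta] exists. *)
  assert (Hb2 : 0 <= b2).
  { unfold b2. assert (L : xs <= xs ^ 2 / ric_D n w xs).
    { apply Rmult_le_reg_r with (ric_D n w xs); [exact HD |]. unfold Rdiv.
      rewrite Rmult_assoc, Rinv_l by lra. nra. }
    nra. }
  exists (sqrt b2). split; [now apply I_lambda_infty |].
  replace (nu - 1 / 2 - - ric_G (1 / 2) n w xs / ric_D n w xs)
    with (nu - 1 * (xs ^ 2 / ric_D n w xs - w xs))
    by (rewrite ric_mu_lambda by lra; ring).
  split.
  - apply (interpolates_infty nu 1 w h one_sqr I_riccati I_ratio I_D_neq_0 xs (sqrt b2) Hxs).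
    + fold n. lra.
    + now apply pow2_sqrt.
  - apply (sharp_infty_iff nu 1 w h one_sqr I_ratio _ _ _ I_asymptotic). ring.
Qed.

Lemma I_best_infty_only (xs alpha beta gamma : R) : 0 < xs ->
  best_coeffs (Rbar_locally p_infty) h xs alpha beta gamma ->
  alpha = nu - 1 * (xs ^ 2 / ric_D n w xs - w xs) /\
  beta ^ 2 = (xs ^ 2 / ric_D n w xs) ^ 2 - xs ^ 2 /\ gamma ^ 2 = 1.
Proof.
  intros Hxs.
  apply (best_coeffs_infty_only nu 1 w h one_sqr I_riccati I_ratio I_D_neq_0); auto.
  exact I_asymptotic.
Qed.

Lemma I_worst_case (xs : R) : 0 < xs ->
  determined (Rbar_locally p_infty) h xs /\ determined (at_right 0) h xs /\
  (forall alpha beta gamma, best_coeffs (Rbar_locally p_infty) h xs alpha beta gamma ->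
     lower_bound_touching (B alpha beta gamma) h xs) /\
  (forall alpha beta gamma, best_coeffs (at_right 0) h xs alpha beta gamma ->
     upper_bound_touching (B alpha beta gamma) h xs).
Proof.
  intros Hxs. assert (Hp : 0 < nu) by lra. split; [| split; [| split]].
  - eapply determined_intro; [| intros a b c H; exact (I_best_infty_only xs a b c Hxs H)].
    destruct (I_exists_infty xs Hxs) as [lam [beta [_ H]]]. now eexists _, _, _; exact H.
  - eapply determined_intro; [| intros a b c H; exact (I_best_0_only xs a b c Hp Hxs H)].
    destruct (I_exists_0 xs Hxs) as [lam [gamma [_ [H1 H2]]]].
    exists (nu - lam), (nu + lam), gamma. split; [exact H1 | exact (H2 Hp)].
  - intros alpha beta gamma H.
    destruct (I_best_infty_only xs _ _ _ Hxs H) as [Ea [_ Eg]].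
    rewrite (ric_mu_lambda n w xs (I_D_neq_0 xs Hxs)) in Ea. rewrite Ea in *.
    apply I_touch_infty; [now apply I_lambda_infty | exact Hxs | exact Eg | apply H].
  - intros alpha beta gamma H.
    destruct (I_best_0_only xs _ _ _ Hp Hxs H) as [Ea [Eb _]]. rewrite Ea in *.
    pose proof (I_lambda0 xs Hxs).
    apply I_touch_0; [lra | exact Hxs | exact Eb | apply H].
Qed.

Lemma I_limits :
  best_bound_tends (at_right 0) h (at_right 0)
    (B (nu - 2) (nu + 2) (sqrt ((nu + 2) / (nu + 1)))) /\
  best_bound_tends (at_right 0) h (Rbar_locally p_infty)
    (B (nu - 1 / 2) (nu + 1 / 2) 1) /\
  best_bound_tends (Rbar_locally p_infty) h (at_right 0)
    (B (nu - 1) (nu + 1) 1) /\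
  best_bound_tends (Rbar_locally p_infty) h (Rbar_locally p_infty)
    (B (nu - 1 / 2) (sqrt (nu ^ 2 - 1 / 4)) 1).
Proof.
  assert (Hp : 0 < nu) by lra.
  assert (Hn1 : n + 1 <> 0) by (unfold n; lra).
  assert (Z1 : forall x, 0 < x -> phiI (nu + 1) x <> 0)
    by (intros x Hx; pose proof (phiI_pos (nu + 1) x ltac:(lra) Hx); lra).
  assert (Z2 : forall x, 0 < x -> phiI (nu + 2) x <> 0)
    by (intros x Hx; pose proof (phiI_pos (nu + 2) x ltac:(lra) Hx); lra).
  assert (Zw : forall x, 0 < x -> w x = n + x ^ 2 / phiI (nu + 1) x)
    by (intros x Hx; unfold w, n; rewrite (phiI_fraction nu x Hnu Hx); ring).
  assert (Z12 : forall x, 0 < x -> phiI (nu + 1) x = 2 * (n + 1) + x ^ 2 / phiI (nu + 2) x).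
  { intros x Hx. rewrite (phiI_fraction (nu + 1) x ltac:(lra) Hx) at 1.
    replace (nu + 1 + 1) with (nu + 2) by ring. unfold n. ring. }
  assert (L1 : filterlim (phiI (nu + 1)) (at_right 0) (locally (2 * (n + 1)))).
  { eapply filterlim_eq; [apply phiI_at_0; lra | unfold n; ring]. }
  assert (L2 : filterlim (phiI (nu + 2)) (at_right 0) (locally (2 * (n + 2)))).
  { eapply filterlim_eq; [apply phiI_at_0; lra | unfold n; ring]. }
  split; [| split; [| split]].
  - eapply best_bound_tends_intro.
    + exact _.
    + intros xs a b c Hxs H. exact (I_best_0_only xs a b c Hp Hxs H).
    + apply at_right_pos.
    + pose proof (ric_lambda_at_zero n w _ _ Hn1 Z1 Z2 Zw Z12 L1 L2 I_M_neq_0) as HL.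
      eapply filterlim_eq; [lim |]. ring.
    + pose proof (ric_lambda_at_zero n w _ _ Hn1 Z1 Z2 Zw Z12 L1 L2 I_M_neq_0) as HL.
      eapply filterlim_eq; [lim |]. unfold n. simpl. ring.
    + rewrite pow2_sqrt by (apply Rlt_le, Rdiv_lt_0_compat; lra).
      eapply filterlim_eq; [exact (ric_g2_at_zero n w _ _ Hn1 Z1 Z2 Zw Z12 L1 L2 I_M_neq_0) |].
      unfold n. now rewrite Rmult_1_l.
  - assert (HL := ric_lambda_at_infinity n w 1 I_asymptotic I_F_lim one_sqr I_M_neq_0).
    eapply best_bound_tends_intro.
    + exact _.
    + intros xs a b c Hxs H. exact (I_best_0_only xs a b c Hp Hxs H).
    + apply p_infty_gt.
    + eapply filterlim_eq; [lim |]. ring.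
    + eapply filterlim_eq; [lim |]. unfold n. simpl. ring.
    + eapply filterlim_eq; [exact (ric_g2_at_infinity n w 1 I_asymptotic I_F_lim one_sqr I_M_neq_0) |]. ring.
  - eapply best_bound_tends_intro.
    + exact _.
    + intros xs a b c Hxs H. exact (I_best_infty_only xs a b c Hxs H).
    + apply at_right_pos.
    + pose proof (ric_mu_at_zero n w _ Hn1 Z1 Zw L1 I_D_neq_0) as HL.
      eapply filterlim_eq; [lim |]. ring.
    + eapply filterlim_eq; [exact (ric_b2_at_zero n w _ Hn1 Z1 Zw L1 I_D_neq_0) |]. unfold n. simpl. ring.
    + eapply filterlim_eq; [lim |]. ring.
  - eapply best_bound_tends_intro.
    + exact _.
    + intros xs a b c Hxs H. exact (I_best_infty_only xs a b c Hxs H).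
    + apply p_infty_gt.
    + pose proof (ric_mu_at_infinity n w 1 I_asymptotic I_F_lim one_sqr I_G_lim I_D_neq_0) as HL.
      eapply filterlim_eq; [lim |]. ring.
    + rewrite pow2_sqrt by nra.
      eapply filterlim_eq; [exact (ric_b2_at_infinity n w 1 I_asymptotic I_F_lim one_sqr I_G_lim I_D_neq_0) |].
      unfold n. ring.
    + eapply filterlim_eq; [lim |]. ring.
Qed.

End OrderI.

(** * Assembly for the second kind *)

Section OrderK.
Variable nu : R.
Hypothesis Hnu : 1 / 2 < nu.
Let n := -1 * nu.
Let w (x : R) := nu - psiK nu x.
Let h := ratioK nu.

Lemma K_n_lt : n < - (1 / 2).
Proof. unfold n. lra. Qed.

Lemma K_riccati : riccati n w.
Proof.
  intros x Hx. pose proof (psiK_riccati nu x Hx) as D1. unfold n, w.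
  auto_derive; [eexists; exact D1 |].
  rewrite (is_derive_unique (fun t : R => psiK nu t) x _ D1). field. lra.
Qed.

Lemma K_bounds (x : R) : 0 < x -> n - x <= w x < n.
Proof.
  intros Hx. pose proof (psiK_gt nu x Hx). pose proof (psiK_le nu x ltac:(lra) Hx).
  unfold n, w. lra.
Qed.

Lemma K_bounds' (x : R) : 0 < x -> w x <= - n - x.
Proof. intros Hx. pose proof (psiK_ge nu x ltac:(lra) Hx). unfold n, w. lra. Qed.

Lemma K_ratio (x : R) : 0 < x -> h x = (nu + -1 * w x) / x.
Proof. intros Hx. unfold h, w. rewrite (ratioK_psiK nu x Hx). f_equal. ring. Qed.

Lemma K_at_0 : filterlim w (at_right 0) (locally n).
Proof. exact (ricK_at_0 n w K_bounds). Qed.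

Lemma K_D_neg (x : R) : 0 < x -> ric_D n w x < 0.
Proof. exact (ricK_D_neg n w K_riccati K_n_lt K_bounds K_bounds' x). Qed.

Lemma K_D_neq_0 (x : R) : 0 < x -> ric_D n w x <> 0.
Proof. intros Hx. pose proof (K_D_neg x Hx). lra. Qed.

Lemma K_M_neq_0 (x : R) : 0 < x -> ric_M n w x <> 0.
Proof. intros Hx. pose proof (ricK_M_neg n w K_riccati K_n_lt K_bounds K_bounds' x Hx). lra. Qed.

Lemma K_touch_infty (xs lam beta gamma : R) : 0 < lam -> 0 < xs -> gamma ^ 2 = 1 ->
  interpolates h xs (nu - -1 * (lam + 1 / 2)) beta gamma ->
  upper_bound_touching (B (nu - -1 * (lam + 1 / 2)) beta gamma) h xs.
Proof.
  intros Hl Hxs Hg Hi. apply upper_touching_intro; [symmetry; apply Hi |].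
  intros x Hx Hne.
  rewrite (ratio_minus_B nu (-1) w h opp_one_sqr K_ratio _ _ _ x Hx).
  destruct (interpolates_signed nu (-1) w h opp_one_sqr K_riccati K_ratio K_D_neq_0 xs _ _ _ Hxs Hi)
    as [H1 [H2 _]].
  rewrite Hg in *.
  pose proof (touchK_infty n w lam xs K_riccati K_n_lt K_bounds K_bounds' Hxs (beta ^ 2) Hl
    (pow2_ge_0 beta) H1 H2 x Hx Hne) as H.
  cbv zeta in H.
  set (e := w x - (ymod (-1) (beta ^ 2) 1 x - (lam + 1 / 2))) in *.
  assert (0 < e / x) by (apply Rdiv_lt_0_compat; lra). unfold Rdiv in *. lra.
Qed.

Lemma K_touch_0 (xs lam beta gamma : R) : 1 / 2 < lam <= nu -> 0 < xs ->
  beta ^ 2 = (n + lam) ^ 2 ->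
  interpolates h xs (nu - -1 * lam) beta gamma ->
  lower_bound_touching (B (nu - -1 * lam) beta gamma) h xs.
Proof.
  intros Hl Hxs Hb Hi. apply lower_touching_intro; [symmetry; apply Hi |].
  intros x Hx Hne.
  rewrite (ratio_minus_B nu (-1) w h opp_one_sqr K_ratio _ _ _ x Hx).
  destruct (interpolates_signed nu (-1) w h opp_one_sqr K_riccati K_ratio K_D_neq_0 xs _ _ _ Hxs Hi)
    as [H1 [H2 H3]].
  rewrite Hb in *.
  assert (Hl' : n + lam <= 0) by (unfold n; lra).
  pose proof (touchK_0 n w lam xs K_riccati K_n_lt K_bounds K_bounds' Hxs (gamma ^ 2)
    ltac:(lra) Hl' H3 H1 H2 x Hx Hne) as H.
  cbv zeta in H. apply Rdiv_lt_0_compat; [| exact Hx]. fold n in H |- *. lra.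
Qed.

Lemma K_asymptotic : filterlim (fun x => w x / x) (Rbar_locally p_infty) (locally (-1)).
Proof. exact (ricK_asymptotic n w K_bounds K_bounds'). Qed.

Lemma K_F_lim : filterlim (ric_F n w) (Rbar_locally p_infty) (locally 0).
Proof.
  apply (ode_antidamped_tends_0 _ _ _ (2 * (1 - n) ^ 2 + (2 - n)) (ode_F n w K_riccati)).
  - apply ric_F_source.
  - apply filterlim_ext_p_infty with (fun x => -2 * (w x + - (1 / 2)) / x).
    + intros x Hx. field. lra.
    + eapply filterlim_eq; [apply ric_damping_lim, K_asymptotic | ring].
  - generalize (p_infty_gt 1). apply filter_imp. intros x Hx.
    apply (ricK_F_abs n w K_n_lt K_bounds). lra.
Qed.

Lemma K_G_lim : filterlim (ric_G (1 / 2) n w) (Rbar_locally p_infty) (locally 0).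
Proof.
  eapply (ode_antidamped_tends_0 _ _ _ _ (ode_G n w K_riccati (1 / 2))).
  - apply (ric_G_source n w (-1) K_asymptotic K_F_lim).
  - apply filterlim_ext_p_infty with (fun x => -2 * (w x + - (1 / 2)) / x).
    + intros x Hx. field. lra.
    + eapply filterlim_eq; [apply ric_damping_lim, K_asymptotic | ring].
  - generalize (p_infty_gt 1). apply filter_imp. intros x Hx.
    apply (ricK_G_abs n w K_n_lt K_bounds). lra.
Qed.

Lemma K_lambda_infty (x : R) : 0 < x ->
  0 < - ric_G (1 / 2) n w x / ric_D n w x < Rmin (1 / 2) (nu - 1 / 2).
Proof.
  intros Hx. replace (nu - 1 / 2) with (- n - 1 / 2) by (unfold n; ring).
  exact (ricK_lambda_infty n w K_riccati K_n_lt K_bounds K_bounds' x Hx).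
Qed.

Lemma K_exists_infty (xs : R) : 0 < xs ->
  exists lam beta, 0 < lam < Rmin (1 / 2) (nu - 1 / 2) /\
  best_coeffs (Rbar_locally p_infty) h xs (nu + 1 / 2 + lam) beta 1.
Proof.
  intros Hxs. pose proof (K_D_neg xs Hxs) as HD.
  pose proof (ricK_D_gt_opp n w K_riccati K_n_lt K_bounds K_bounds' xs Hxs) as HD'.
  exists (- ric_G (1 / 2) n w xs / ric_D n w xs).
  set (b2 := (xs ^ 2 / ric_D n w xs) ^ 2 - xs ^ 2).
  assert (Hb2 : 0 <= b2).
  { unfold b2. assert (L : xs <= xs ^ 2 / - ric_D n w xs).
    { apply Rmult_le_reg_r with (- ric_D n w xs); [lra |]. unfold Rdiv.
      rewrite Rmult_assoc, Rinv_l by lra. nra. }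
    replace (xs ^ 2 / ric_D n w xs) with (- (xs ^ 2 / - ric_D n w xs)) by (field; lra). nra. }
  exists (sqrt b2). split; [now apply K_lambda_infty |].
  replace (nu + 1 / 2 + - ric_G (1 / 2) n w xs / ric_D n w xs)
    with (nu - -1 * (xs ^ 2 / ric_D n w xs - w xs))
    by (rewrite ric_mu_lambda by lra; ring).
  split.
  - apply (interpolates_infty nu (-1) w h opp_one_sqr K_riccati K_ratio K_D_neq_0 xs (sqrt b2) Hxs).
    + fold n. lra.
    + now apply pow2_sqrt.
  - apply (sharp_infty_iff nu (-1) w h opp_one_sqr K_ratio _ _ _ K_asymptotic). ring.
Qed.

Lemma K_best_infty_only (xs alpha beta gamma : R) : 0 < xs ->
  best_coeffs (Rbar_locally p_infty) h xs alpha beta gamma ->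
  alpha = nu - -1 * (xs ^ 2 / ric_D n w xs - w xs) /\
  beta ^ 2 = (xs ^ 2 / ric_D n w xs) ^ 2 - xs ^ 2 /\ gamma ^ 2 = 1.
Proof.
  intros Hxs.
  apply (best_coeffs_infty_only nu (-1) w h opp_one_sqr K_riccati K_ratio K_D_neq_0); auto.
  exact K_asymptotic.
Qed.

Lemma K_best_0_only (xs alpha beta gamma : R) : 0 < xs ->
  best_coeffs (at_right 0) h xs alpha beta gamma ->
  alpha = nu - -1 * lambda0 nu (-1) w xs /\ beta ^ 2 = (n + lambda0 nu (-1) w xs) ^ 2 /\
  gamma ^ 2 = ric_D n w xs * (w xs + lambda0 nu (-1) w xs) / xs ^ 2.
Proof.
  intros Hxs.
  apply (best_coeffs_0_only nu (-1) w h opp_one_sqr K_riccati K_ratio K_D_neq_0).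
  - exact K_at_0.
  - lra.
  - exact Hxs.
  - now apply K_M_neq_0.
Qed.

Hypothesis Hnu2 : 2 <= nu.

Lemma K_n_le : n <= -2.
Proof. unfold n. lra. Qed.

Lemma K_lambda0 (x : R) : 0 < x -> 1 / 2 < lambda0 nu (-1) w x < 2.
Proof. exact (ricK_lambda0 n w K_riccati K_n_lt K_bounds K_bounds' K_n_le x). Qed.

Lemma K_exists_0 (xs : R) : 0 < xs -> exists lam gamma, 1 / 2 < lam < 2 /\
  best_coeffs (at_right 0) h xs (nu + lam) (nu - lam) gamma.
Proof.
  intros Hxs. pose proof (K_lambda0 xs Hxs) as Hl. pose proof (K_bounds xs Hxs) as Hb.
  pose proof (K_D_neg xs Hxs) as HD. pose proof K_n_le as Hn.
  set (lam := lambda0 nu (-1) w xs) in *.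
  set (gamma := sqrt (ric_D n w xs * (w xs + lam) / xs ^ 2)).
  assert (Hg : gamma ^ 2 = ric_D n w xs * (w xs + lam) / xs ^ 2).
  { apply pow2_sqrt. apply Rlt_le, Rdiv_lt_0_compat; [| now apply pow_lt]. nra. }
  assert (Hp : 0 < -1 * (w xs + lam)) by lra.
  pose proof (interpolates_0 nu (-1) w h opp_one_sqr K_riccati K_ratio K_D_neq_0 xs gamma Hxs
    (K_M_neq_0 xs Hxs) Hp Hg) as Hi.
  fold lam in Hi.
  replace (nu - -1 * lam) with (nu + lam) in Hi by ring.
  replace (nu + -1 * lam) with (nu - lam) in Hi by ring.
  exists lam, gamma. split; [exact Hl | split; [exact Hi |]].
  apply (sharp_0_iff nu (-1) w h opp_one_sqr K_ratio); [exact K_at_0 | lra |].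
  rewrite Rabs_right; lra.
Qed.

Lemma K_worst_case (xs : R) : 0 < xs ->
  determined (at_right 0) h xs /\ determined (Rbar_locally p_infty) h xs /\
  (forall alpha beta gamma, best_coeffs (at_right 0) h xs alpha beta gamma ->
     lower_bound_touching (B alpha beta gamma) h xs) /\
  (forall alpha beta gamma, best_coeffs (Rbar_locally p_infty) h xs alpha beta gamma ->
     upper_bound_touching (B alpha beta gamma) h xs).
Proof.
  intros Hxs. split; [| split; [| split]].
  - eapply determined_intro; [| intros a b c H; exact (K_best_0_only xs a b c Hxs H)].
    destruct (K_exists_0 xs Hxs) as [lam [gamma [_ H]]]. now eexists _, _, _; exact H.
  - eapply determined_intro; [| intros a b c H; exact (K_best_infty_only xs a b c Hxs H)].
    destruct (K_exists_infty xs Hxs) as [lam [beta [_ H]]]. now eexists _, _, _; exact H.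
  - intros alpha beta gamma H.
    destruct (K_best_0_only xs _ _ _ Hxs H) as [Ea [Eb _]]. rewrite Ea in *.
    pose proof (K_lambda0 xs Hxs).
    apply K_touch_0; [lra | exact Hxs | exact Eb | apply H].
  - intros alpha beta gamma H.
    destruct (K_best_infty_only xs _ _ _ Hxs H) as [Ea [_ Eg]].
    rewrite (ric_mu_lambda n w xs (K_D_neq_0 xs Hxs)) in Ea. rewrite Ea in *.
    apply K_touch_infty; [now apply K_lambda_infty | exact Hxs | exact Eg | apply H].
Qed.

Lemma K_limits :
  best_bound_tends (at_right 0) h (at_right 0)
    (B (nu + 2) (nu - 2) (sqrt ((nu - 2) / (nu - 1)))) /\
  best_bound_tends (at_right 0) h (Rbar_locally p_infty)
    (B (nu + 1 / 2) (nu - 1 / 2) 1) /\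
  best_bound_tends (Rbar_locally p_infty) h (at_right 0)
    (B (nu + 1) (nu - 1) 1) /\
  best_bound_tends (Rbar_locally p_infty) h (Rbar_locally p_infty)
    (B (nu + 1 / 2) (sqrt (nu ^ 2 - 1 / 4)) 1).
Proof.
  assert (Hn1 : n + 1 <> 0) by (unfold n; lra).
  (* The signs follow from [w = nu - psi] and [n = - nu]; the order [nu - 2 >= 0] is within reach of
     [psiK_at_0]. *)
  set (z1 := fun x => - psiK (nu - 1) x). set (z2 := fun x => - psiK (nu - 2) x).
  assert (Z1 : forall x, 0 < x -> z1 x <> 0)
    by (intros x Hx; pose proof (psiK_pos (nu - 1) x Hx); unfold z1; lra).
  assert (Z2 : forall x, 0 < x -> z2 x <> 0)
    by (intros x Hx; pose proof (psiK_pos (nu - 2) x Hx); unfold z2; lra).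
  assert (Zw : forall x, 0 < x -> w x = n + x ^ 2 / z1 x).
  { intros x Hx. unfold w, n, z1. rewrite (psiK_fraction nu x Hx).
    pose proof (psiK_pos (nu - 1) x Hx). field. lra. }
  assert (Z12 : forall x, 0 < x -> z1 x = 2 * (n + 1) + x ^ 2 / z2 x).
  { intros x Hx. unfold z1, z2, n. rewrite (psiK_fraction (nu - 1) x Hx) at 1.
    replace (nu - 1 - 1) with (nu - 2) by ring.
    pose proof (psiK_pos (nu - 2) x Hx). field. lra. }
  assert (L1 : filterlim z1 (at_right 0) (locally (2 * (n + 1)))).
  { eapply filterlim_eq; [apply filterlim_Ropp, psiK_at_0; lra | unfold n; ring]. }
  assert (L2 : filterlim z2 (at_right 0) (locally (2 * (n + 2)))).
  { eapply filterlim_eq; [apply filterlim_Ropp, psiK_at_0; lra | unfold n; ring]. }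
  split; [| split; [| split]].
  - pose proof (ric_lambda_at_zero n w _ _ Hn1 Z1 Z2 Zw Z12 L1 L2 K_M_neq_0) as HL.
    eapply best_bound_tends_intro.
    + exact _.
    + intros xs a b c Hxs H. exact (K_best_0_only xs a b c Hxs H).
    + apply at_right_pos.
    + eapply filterlim_eq; [lim |]. ring.
    + eapply filterlim_eq; [lim |]. unfold n. simpl. ring.
    + rewrite pow2_sqrt by (apply Rmult_le_pos; [lra | apply Rlt_le, Rinv_0_lt_compat; lra]).
      eapply filterlim_eq; [exact (ric_g2_at_zero n w _ _ Hn1 Z1 Z2 Zw Z12 L1 L2 K_M_neq_0) |].
      unfold n. field. lra.
  - assert (HL := ric_lambda_at_infinity n w (-1) K_asymptotic K_F_lim opp_one_sqr K_M_neq_0).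
    eapply best_bound_tends_intro.
    + exact _.
    + intros xs a b c Hxs H. exact (K_best_0_only xs a b c Hxs H).
    + apply p_infty_gt.
    + eapply filterlim_eq; [lim |]. ring.
    + eapply filterlim_eq; [lim |]. unfold n. simpl. ring.
    + eapply filterlim_eq; [exact (ric_g2_at_infinity n w (-1) K_asymptotic K_F_lim opp_one_sqr K_M_neq_0) |]. ring.
  - eapply best_bound_tends_intro.
    + exact _.
    + intros xs a b c Hxs H. exact (K_best_infty_only xs a b c Hxs H).
    + apply at_right_pos.
    + pose proof (ric_mu_at_zero n w _ Hn1 Z1 Zw L1 K_D_neq_0) as HL.
      eapply filterlim_eq; [lim |]. ring.
    + eapply filterlim_eq; [exact (ric_b2_at_zero n w _ Hn1 Z1 Zw L1 K_D_neq_0) |]. unfold n. simpl. ring.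
    + eapply filterlim_eq; [lim |]. ring.
  - eapply best_bound_tends_intro.
    + exact _.
    + intros xs a b c Hxs H. exact (K_best_infty_only xs a b c Hxs H).
    + apply p_infty_gt.
    + pose proof (ric_mu_at_infinity n w (-1) K_asymptotic K_F_lim opp_one_sqr K_G_lim K_D_neq_0) as HL.
      eapply filterlim_eq; [lim |]. ring.
    + rewrite pow2_sqrt by nra.
      eapply filterlim_eq; [exact (ric_b2_at_infinity n w (-1) K_asymptotic K_F_lim opp_one_sqr K_G_lim K_D_neq_0) |].
      unfold n. ring.
    + eapply filterlim_eq; [lim |]. ring.
Qed.

End OrderK.

Theorem theorem14 :
  (* the bounds, for all x_*, in the worst-case ranges of nu *)
  (forall nu xs : R, 1 / 2 <= nu -> 0 < xs ->
     determined (Rbar_locally p_infty) (ratioI nu) xs /\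
     determined (at_right 0) (ratioI nu) xs /\
     (forall alpha beta gamma,
        best_coeffs (Rbar_locally p_infty) (ratioI nu) xs alpha beta gamma ->
        lower_bound_touching (B alpha beta gamma) (ratioI nu) xs) /\
     (forall alpha beta gamma,
        best_coeffs (at_right 0) (ratioI nu) xs alpha beta gamma ->
        upper_bound_touching (B alpha beta gamma) (ratioI nu) xs)) /\
  (forall nu xs : R, 2 <= nu -> 0 < xs ->
     determined (at_right 0) (ratioK nu) xs /\
     determined (Rbar_locally p_infty) (ratioK nu) xs /\
     (forall alpha beta gamma,
        best_coeffs (at_right 0) (ratioK nu) xs alpha beta gamma ->
        lower_bound_touching (B alpha beta gamma) (ratioK nu) xs) /\
     (forall alpha beta gamma,
        best_coeffs (Rbar_locally p_infty) (ratioK nu) xs alpha beta gamma ->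
        upper_bound_touching (B alpha beta gamma) (ratioK nu) xs)) /\
  (* lower bound for I: nu >= 1/2 - lam *)
  (forall nu lam xs beta : R,
     0 < lam < 1 / 2 -> 1 / 2 - lam <= nu -> 0 < xs ->
     best_coeffs (Rbar_locally p_infty) (ratioI nu) xs
       (nu - 1 / 2 - lam) beta 1 ->
     lower_bound_touching (B (nu - 1 / 2 - lam) beta 1) (ratioI nu) xs) /\
  (forall nu xs : R, 1 / 2 <= nu -> 0 < xs ->
     exists lam beta, 0 < lam < 1 / 2 /\
       best_coeffs (Rbar_locally p_infty) (ratioI nu) xs
         (nu - 1 / 2 - lam) beta 1) /\
  (* upper bound for I: nu >= 0; at nu = 0 the sharpness condition at 0+
     is replaced by the form alpha = nu - lam, beta = nu + lam *)
  (forall nu lam xs gamma : R,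
     1 / 2 < lam < 2 -> 0 <= nu -> 0 < xs ->
     interpolates (ratioI nu) xs (nu - lam) (nu + lam) gamma ->
     (0 < nu -> sharp (at_right 0) (ratioI nu) (nu - lam) (nu + lam) gamma) ->
     upper_bound_touching (B (nu - lam) (nu + lam) gamma) (ratioI nu) xs) /\
  (forall nu xs : R, 0 <= nu -> 0 < xs ->
     exists lam gamma, 1 / 2 < lam < 2 /\
       interpolates (ratioI nu) xs (nu - lam) (nu + lam) gamma /\
       (0 < nu ->
        sharp (at_right 0) (ratioI nu) (nu - lam) (nu + lam) gamma)) /\
  (* upper bound for K: nu > 1/2 *)
  (forall nu lam xs beta : R,
     1 / 2 < nu -> 0 < lam < Rmin (1 / 2) (nu - 1 / 2) -> 0 < xs ->
     best_coeffs (Rbar_locally p_infty) (ratioK nu) xs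
       (nu + 1 / 2 + lam) beta 1 ->
     upper_bound_touching (B (nu + 1 / 2 + lam) beta 1) (ratioK nu) xs) /\
  (forall nu xs : R, 1 / 2 < nu -> 0 < xs ->
     exists lam beta, 0 < lam < Rmin (1 / 2) (nu - 1 / 2) /\
       best_coeffs (Rbar_locally p_infty) (ratioK nu) xs
         (nu + 1 / 2 + lam) beta 1) /\
  (* lower bound for K: nu >= lam *)
  (forall nu lam xs gamma : R,
     1 / 2 < lam < 2 -> lam <= nu -> 0 < xs ->
     best_coeffs (at_right 0) (ratioK nu) xs (nu + lam) (nu - lam) gamma ->
     lower_bound_touching (B (nu + lam) (nu - lam) gamma) (ratioK nu) xs) /\
  (forall nu xs : R, 2 <= nu -> 0 < xs ->
     exists lam gamma, 1 / 2 < lam < 2 /\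
       best_coeffs (at_right 0) (ratioK nu) xs (nu + lam) (nu - lam) gamma) /\
  (* limits of the best bounds *)
  (forall nu : R, 1 / 2 <= nu ->
     best_bound_tends (at_right 0) (ratioI nu) (at_right 0)
       (B (nu - 2) (nu + 2) (sqrt ((nu + 2) / (nu + 1)))) /\
     best_bound_tends (at_right 0) (ratioI nu) (Rbar_locally p_infty)
       (B (nu - 1 / 2) (nu + 1 / 2) 1) /\
     best_bound_tends (Rbar_locally p_infty) (ratioI nu) (at_right 0)
       (B (nu - 1) (nu + 1) 1) /\
     best_bound_tends (Rbar_locally p_infty) (ratioI nu) (Rbar_locally p_infty)
       (B (nu - 1 / 2) (sqrt (nu ^ 2 - 1 / 4)) 1)) /\
  (forall nu : R, 2 <= nu ->
     best_bound_tends (at_right 0) (ratioK nu) (at_right 0)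
       (B (nu + 2) (nu - 2) (sqrt ((nu - 2) / (nu - 1)))) /\
     best_bound_tends (at_right 0) (ratioK nu) (Rbar_locally p_infty)
       (B (nu + 1 / 2) (nu - 1 / 2) 1) /\
     best_bound_tends (Rbar_locally p_infty) (ratioK nu) (at_right 0)
       (B (nu + 1) (nu - 1) 1) /\
     best_bound_tends (Rbar_locally p_infty) (ratioK nu) (Rbar_locally p_infty)
       (B (nu + 1 / 2) (sqrt (nu ^ 2 - 1 / 4)) 1)).
Proof.
  repeat match goal with |- _ /\ _ => split end.
  - intros nu xs Hnu Hxs. apply I_worst_case; lra.
  - intros nu xs Hnu Hxs. apply K_worst_case; lra.
  - intros nu lam xs beta Hl Hnu Hxs [Hi _].
    replace (nu - 1 / 2 - lam) with (nu - 1 * (lam + 1 / 2)) in * by ring.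
    apply I_touch_infty; lra || exact Hi.
  - intros nu xs Hnu Hxs. apply I_exists_infty; lra.
  - intros nu lam xs gamma Hl Hnu Hxs Hi _.
    replace (nu - lam) with (nu - 1 * lam) in * by ring.
    apply I_touch_0; [lra | lra | lra | | exact Hi]. f_equal. ring.
  - intros nu xs Hnu Hxs. now apply I_exists_0.
  - intros nu lam xs beta Hnu Hl Hxs [Hi _].
    replace (nu + 1 / 2 + lam) with (nu - -1 * (lam + 1 / 2)) in * by ring.
    apply K_touch_infty; lra || exact Hi.
  - intros nu xs Hnu Hxs. now apply K_exists_infty.
  - intros nu lam xs gamma Hl Hnu Hxs [Hi _].
    replace (nu + lam) with (nu - -1 * lam) in * by ring.
    apply K_touch_0; [lra | lra | lra | ring | exact Hi].
  - intros nu xs Hnu Hxs. apply K_exists_0; lra.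
  - intros nu Hnu. apply I_limits; lra.
  - intros nu Hnu. apply K_limits; lra.
Qed.
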